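(* Let $n\ge 1$, $p>1$, and let $\phi:\mathbb{R}^n\to[0,\infty)$ be bounded, continuous and not identically zero. Consider the Cauchy problem $$u_t=\Delta u+|u|^{p-1}u \ \text{ in } \mathbb{R}^n\times(0,+\infty),\qquad u(x,0)=\phi(x),\ x\in\mathbb{R}^n .$$ For $\alpha>0$ put $$D(\alpha)=\limsup_{r\to+\infty}\frac{\operatorname{mes}\bigl(\{x\mid \phi(x)\ge\alpha\}\cap B(0,r)\bigr)}{\operatorname{mes}\bigl(B(0,r)\bigr)} .$$ If $\infty$ is not a rarefaction point of $\phi$, then the solution of the Cauchy problem blows up in finite time $T^{*}$, and $$T^{*}\le \frac{1}{p-1}\inf_{\alpha>0}\bigl(\alpha D(\alpha)\bigr)^{1-p}.$$
   Context: $\operatorname{mes}$ denotes Lebesgue measure on $\mathbb{R}^n$ and $B(x,r)$ the ball centered at $x$ with radius $r$. $\infty$ is a point of rarefaction of a set $E\subset\mathbb{R}^n$ if $\lim_{r\to+\infty}\frac{\operatorname{mes}(B(0,r)\cap E)}{\operatorname{mes}(B(0,r))}=0$. $\infty$ is a rarefaction point of a non-negative function $\phi$ if for every $\alpha>0$ it is a point of rarefaction of the set $\{x\mid\phi(x)\ge\alpha\}$. Since $1-p<0$, the convention $0^{1-p}=+\infty$ is used when $D(\alpha)=0$. The solution $u$ of the Cauchy problem is the (unique, non-negative) maximal solution that is bounded on $\mathbb{R}^n\times[0,T]$ for every $T<T^*$, where $[0,T^* )$ is its maximal existence interval; it satisfies $$u(x,t)=\int_{\mathbb{R}^n}g(x,y,t)\phi(y)\,dy+\int_0^t\int_{\mathbb{R}^n}g(x,y,t-s)|u|^{p-1}u(y,s)\,dy\,ds,\qquad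 g(x,y,t)=\frac{1}{(4\pi t)^{n/2}}\exp\Bigl(-\frac{|x-y|^2}{4t}\Bigr).$$ It blows up in finite time $T^*$ (the life span) if $T^*<\infty$ and $\lim_{t\to T^{*-}}\|u(\cdot,t)\|_{L^\infty(\mathbb{R}^n)}=\infty$. *)

(* Defs.v *)
From HB Require Import structures.
From mathcomp Require Import all_boot all_order all_algebra.
From mathcomp Require Import all_classical all_reals all_analysis.

Set Implicit Arguments.
Unset Strict Implicit.
Unset Printing Implicit Defensive.

Import Order.TTheory GRing.Theory Num.Theory.
Import numFieldNormedType.Exports.

Local Open Scope classical_set_scope.
Local Open Scope ring_scope.

Definition rV_display : measure_display.
Proof. exact: default_measure_display. Qed.

(* R^n is 'rV[R]_n with the sigma-algebra generated by the n coordinates, i.e.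
   the Borel sigma-algebra. *)
Section measurable_rV.
Context (R : realType) (n : nat).

Let coords : 'I_n -> 'rV[R]_n -> measurableTypeR R := fun i x => x ord0 i.

Let rV_set0 : g_sigma_preimage coords set0.
Proof. exact: sigma_algebra0. Qed.

Let rV_setC A : g_sigma_preimage coords A -> g_sigma_preimage coords (~` A).
Proof. exact: sigma_algebraC. Qed.

Let rV_bigcup (F : (set 'rV[R]_n)^nat) :
  (forall i, g_sigma_preimage coords (F i)) ->
  g_sigma_preimage coords (\bigcup_i (F i)).
Proof. exact: sigma_algebra_bigcup. Qed.

HB.instance Definition _ := @isMeasurable.Build rV_display
  'rV[R]_n (g_sigma_preimage coords) rV_set0 rV_setC rV_bigcup.

End measurable_rV.

Section measurable_fun_rV.
Context (R : realType) d (T : measurableType d).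

Lemma measurable_coord n (i : 'I_n) :
  measurable_fun [set: 'rV[R]_n]
    ((fun x => x ord0 i) : 'rV[R]_n -> measurableTypeR R).
Proof.
move=> _ Y mY; rewrite setTI; apply: sub_sigma_algebra => /=.
rewrite -bigcup_seq/=; exists i => /=; first by rewrite mem_index_enum.
by exists Y => //; rewrite setTI.
Qed.

Lemma measurable_fun_rV n (f : T -> 'rV[R]_n) :
  (forall i, measurable_fun [set: T]
     ((fun t => f t ord0 i) : T -> measurableTypeR R)) ->
  measurable_fun [set: T] f.
Proof.
move=> mf _ A mA; rewrite setTI.
suff : measurable `<=` [set B : set 'rV[R]_n | measurable (f @^-1` B)] by exact.
apply: smallest_sub => [|B].
  split => /=; first by rewrite preimage_set0.
  - by move=> B mB; rewrite setTD preimage_setC; exact: measurableC.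
  - by move=> F mF; rewrite preimage_bigcup; exact: bigcup_measurable.
rewrite -bigcup_seq => -[i _ [C mC <-]] /=.
by rewrite setTI -comp_preimage -[X in measurable X]setTI; exact: (mf i).
Qed.

End measurable_fun_rV.

(* Lebesgue measure on R^n.+1 = R x R^n is the image of the product of the
   Lebesgue measures on R and on R^n. *)
Section lebesgue_step.
Context (R : realType) (n : nat).

Definition rV_cons (z : measurableTypeR R * 'rV[R]_n) : 'rV[R]_n.+1 :=
  row_mx (z.1)%:M z.2.

Definition rV_uncons (x : 'rV[R]_n.+1) : measurableTypeR R * 'rV[R]_n :=
  (x ord0 ord0, \row_i x ord0 (lift ord0 i)).

Lemma rV_cons0 z : rV_cons z ord0 ord0 = z.1.
Proof.
rewrite /rV_cons (_ : ord0 = lshift n (@ord0 0)); last exact/val_inj.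
by rewrite (@row_mxEl R 1 1 n) mxE eqxx mulr1n.
Qed.

Lemma rV_consS z i : rV_cons z ord0 (lift ord0 i) = z.2 ord0 i.
Proof.
rewrite /rV_cons (_ : lift ord0 i = rshift 1 i); last exact/val_inj.
by rewrite (@row_mxEr R 1 1 n).
Qed.

Lemma rV_consK : cancel rV_cons rV_uncons.
Proof.
case=> a v; rewrite /rV_uncons rV_cons0; congr pair.
by apply/rowP => i; rewrite mxE rV_consS.
Qed.

Lemma measurable_rV_cons : measurable_fun [set: _] rV_cons.
Proof.
apply: measurable_fun_rV => i.
case: (unliftP ord0 i) => [j ->|->].
  under eq_fun do rewrite rV_consS.
  exact: (measurableT_comp (@measurable_coord R n j) measurable_snd).
by under eq_fun do rewrite rV_cons0; exact: measurable_fst.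
Qed.

Lemma measurable_rV_uncons : measurable_fun [set: 'rV[R]_n.+1] rV_uncons.
Proof.
apply/measurable_fun_pairP; split; first exact: measurable_coord.
apply: measurable_fun_rV => i.
rewrite [X in measurable_fun _ X](_ : _ =
  (fun x : 'rV[R]_n.+1 => x ord0 (lift ord0 i))); first exact: measurable_coord.
by apply/funext => x /=; rewrite mxE.
Qed.

Context (mu : {sigma_finite_measure set 'rV[R]_n -> \bar R}).

Definition lebesgue_step : set 'rV[R]_n.+1 -> \bar R :=
  pushforward (lebesgue_measure \x mu)%E rV_cons.

Let lebesgue_step0 : lebesgue_step set0 = 0%E.
Proof. by rewrite /lebesgue_step /pushforward preimage_set0 measure0. Qed.

Let lebesgue_step_ge0 A : (0 <= lebesgue_step A)%E.
Proof. by rewrite /lebesgue_step /pushforward measure_ge0. Qed.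

Let lebesgue_step_sigma_additive : semi_sigma_additive lebesgue_step.
Proof.
move=> F mF tF mUF; rewrite /lebesgue_step /pushforward preimage_bigcup.
apply: measure_semi_sigma_additive.
- by move=> k; rewrite -[X in measurable X]setTI; exact: measurable_rV_cons.
- apply/trivIsetP => /= i j _ _ ij; rewrite -preimage_setI.
  by move/trivIsetP : tF => /(_ _ _ _ _ ij) ->//; rewrite preimage_set0.
- rewrite -preimage_bigcup -[X in measurable X]setTI.
  exact: measurable_rV_cons.
Qed.

HB.instance Definition _ := isMeasure.Build _ _ _ lebesgue_step
  lebesgue_step0 lebesgue_step_ge0 lebesgue_step_sigma_additive.

Let lebesgue_step_sigma_finite : sigma_finite setT lebesgue_step.
Proof.
have /sigma_finiteP[F [TF ndF Foo]] := sigma_finiteT (@lebesgue_measure R).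
have /sigma_finiteP[G [TG ndG Goo]] := sigma_finiteT mu.
exists (fun k => rV_uncons @^-1` (F k `*` G k)).
  rewrite -preimage_bigcup (_ : \bigcup_k _ = setT) ?preimage_setT//.
  apply/seteqP; split=> // -[a v] _.
  have : [set: measurableTypeR R] a by []. rewrite TF => -[k _ Fka].
  have : [set: 'rV[R]_n] v by []. rewrite TG => -[l _ Glv].
  exists (maxn k l) => //; split => /=.
  - by move: a Fka; exact/subsetPset/ndF/leq_maxl.
  - by move: v Glv; exact/subsetPset/ndG/leq_maxr.
move=> k; have [mF Fk] := Foo k; have [mG Gk] := Goo k; split.
  by rewrite -[X in measurable X]setTI; apply: measurable_rV_uncons => //;
    exact: measurableX.
rewrite /lebesgue_step /pushforward -comp_preimage.
rewrite (_ : _ \o _ = id) ?preimage_id; last exact/funext/rV_consK.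
by rewrite product_measure1E// lte_mul_pinfty// ge0_fin_numE.
Qed.

HB.instance Definition _ := Measure_isSigmaFinite.Build _ _ _ lebesgue_step
  lebesgue_step_sigma_finite.

End lebesgue_step.

Fixpoint lebesgue_rV (R : realType) (n : nat) :
    {sigma_finite_measure set 'rV[R]_n -> \bar R} :=
  if n is m.+1 then lebesgue_step (lebesgue_rV R m) else dirac (0 : 'rV[R]_0).

Section rarefaction.
Context (R : realType) (n : nat).
Implicit Types (E : set 'rV[R]_n) (phi : 'rV[R]_n -> R).

(* The norm provided by the library on 'rV[R]_n is the sup norm. *)
Definition enorm (x : 'rV[R]_n) : R := Num.sqrt (\sum_i x ord0 i ^+ 2).

Definition eball (x : 'rV[R]_n) (r : R) : set 'rV[R]_n :=
  [set y | enorm (y - x) < r].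

Definition density E (r : R) : \bar R :=
  (lebesgue_rV R n (E `&` eball 0%R r) / lebesgue_rV R n (eball 0%R r))%E.

Definition rarefaction_set E := density E r @[r --> +oo] --> 0%E.

Definition rarefaction_fun phi :=
  forall a : R, 0 < a -> rarefaction_set [set x | a <= phi x].

Definition upper_density phi (a : R) : \bar R :=
  limf_esup (density [set x | a <= phi x]) (pinfty_nbhs R).

End rarefaction.

(* The library has 0 `^ r = 0 when r < 0. *)
Definition npoweR (R : realType) (x : \bar R) (r : R) : \bar R :=
  if x == 0%E then +oo%E else (x `^ r)%E.

Section cauchy_problem.
Context (R : realType) (n : nat).
Implicit Types (u : 'rV[R]_n -> R -> R) (T : \bar R).

Definition heat_kernel (x y : 'rV[R]_n) (t : R) : R :=
  ((4 * pi * t) `^ (n%:R / 2))^-1 * expR (- (enorm (x - y) ^+ 2 / (4 * t))).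

Definition laplacian (f : 'rV[R]_n -> R) (x : 'rV[R]_n) : R :=
  \sum_(i < n) 'D_(delta_mx ord0 i) ('D_(delta_mx ord0 i) f) x.

Definition reaction (p v : R) : R := `|v| `^ (p - 1) * v.

(* The values u x t with t outside [0, T[ are irrelevant. All the integrands
   are nonnegative, so that the integrals make sense in \bar R. Continuity of
   the derivatives is not required: it follows from solution_integral. *)
Record is_solution (p : R) (phi : 'rV[R]_n -> R) (T : \bar R) u : Prop := {
  solution_continuous :
    {within [set z : 'rV[R]_n * R | 0 <= z.2 /\ (z.2%:E < T)%E],
      continuous (fun z => u z.1 z.2)} ;
  solution_initial : forall x, u x 0 = phi x ;
  solution_derivable : forall x t, 0 < t -> (t%:E < T)%E ->
    derivable (u x) t 1 /\
    forall i, derivable (u ^~ t) x (delta_mx ord0 i) /\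
      derivable ('D_(delta_mx ord0 i) (u ^~ t)) x (delta_mx ord0 i) ;
  solution_equation : forall x t, 0 < t -> (t%:E < T)%E ->
    'D_1 (u x) t = laplacian (u ^~ t) x + reaction p (u x t) ;
  solution_ge0 : forall x t, 0 <= t -> (t%:E < T)%E -> 0 <= u x t ;
  solution_bounded : forall S : R, (S%:E < T)%E ->
    exists M : R, forall x t, 0 <= t <= S -> `|u x t| <= M ;
  solution_integral : forall x t, 0 < t -> (t%:E < T)%E ->
    ((u x t)%:E =
      \int[lebesgue_rV R n]_y (heat_kernel x y t * phi y)%:E +
      \int[lebesgue_measure]_(s in `[0%R, t])
        \int[lebesgue_rV R n]_y
          (heat_kernel x y (t - s) * reaction p (u y s))%:E)%E
}.

Definition is_maximal_solution (p : R) (phi : 'rV[R]_n -> R) T u : Prop :=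
  [/\ (0 < T)%E, is_solution p phi T u &
    forall T' v, (T <= T')%E -> is_solution p phi T' v ->
      (forall x t, 0 <= t -> (t%:E < T)%E -> v x t = u x t) -> T' = T].

Definition blows_up T u : Prop :=
  (T < +oo)%E /\
  Lnorm (lebesgue_rV R n) +oo%E (fun x => (u x t)%:E) @[t --> (fine T)^'-]
    --> +oo%E.

End cauchy_problem.

(* Main.v *)
Require Import Defs.
From HB Require Import structures.
From mathcomp Require Import all_boot all_order all_algebra.
From mathcomp Require Import all_classical all_reals all_analysis.
From mathcomp Require Import measurable_realfun ess_sup_inf ring lra.

(* Write P_t for the heat semigroup. For a solution u and x fixed, Jensen's
   inequality applied to the mild formula shows that w(s) = P_{t-s} u(s) (x)
   satisfies w' >= w^p; since w stays finite up to time t, this forces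
   (p - 1) t <= (P_t phi (x))^(1-p). On the other hand, averaging P_t phi over
   large balls shows that sup_x P_t phi (x) >= a D(a), which bounds the life
   span. If ||u(t)||_oo did not tend to +oo at T, then u would be bounded on
   [0, T[, and monotone iteration of the mild formula, started from u extended
   by 0, would extend it past T as a bounded mild solution. A bounded mild
   solution is classical: differentiating its mild formula once shows that its
   gradient satisfies an equation of the same form, so that the gradient can be
   differentiated again. This contradicts maximality. *)
Set Implicit Arguments.
Unset Strict Implicit.
Unset Printing Implicit Defensive.

Import Order.TTheory GRing.Theory Num.Theory.
Import numFieldNormedType.Exports.

Local Open Scope classical_set_scope.
Local Open Scope ring_scope.

(** * Borel sets and integrals in R^n *)

Section measurable_rV_topology.
Context (R : realType).

(** Four obstacles shape the proof. The differential inequality for w is only used through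
    increments, w(s2) >= w(s1) + (s2 - s1) w(s1)^p, so that an Euler scheme replaces the integration
    of an ODE. The second derivatives of the heat kernel have size 1/t, which is not integrable at
    0: the Duhamel term cannot be differentiated twice under the integral, and one derivative has to
    be moved onto the source, whence the equation for the gradient. As phi is only continuous, the
    gradient may grow like t^(-1/2) at time 0, and its equation is started from a positive time.
    Finally, a maximal solution is only known to be bounded on each [0, S] with S < T. The bound up
    to T comes from a time t1 close to T at which u is at most A: a solution below A at time t1
    stays below 2 A for a time depending on A and p alone. The iteration starts from u extended by
    0, so that all iterates coincide with u on ]0, T[ and no gluing at T is required; being monotone
    and bounded, it converges without any contraction estimate. *)

Lemma open_measurable_rV n (U : set 'rV[R]_n) : open U -> measurable U.
Proof.
move=> oU.
(* Boxes with rational centre and radius 1 / (k + 1) form a countable base of the topology, and each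
   of them is a finite intersection of preimages under coordinates. *)
pose box (q : 'rV[rat]_n * nat) : set 'rV[R]_n :=
  \bigcap_(i in [set: 'I_n])
    ((fun x : 'rV[R]_n => (x ord0 i : measurableTypeR R)) @^-1`
      ball (ratr (q.1 ord0 i) : R) (q.2.+1%:R^-1)).
pose V q := if `[< box q `<=` U >] then box q else set0.
have -> : U = \bigcup_(q in [set: 'rV[rat]_n * nat]) V q.
  apply/seteqP; split=> [x Ux|x [q _]]; last first.
    by rewrite /V; case: asboolP => // qU /qU.
  have /nbhs_ballP[e /= e0 eU] : nbhs x U by exact: open_nbhs_nbhs.
  have e20 : 0 < e / 2 by rewrite divr_gt0.
  pose k := Num.truncn (e / 2)^-1.
  have ke : k.+1%:R^-1 < e / 2.
    rewrite invf_plt ?posrE//.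
    exact: truncnS_gt.
  have /choice[q qP] : forall i : 'I_n, exists q : rat,
      ratr q \in `]x ord0 i - k.+1%:R^-1, x ord0 i + k.+1%:R^-1[%R.
    by move=> i; apply: rat_in_itvoo; rewrite ltrBlDr -addrA ltrDl addr_gt0.
  have Hb i : `|x ord0 i - ratr (q i)| < k.+1%:R^-1.
    have := qP i; rewrite in_itv/= => /andP[A B].
    by rewrite distrC ltr_norml ltrBrDl A ltrBlDl B.
  exists (\row_i q i, k) => //.
  have bU : box (\row_i q i, k) `<=` U.
    move=> y xy; apply: eU; split=> // i j; rewrite ord1/=.
    rewrite /ball/=.
    have := xy j Logic.I; rewrite /= /ball/= mxE => yq.
    have := Hb j => xq.
    rewrite (_ : _ - _ = (x ord0 j - ratr (q j)) + (ratr (q j) - y ord0 j)); last by ring.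
    rewrite (le_lt_trans (ler_normD _ _))// (splitr e) ltrD//.
    - exact: lt_trans xq ke.
    - exact: lt_trans yq ke.
  rewrite /V asboolT// => i _ /=.
  by rewrite /ball/= mxE distrC.
apply: countable_bigcupT_measurable; first exact: countableP.
move=> q; rewrite /V; case: asboolP => _ //.
apply: fin_bigcap_measurable; first exact: finite_finset.
move=> i _; rewrite -[X in measurable X]setTI.
by apply: measurable_coord => //; exact: measurable_ball.
Qed.

Lemma measurable_rV_snoc n :
  measurable_fun [set: 'rV[R]_n * measurableTypeR R]
    (fun z => rV_cons (z.2, z.1)).
Proof.
apply: (measurableT_comp (@measurable_rV_cons R n)).
apply/measurable_fun_pairP; split => /=; [exact: measurable_snd|exact: measurable_fst].
Qed.

Lemma continuous_at_ball (X : topologicalType) (Y : pseudoMetricType R) (f : X -> Y) x :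
  (forall e, 0 < e -> \forall y \near x, ball (f x) e (f y)) -> {for x, continuous f}.
Proof. by move=> H; apply/cvg_ballP. Qed.

Lemma continuous_rV_unsnoc n :
  continuous (fun x : 'rV[R]_n.+1 => ((rV_uncons x).2, (rV_uncons x).1 : R) : 'rV[R]_n * R).
Proof.
move=> x; apply: continuous_at_ball => e e0; near=> y.
have : ball x e y by near: y; exact: nbhsx_ballx.
move=> [_ xy]; split; last exact: xy.
by split => // i j; rewrite !mxE; exact: xy.
Unshelve. all: by end_near. Qed.

(** Transferred from R^(n+1): moving the last component to the front is measurable, its inverse is
    continuous, and so U is the preimage of an open set of R^(n+1). *)
Lemma open_measurable_rV_R n (U : set ('rV[R]_n * R)) :
  open U -> measurable (U : set ('rV[R]_n * measurableTypeR R)).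
Proof.
move=> oU.
have := @measurable_rV_snoc n measurableT _ (open_measurable_rV
  (open_comp (fun x _ => @continuous_rV_unsnoc n x) oU)).
rewrite setTI -comp_preimage/=.
set f := (X in X @^-1` _); suff -> : f = id by rewrite preimage_id.
apply/funext => -[a b].
change (((rV_uncons (rV_cons (b, a))).2, (rV_uncons (rV_cons (b, a))).1) = (a, b)).
by rewrite rV_consK.
Qed.

Lemma continuous_open_preimage (X : topologicalType) (U : set X) (f : X -> R) (B : set R) :
  open U -> open B -> {in U, continuous f} -> open (U `&` f @^-1` B).
Proof.
move=> oU oB cf; rewrite openE => x [Ux Bx]; apply: filterI.
  exact: open_nbhs_nbhs.
apply: cf; first exact/mem_set.
exact: open_nbhs_nbhs.
Qed.

Lemma open_continuous_measurable_rV n (U : set 'rV[R]_n) (f : 'rV[R]_n -> R) :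
  open U -> {in U, continuous f} -> measurable_fun U f.
Proof.
move=> oU cf; apply: (measurability _ (RGenOpens.measurableE R)).
move=> _ [_ [a [b ->] <-]]; apply: open_measurable_rV.
by apply: continuous_open_preimage => //; exact: interval_open.
Qed.

Lemma open_continuous_measurable_rV_R n (U : set ('rV[R]_n * R))
    (f : 'rV[R]_n * R -> R) :
  open U -> {in U, continuous f} ->
  measurable_fun (U : set ('rV[R]_n * measurableTypeR R)) f.
Proof.
move=> oU cf; apply: (measurability _ (RGenOpens.measurableE R)).
move=> _ [_ [a [b ->] <-]]; apply: open_measurable_rV_R.
by apply: continuous_open_preimage => //; exact: interval_open.
Qed.

End measurable_rV_topology.

Section integral_rV.
Context (R : realType).
Local Open Scope ereal_scope.

Lemma measurable_integral_rV d (T : measurableType d) n (f : T * 'rV[R]_n -> \bar R) :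
  measurable_fun [set: T * 'rV[R]_n] f -> (forall z, 0 <= f z) ->
  measurable_fun [set: T] (fun x => \int[lebesgue_rV R n]_y f (x, y)).
Proof. exact: measurable_fun_fubini_tonelli_F. Qed.

Lemma ge0_integral_rVS n (f : 'rV[R]_n.+1 -> \bar R) :
  measurable_fun [set: 'rV[R]_n.+1] f -> (forall x, 0 <= f x) ->
  \int[lebesgue_rV R n.+1]_x f x =
  \int[lebesgue_measure]_a \int[lebesgue_rV R n]_v f (rV_cons (a, v)).
Proof.
move=> mf f0.
transitivity (\int[pushforward (lebesgue_measure \x lebesgue_rV R n)%E (@rV_cons R n)]_x f x) => //.
rewrite (ge0_integral_pushforward (measurable_rV_cons (n:=n)))// preimage_setT.
rewrite (fubini_tonelli1 (f \o @rV_cons R n)) => [//||x]; last exact: f0.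
exact: measurableT_comp mf (@measurable_rV_cons R n).
Qed.

(** The image of Lebesgue measure under x |-> c x + b, multiplied by c, agrees with Lebesgue measure
    on half-open intervals, hence everywhere by uniqueness. *)
Lemma lebesgue_measure_affine (c b : R) (f : R -> \bar R) : (0 < c)%R ->
  measurable_fun [set: R] f -> (forall x, 0 <= f x) ->
  \int[lebesgue_measure]_x f x = c%:E * \int[lebesgue_measure]_x f (c * x + b)%R.
Proof.
move=> c0 mf f0.
pose phi (x : measurableTypeR R) : measurableTypeR R := (c * x + b)%R.
have mphi : measurable_fun [set: measurableTypeR R] phi.
  by apply: measurable_funD => //; exact: mulrl_measurable.
pose cn := NngNum (ltW c0).
rewrite (_ : \int[lebesgue_measure]_x f (c * x + b)%R =
  \int[pushforward lebesgue_measure phi]_x f x); last first.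
  by rewrite ge0_integral_pushforward.
have -> : c%:E = cn%:num%:E by [].
rewrite -ge0_integral_mscale//.
apply: eq_measure_integral => A mA _.
apply: (@lebesgue_measure_unique R (mscale cn (pushforward lebesgue_measure phi))) => //.
move=> X [[u v] _ <-].
have E : phi @^-1` `]u, v]%classic = `]((u - b) / c)%R, ((v - b) / c)%R]%classic.
  apply/seteqP; split => x; rewrite /phi /= !in_itv/= ltr_pdivrMr// ler_pdivlMr//;
    by rewrite ltrBlDr lerBrDr ![(x * c)%R]mulrC.
apply: etrans (esym (congr1 (fun Z => c%:E * lebesgue_measure Z) E)).
rewrite !lebesgue_measure_itv/= !lte_fin.
rewrite ltr_pM2r ?invr_gt0// ltrD2r; case: ifPn => _; last by rewrite mule0.
by rewrite -!EFinD -EFinM; congr EFin; field; rewrite gt_eqF.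
Qed.

Lemma measurable_affine_rV n (c : R) (v : 'rV[R]_n) :
  measurable_fun [set: 'rV[R]_n] (fun y : 'rV[R]_n => c *: y + v)%R.
Proof.
apply: measurable_fun_rV => i.
rewrite (_ : (fun _ => _) = (fun t : 'rV[R]_n => c * t ord0 i + v ord0 i)%R); last first.
  by apply/funext => t; rewrite !mxE.
apply: measurable_funD => //; apply: measurable_funM => //; exact: measurable_coord.
Qed.

Lemma rV_cons_affine n (c a : R) (w : 'rV[R]_n) (v : 'rV[R]_n.+1) :
  rV_cons ((c * a + v ord0 ord0)%R, (c *: w + (rV_uncons v).2)%R) =
  (c *: rV_cons (a, w) + v)%R.
Proof.
apply/rowP => i; case: (unliftP ord0 i) => [j ->|->].
  by rewrite rV_consS/= mxE [RHS]mxE mxE [in RHS]mxE rV_consS mxE.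
by rewrite rV_cons0/= mxE [in RHS]mxE rV_cons0.
Qed.

(** Induction on n by Tonelli, the measure on R^(n+1) being by definition the image of a product.
    Dilations will give the volume of balls, translations the derivative of the flow along the
    data. *)
Lemma ge0_integral_affine n (c : R) (v : 'rV[R]_n) (f : 'rV[R]_n -> \bar R) : (0 < c)%R ->
  measurable_fun [set: 'rV[R]_n] f -> (forall x, 0 <= f x) ->
  \int[lebesgue_rV R n]_x f x = (c ^+ n)%:E * \int[lebesgue_rV R n]_x f (c *: x + v)%R.
Proof.
move=> c0; elim: n v f => [|n IH] v f mf f0.
  rewrite expr0 mul1e; apply: eq_integral => x _; congr f.
  by apply/rowP => -[].
rewrite ge0_integral_rVS// ge0_integral_rVS//; last first.
  exact: measurableT_comp mf (measurable_affine_rV c v).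
have mf2 a : measurable_fun [set: 'rV[R]_n] (fun w => f (rV_cons (a, w))).
  apply: (measurableT_comp mf).
  apply: (measurableT_comp (@measurable_rV_cons R n)).
  by apply/measurable_fun_pairP; split; [exact: measurable_cst|exact: measurable_id].
have mg : measurable_fun [set: measurableTypeR R * 'rV[R]_n] (f \o @rV_cons R n).
  exact: measurableT_comp mf (@measurable_rV_cons R n).
rewrite (@lebesgue_measure_affine c (v ord0 ord0))//; last 2 first.
  exact: (measurable_integral_rV mg (fun _ => f0 _)).
  by move=> x; exact: integral_ge0.
pose v' := (rV_uncons v).2.
under eq_integral do rewrite (IH v')//.
rewrite ge0_integralZl//; last 3 first.
- pose h (z : measurableTypeR R * 'rV[R]_n) := f (rV_cons ((c * z.1 + v ord0 ord0)%R, (c *: z.2 + v')%R)).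
  apply: (@measurable_integral_rV _ _ n h) => [|z]; last exact: f0.
  rewrite (_ : h = fun z => f (c *: rV_cons z + v)%R).
    exact: (measurableT_comp (measurableT_comp mf (measurable_affine_rV c v)) (@measurable_rV_cons R n)).
  by apply/funext => -[a w]; rewrite /h/= rV_cons_affine.
- by move=> *; apply: integral_ge0.
- by rewrite lee_fin exprn_ge0// ltW.
rewrite muleA -EFinM -exprS; congr (_ * _).
by apply: eq_integral => a _; apply: eq_integral => w _; rewrite rV_cons_affine.
Qed.

End integral_rV.

(** * The heat kernel *)

Section kernel_algebra.
Context (R : realType).

(** Writing 1/x as x (x^2)^(-1) brings in the power function, which only sees nonnegative numbers;
    at 0 both sides are 0. *)
Lemma measurable_invr : measurable_fun [set: R] (fun x : R => x^-1).
Proof.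
rewrite (_ : (fun _ => _) = (fun x : R => x * (x ^+ 2) `^ (-1))).
  apply: measurable_funM => //.
  by apply: (measurableT_comp (measurable_powR (-1))); exact: exprn_measurable.
apply/funext => x; rewrite powR_inv1 ?sqr_ge0//.
have [->|x0] := eqVneq x 0; first by rewrite mul0r invr0.
by field.
Qed.

Variable n : nat.
Implicit Types (x y z : 'rV[R]_n) (t h : R).

Definition sqdist x y : R := \sum_i (x ord0 i - y ord0 i) ^+ 2.

Lemma sqdist_ge0 x y : 0 <= sqdist x y.
Proof. by apply: sumr_ge0 => i _; exact: sqr_ge0. Qed.

Lemma sqdistC x y : sqdist x y = sqdist y x.
Proof. by apply: eq_bigr => i _; ring. Qed.

Lemma sqr_enorm x y : enorm (x - y) ^+ 2 = sqdist x y.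
Proof.
rewrite sqr_sqrtr; last by apply: sumr_ge0 => i _; exact: sqr_ge0.
by apply: eq_bigr => i _; rewrite !mxE.
Qed.

Lemma sqdist_coord x y i : (x ord0 i - y ord0 i) ^+ 2 <= sqdist x y.
Proof.
rewrite /sqdist (bigD1 i)//= lerDl; apply: sumr_ge0 => j _; exact: sqr_ge0.
Qed.

(* From 2 a b >= - (2 a^2 + b^2 / 2) applied coordinatewise. *)
Lemma sqdist_shift x y z : sqdist z y / 2 - sqdist x z <= sqdist x y.
Proof.
rewrite /sqdist mulr_suml -sumrB; apply: ler_sum => i _.
rewrite -subr_ge0 (_ : _ - _ = 2^-1 * (2 * (x ord0 i - z ord0 i) + (z ord0 i - y ord0 i)) ^+ 2).
  by rewrite mulr_ge0// sqr_ge0.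
by field.
Qed.

Lemma heat_kernelE x y t :
  heat_kernel x y t = ((4 * pi * t) `^ (n%:R / 2))^-1 * expR (- (sqdist x y / (4 * t))).
Proof. by rewrite /heat_kernel sqr_enorm. Qed.

Lemma heat_kernelC x y t : heat_kernel x y t = heat_kernel y x t.
Proof. by rewrite !heat_kernelE sqdistC. Qed.

Lemma heat_kernel_ge0 x y t : 0 <= heat_kernel x y t.
Proof. by rewrite mulr_ge0// ?expR_ge0// invr_ge0 powR_ge0. Qed.

Lemma heat_kernel_scale x y t (c : R) : 0 < t -> 0 < c ->
  heat_kernel x y t =
  c `^ (n%:R / 2) * expR (- (sqdist x y / (4 * t) * (1 - c^-1))) * heat_kernel x y (c * t).
Proof.
move=> t0 c0; rewrite !heat_kernelE.
rewrite (_ : 4 * pi * (c * t) = c * (4 * pi * t)); last by ring.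
have p0 : 0 < 4 * pi * t by rewrite !mulr_gt0 ?pi_gt0.
rewrite (powRM _ (ltW c0) (ltW p0)).
have d0 : c `^ (n%:R / 2) != 0 by rewrite gt_eqF// powR_gt0.
have e0 : (4 * pi * t) `^ (n%:R / 2) != 0 by rewrite gt_eqF// powR_gt0.
rewrite (_ : - (sqdist x y / (4 * t)) = - (sqdist x y / (4 * t) * (1 - c^-1)) - sqdist x y / (4 * (c * t))).
  by rewrite expRD; field; rewrite d0 e0.
by field; rewrite !gt_eqF.
Qed.

(** The kernel at time t is the kernel at time 2 t multiplied by 2^(n/2) exp (- |x - y|^2 / (8 t)).
    The exponential absorbs polynomial factors such as those of the derivatives. *)
Lemma heat_kernel_dom x y t (a C : R) : 0 < t ->
  a <= C * expR (sqdist x y / (8 * t)) ->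
  a * heat_kernel x y t <= C * 2 `^ (n%:R / 2) * heat_kernel x y (2 * t).
Proof.
move=> t0 aC; rewrite (@heat_kernel_scale x y t 2)//.
rewrite mulrA ler_wpM2r ?heat_kernel_ge0//.
rewrite mulrCA mulrC ler_wpM2r ?powR_ge0//.
rewrite expRN ler_pdivrMr ?expR_gt0// (le_trans aC)//.
rewrite le_eqVlt; apply/orP; left; apply/eqP; congr (_ * expR _).
by field; rewrite gt_eqF.
Qed.

(** A pointwise second moment bound, from z <= exp z. It acts as a Chebyshev inequality, both for
    the mass leaving a ball and for the limit of the flow at time 0. *)
Lemma sqdist_heat_kernel x y t : 0 < t ->
  sqdist x y * heat_kernel x y t <= 8 * t * 2 `^ (n%:R / 2) * heat_kernel x y (2 * t).
Proof.
move=> t0; apply: heat_kernel_dom => //.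
have t8 : 0 < 8 * t by rewrite mulr_gt0.
rewrite -ler_pdivrMl// mulrC; apply: le_trans (expR_ge1Dx _).
by rewrite lerDr.
Qed.

Definition dheat_kernel (i : 'I_n) x y (t : R) : R :=
  - ((x ord0 i - y ord0 i) / (2 * t)) * heat_kernel x y t.

Definition d2heat_kernel (i : 'I_n) x y (t : R) : R :=
  ((x ord0 i - y ord0 i) ^+ 2 / (4 * t ^+ 2) - (2 * t)^-1) * heat_kernel x y t.

(** The point is the rate t^(-1/2), which is integrable at 0. With r = sqrt t and w = |x_i - y_i|,
    it rests on w / (2 r) <= 1 + w^2 / (8 r^2) <= exp (|x - y|^2 / (8 t)). *)
Lemma dheat_kernel_le i x y t : 0 < t ->
  `|dheat_kernel i x y t| <= (Num.sqrt t)^-1 * 2 `^ (n%:R / 2) * heat_kernel x y (2 * t).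
Proof.
move=> t0; rewrite /dheat_kernel normrM (ger0_norm (heat_kernel_ge0 _ _ _)).
apply: heat_kernel_dom => //; rewrite normrN.
set r := Num.sqrt t; have r0 : 0 < r by rewrite sqrtr_gt0.
have tr : t = r ^+ 2 by rewrite sqr_sqrtr// ltW.
rewrite tr -ler_pdivrMl ?invr_gt0// invrK.
apply: le_trans (_ : 1 + (x ord0 i - y ord0 i) ^+ 2 / (8 * r ^+ 2) <= _).
  rewrite -[(x ord0 i - y ord0 i) ^+ 2]real_normK ?num_real// normrM; set w := `|_ - _|.
  rewrite (ger0_norm (_ : 0 <= (2 * r ^+ 2)^-1)); last first.
    by rewrite invr_ge0 mulr_ge0// sqr_ge0.
  rewrite -subr_ge0 (_ : _ - _ = (1/8) * ((w / r - 2) ^+ 2 + 4)).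
    by rewrite mulr_ge0// addr_ge0// sqr_ge0.
  by field; rewrite gt_eqF.
apply: le_trans (expR_ge1Dx _).
by rewrite lerD2l ler_wpM2r ?sqdist_coord// invr_ge0 mulr_ge0// sqr_ge0.
Qed.

(** For t <= 2 t0 the Gaussian exponent is at least |x - y|^2 / (8 t0). One half of it absorbs 1 +
    |x - y|^2, at the cost of 1 + 16 t0. By [sqdist_shift] the other half is at least |x0 - y|^2 /
    (32 t0) - 1/16, which is the exponent of the kernel at time 8 t0 up to the factor exp (1/16). *)
Lemma heat_kernel_local_dom (t0 : R) : 0 < t0 -> exists2 C, 0 <= C &
  forall x0 x y t, sqdist x x0 <= t0 -> t0 / 2 <= t <= 2 * t0 ->
  (1 + sqdist x y) * heat_kernel x y t <= C * heat_kernel x0 y (8 * t0).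
Proof.
move=> t0p; pose c1 := ((4 * pi * (t0 / 2)) `^ (n%:R / 2))^-1.
pose c2 := ((4 * pi * (8 * t0)) `^ (n%:R / 2)).
have c10 : 0 <= c1 by rewrite invr_ge0 powR_ge0.
have c20 : 0 < c2 by rewrite powR_gt0// !mulr_gt0 ?pi_gt0.
exists ((1 + 16 * t0) * expR (1/16) * c1 * c2).
  by rewrite !mulr_ge0 ?expR_ge0// ?(ltW c20)// addr_ge0// mulr_ge0// ltW.
move=> x0 x y t xx0 /andP[tl tu].
have tp : 0 < t by apply: lt_le_trans tl; rewrite divr_gt0.
rewrite !heat_kernelE -/c2.
rewrite [leRHS](_ : _ = c1 * ((1 + 16 * t0) * expR (1/16) * expR (- (sqdist x0 y / (4 * (8 * t0)))))); last first.
  by field; rewrite gt_eqF.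
rewrite mulrCA; apply: ler_pM => //.
- by rewrite invr_ge0 powR_ge0.
- by rewrite mulr_ge0 ?expR_ge0// addr_ge0// sqdist_ge0.
- rewrite /c1 lef_pV2 ?posrE ?powR_gt0//; last 2 first.
    by rewrite !mulr_gt0 ?pi_gt0.
    by rewrite !mulr_gt0 ?pi_gt0// divr_gt0.
  apply: ge0_ler_powR; rewrite ?nnegrE ?divr_ge0//.
  + by rewrite !mulr_ge0 ?pi_ge0// ltW// divr_gt0.
  + by rewrite !mulr_ge0 ?pi_ge0// ltW.
  + by rewrite ler_wpM2l// mulr_ge0 ?pi_ge0.
have q0 := sqdist_ge0 x y.
apply: (@le_trans _ _ ((1 + 16 * t0) * (expR (sqdist x y / (16 * t0)) * expR (- (sqdist x y / (8 * t0)))))).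
  rewrite mulrA; apply: ler_pM; rewrite ?expR_ge0 ?addr_ge0//.
    apply: le_trans (_ : (1 + 16 * t0) * (1 + sqdist x y / (16 * t0)) <= _); last first.
      by rewrite ler_wpM2l ?expR_ge1Dx// addr_ge0// mulr_ge0// ltW.
    rewrite -subr_ge0 (_ : _ - _ = 16 * t0 + sqdist x y / (16 * t0)).
      by rewrite addr_ge0 ?divr_ge0 ?mulr_ge0// ltW.
    by field; rewrite gt_eqF.
  rewrite ler_expR lerN2 ler_wpM2l// lef_pV2 ?posrE ?mulr_gt0//.
  by rewrite (_ : 8 * t0 = 4 * (2 * t0)) ?ler_wpM2l//; ring.
rewrite -mulrA ler_wpM2l ?addr_ge0 ?mulr_ge0 ?(ltW t0p)//.
rewrite -!expRD ler_expR.
have := sqdist_shift x y x0.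
rewrite -subr_ge0 => H.
rewrite -subr_ge0 (_ : _ - _ = (sqdist x y - (sqdist x0 y / 2 - sqdist x x0)) / (16 * t0) + (t0 - sqdist x x0) / (16 * t0)).
  have t16 : 0 <= 16 * t0 by rewrite mulr_ge0// ltW.
  by apply: addr_ge0; apply: divr_ge0; rewrite ?subr_ge0// -subr_ge0.
by field; rewrite gt_eqF.
Qed.

Lemma sqdist_delta x y i h : sqdist (h *: delta_mx ord0 i + x) y =
  sqdist x y + 2 * h * (x ord0 i - y ord0 i) + h ^+ 2.
Proof.
rewrite /sqdist !(bigD1 (P := predT) i)//= !mxE !eqxx mulr1.
rewrite (_ : \sum_(j < n | j != i) _ = \sum_(j < n | j != i) (x ord0 j - y ord0 j) ^+ 2); first ring.
apply: eq_bigr => j ji; rewrite !mxE (negbTE ji) andbF/= mulr0 add0r//.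
Qed.

Lemma is_derive_heat_kernel i x y t (h : R) : 0 < t ->
  is_derive h 1 (fun h => heat_kernel (h *: delta_mx ord0 i + x) y t)
    (dheat_kernel i (h *: delta_mx ord0 i + x) y t).
Proof.
move=> t0.
rewrite /dheat_kernel !mxE !eqxx mulr1.
under eq_fun do rewrite heat_kernelE.
pose f (h : R) := - ((sqdist x y + 2 * h * (x ord0 i - y ord0 i) + h ^+ 2) / (4 * t)).
rewrite heat_kernelE.
under eq_fun do rewrite sqdist_delta -/(f _).
rewrite sqdist_delta -/(f h).
have df : is_derive h 1 f (- ((h + x ord0 i - y ord0 i) / (2 * t))).
  rewrite /f; apply: is_derive_eq.
  rewrite /GRing.scale/=; field; rewrite gt_eqF//.
have H := is_derive1_comp (is_derive_expR (f h)) df.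
have := @is_deriveZ _ _ _ (expR \o f) ((4 * pi * t) `^ (n%:R / 2))^-1 h 1 _ H.
by rewrite /GRing.scale/= mulrA [RHS in is_derive _ _ _ RHS]mulrC.
Qed.

Lemma is_derive_dheat_kernel i x y t (h : R) : 0 < t ->
  is_derive h 1 (fun h => dheat_kernel i (h *: delta_mx ord0 i + x) y t)
    (d2heat_kernel i (h *: delta_mx ord0 i + x) y t).
Proof.
move=> t0; have t00 : t != 0 by rewrite gt_eqF.
rewrite /dheat_kernel /d2heat_kernel !mxE !eqxx mulr1.
have H := is_derive_heat_kernel i x y h t0.
under eq_fun do rewrite !mxE !eqxx mulr1.
apply: is_derive_eq.
rewrite /dheat_kernel !mxE !eqxx mulr1 /GRing.scale/=.
by field.
Qed.

(** The heat equation for the kernel: both sides are the kernel times |x - y|^2 / (4 t^2) - n / (2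
    t). *)
Lemma is_derive_time_heat_kernel x y t : 0 < t ->
  is_derive t 1 (heat_kernel x y) (\sum_i d2heat_kernel i x y t).
Proof.
move=> t0; have t00 : t != 0 by rewrite gt_eqF.
rewrite (_ : \sum_i _ = (sqdist x y / (4 * t ^+ 2) - n%:R / (2 * t)) * heat_kernel x y t); last first.
  rewrite /sqdist mulr_suml [_ / (2 * t)]mulr_natl.
  by rewrite -[in X in _ - X](card_ord n) -sumr_const -sumrB mulr_suml.
rewrite (_ : heat_kernel x y = fun s => (4 * pi * s) `^ (- (n%:R / 2)) * expR (- (sqdist x y / (4 * s)))); last first.
  by apply/funext => s; rewrite heat_kernelE -powRN.
have p0 : 0 < 4 * pi * t :> R by rewrite !mulr_gt0 ?pi_gt0.
have d1 : is_derive t 1 (fun s : R => 4 * pi * s) (4 * pi).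
  by apply: is_derive_eq; rewrite /GRing.scale/= mulr1.
have H1 := is_derive1_comp (is_derive1_powR (- (n%:R / 2)) p0) d1.
have d2 : is_derive t 1 (fun s : R => - (sqdist x y / (4 * s))) (sqdist x y / (4 * t ^+ 2)).
  have d3 : is_derive t 1 (fun s : R => 4 * s) 4.
    by apply: is_derive_eq; rewrite /GRing.scale/= mulr1.
  have nz : 4 * t != 0 by rewrite mulf_neq0.
  have := is_deriveV nz d3 => d4.
  apply: is_derive_eq.
  rewrite /GRing.scale/=; by field.
have H2 := @is_derive1_comp _ expR (fun s : R => - (sqdist x y / (4 * s))) t _ _
  (is_derive_expR _) d2.
have H3 := is_deriveM H1 H2.
apply: is_derive_eq; rewrite /GRing.scale/=.
have -> : (4 * pi * t) `^ (- (n%:R / 2) - 1) = (4 * pi * t) `^ (- (n%:R / 2)) / (4 * pi * t).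
  by rewrite powRD ?powR_inv1 ?(ltW p0)// (gt_eqF p0) implybT.
have pi0 : pi != 0 :> R by rewrite gt_eqF ?pi_gt0.
set P := powR _ _; set E := expR _; move: (sqdist x y) => q.
clearbody P E; move: (pi) pi0 => w w0; by field; rewrite t00.
Qed.

End kernel_algebra.

(** * Mass and semigroup law of the heat kernel *)

Section heat_kernel_mass.
Context (R : realType).
Local Open Scope ereal_scope.

Lemma measurable_funR_comp (h : R -> R) d (T : measurableType d) (f : T -> R) :
  measurable_fun [set: R] h -> measurable_fun [set: T] f ->
  measurable_fun [set: T] (fun z => h (f z)).
Proof. by move=> mh mf; exact: (measurableT_comp mh mf). Qed.

Lemma measurable_heat_kernel d (T : measurableType d) n (f g : T -> 'rV[R]_n) (h : T -> R) :
  measurable_fun [set: T] f -> measurable_fun [set: T] g -> measurable_fun [set: T] h ->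
  measurable_fun [set: T] (fun z => heat_kernel (f z) (g z) (h z)).
Proof.
move=> mf mg mh.
under eq_fun do rewrite heat_kernelE.
have mh4 : measurable_fun [set: T] (fun z => 4 * h z)%R by exact: measurable_funM.
apply: measurable_funM.
  apply: (measurable_funR_comp (h := fun r => r^-1)%R); first exact: measurable_invr.
  apply: (measurable_funR_comp (h := fun r => r `^ _)%R); first exact: measurable_powR.
  exact: measurable_funM.
apply: (measurable_funR_comp (h := expR)) => //.
apply: (measurable_funR_comp (h := -%R)) => //.
apply: measurable_funM; last first.
  by apply: (measurable_funR_comp (h := fun r => r^-1)%R); first exact: measurable_invr.
apply: measurable_sum => i.
apply: measurable_funX.
apply: measurable_funB.
- exact: measurableT_comp (@measurable_coord R n i) mf.
- exact: measurableT_comp (@measurable_coord R n i) mg.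
Qed.

Lemma measurable_heat_kernelr n (x : 'rV[R]_n) (t : R) :
  measurable_fun [set: 'rV[R]_n] (fun y => heat_kernel x y t).
Proof. by apply: measurable_heat_kernel. Qed.

(** The integrand is the normal density of mean a and variance 2 t. *)
Lemma integral_gauss1 (a t : R) : (0 < t)%R ->
  \int[lebesgue_measure]_b (((4 * pi * t) `^ 2^-1)^-1 * expR (- ((a - b) ^+ 2 / (4 * t))))%:E = 1.
Proof.
move=> t0; rewrite -(integral_normal_pdf a (Num.sqrt (2 * t))).
apply: eq_integral => b _; rewrite /normal_pdf.
have t20 : (0 < 2 * t)%R by rewrite mulr_gt0.
rewrite gt_eqF ?sqrtr_gt0// /normal_peak /normal_fun sqr_sqrtr ?(ltW t20)//.
rewrite powR12_sqrt; last by rewrite !mulr_ge0 ?pi_ge0// ltW.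
congr (_%:E); congr (_^-1 * expR _)%R.
  by congr Num.sqrt; rewrite mulr2n; ring.
by rewrite mulNr; congr (- (_ * _^-1))%R; ring.
Qed.

Lemma heat_kernelS n (x y : 'rV[R]_n.+1) (t : R) : (0 < t)%R ->
  heat_kernel x y t =
  (((4 * pi * t) `^ 2^-1)^-1 * expR (- ((x ord0 ord0 - y ord0 ord0) ^+ 2 / (4 * t))) *
   heat_kernel (rV_uncons x).2 (rV_uncons y).2 t)%R.
Proof.
move=> t0; rewrite !heat_kernelE /sqdist big_ord_recl/=.
have p0 : (0 < 4 * pi * t)%R by rewrite !mulr_gt0 ?pi_gt0.
rewrite (_ : n.+1%:R / 2 = 2^-1 + n%:R / 2)%R; last by rewrite -natr1; field.
rewrite powRD ?(gt_eqF p0) ?implybT// invfM.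
rewrite [((_ + \sum_(i < n) _) / _)%R]mulrDl opprD expRD.
under [in RHS]eq_bigr do rewrite !mxE.
by ring.
Qed.

Lemma integral_heat_kernel n (x : 'rV[R]_n) (t : R) : (0 < t)%R ->
  \int[lebesgue_rV R n]_y (heat_kernel x y t)%:E = 1.
Proof.
move=> t0; elim: n x => [|n IH] x.
  rewrite (eq_integral (fun=> 1)); last first.
    move=> y _; rewrite heat_kernelE /sqdist big_ord0 mul0r powRr0 ?mul0r oppr0 expR0.
    by rewrite invr1 mul1r.
  by rewrite integral_cst//= mul1e diracT.
rewrite ge0_integral_rVS; last 2 first.
- by apply/measurable_EFinP; exact: measurable_heat_kernelr.
- by move=> y; rewrite lee_fin heat_kernel_ge0.
rewrite -[RHS](integral_gauss1 (x ord0 ord0) t0).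
apply: eq_integral => a _.
under eq_integral do rewrite heat_kernelS// rV_consK rV_cons0 EFinM.
rewrite /= ge0_integralZl// ?IH ?mule1//.
- by apply/measurable_EFinP; exact: measurable_heat_kernelr.
- by move=> y _; rewrite lee_fin heat_kernel_ge0.
- by rewrite lee_fin mulr_ge0 ?expR_ge0// invr_ge0 powR_ge0.
Qed.

(** Completing the square in y: the product is a Gaussian in y, centred at a weighted mean of x and
    z, times a factor free of y. Integrating over y leaves this factor, which is the semigroup
    law. *)
Lemma heat_kernelM n (x y z : 'rV[R]_n) (t s : R) : (0 < t)%R -> (0 < s)%R ->
  (heat_kernel x y t * heat_kernel y z s =
  heat_kernel x z (t + s) *
  heat_kernel ((t + s)^-1 *: (s *: x + t *: z)) y (t * s / (t + s)))%R.
Proof.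
move=> t0 s0; have ts0 : (0 < t + s)%R by rewrite addr_gt0.
rewrite !heat_kernelE.
have p0 : (0 < 4 * pi * t)%R by rewrite !mulr_gt0 ?pi_gt0.
have q0 : (0 < 4 * pi * s)%R by rewrite !mulr_gt0 ?pi_gt0.
have r0 : (0 < 4 * pi * (t + s))%R by rewrite !mulr_gt0 ?pi_gt0.
have w0 : (0 < 4 * pi * (t * s / (t + s)))%R by rewrite !mulr_gt0 ?pi_gt0 ?invr_gt0.
rewrite mulrACA [RHS]mulrACA -!invfM -!expRD -!powRM ?(ltW p0) ?(ltW q0) ?(ltW r0) ?(ltW w0)//.
congr (_^-1 * expR _)%R.
  by congr (powR _ _); field; rewrite gt_eqF.
rewrite -!opprD; congr (- _)%R.
rewrite /sqdist !mulr_suml -!big_split/=; apply: eq_bigr => i _; rewrite !mxE.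
by field; rewrite !gt_eqF.
Qed.

Lemma chapman_kolmogorov n (x z : 'rV[R]_n) (t s : R) : (0 < t)%R -> (0 < s)%R ->
  \int[lebesgue_rV R n]_y (heat_kernel x y t * heat_kernel y z s)%:E =
  (heat_kernel x z (t + s))%:E.
Proof.
move=> t0 s0.
under eq_integral do rewrite heat_kernelM// EFinM.
rewrite ge0_integralZl//.
- rewrite integral_heat_kernel ?mule1// divr_gt0 ?mulr_gt0 ?addr_gt0//.
- by apply/measurable_EFinP; exact: measurable_heat_kernelr.
- by move=> y _; rewrite lee_fin heat_kernel_ge0.
- by rewrite lee_fin heat_kernel_ge0.
Qed.

End heat_kernel_mass.

(** * Heat and Duhamel operators *)

Section Rintegral_lemmas.
Context d (T : measurableType d) (R : realType) (mu : {measure set T -> \bar R}).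

Lemma dominated_integrable (f g : T -> R) :
  measurable_fun [set: T] f -> mu.-integrable [set: T] (EFin \o g) ->
  (forall x, `|f x| <= g x) -> mu.-integrable [set: T] (EFin \o f).
Proof.
move=> mf ig fg; apply: le_integrable ig => //; first exact/measurable_EFinP.
by move=> x _ /=; rewrite lee_fin (le_trans (fg x))// ler_norm.
Qed.

Lemma normr_Rintegral_le (f g : T -> R) :
  measurable_fun [set: T] f -> mu.-integrable [set: T] (EFin \o g) ->
  (forall x, `|f x| <= g x) -> `|\int[mu]_x f x| <= \int[mu]_x g x.
Proof.
move=> mf ig fg; have iF := dominated_integrable mf ig fg.
apply: le_trans (le_normr_Rintegral _ iF) _ => //.
apply: le_Rintegral => //.
have := integrable_abse iF; apply: eq_integrable => //.
Qed.

Lemma EFin_Rintegral (f : T -> R) : mu.-integrable [set: T] (EFin \o f) ->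
  (\int[mu]_x f x)%:E = (\int[mu]_x (f x)%:E)%E.
Proof. by move=> iF; rewrite /Rintegral fineK//; exact: integrable_fin_num. Qed.

End Rintegral_lemmas.

Section measurable_Rintegral.
Context d (T : measurableType d) d' (S : measurableType d') (R : realType).

Lemma measurable_Rintegral (mu : {sigma_finite_measure set S -> \bar R}) (f : T * S -> R) :
  measurable_fun [set: T * S] f -> measurable_fun [set: T] (fun x => \int[mu]_y f (x, y)).
Proof.
move=> mf; rewrite /Rintegral.
apply: (measurableT_comp (@fine_measurable R _ _)) => //.
under eq_fun do rewrite integralE.
have mF : measurable_fun [set: T * S] (EFin \o f) by exact/measurable_EFinP.
apply: emeasurable_funB.
- have := measurable_fun_fubini_tonelli_F (m2 := mu) _ (measurable_funepos mF)
    (fun z => funepos_ge0 (EFin \o f) z).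
  by apply: eq_measurable_fun => x _; apply: eq_integral => y _; rewrite !funeposE.
- have := measurable_fun_fubini_tonelli_F (m2 := mu) _ (measurable_funeneg mF)
    (fun z => funeneg_ge0 (EFin \o f) z).
  by apply: eq_measurable_fun => x _; apply: eq_integral => y _; rewrite !funenegE.
Qed.

End measurable_Rintegral.

Section heat_operator.
Context (R : realType) (n : nat).
Implicit Types (x y : 'rV[R]_n) (t s : R) (w : 'rV[R]_n -> R).
Local Notation mu := (lebesgue_rV R n).

(** With the value 0 at nonpositive times, the heat and Duhamel operators are integrals over whole
    spaces and stay jointly measurable. *)
Definition heat_kernel0 x y t : R := if 0 < t then heat_kernel x y t else 0.

Lemma heat_kernel0E x y t : 0 < t -> heat_kernel0 x y t = heat_kernel x y t.
Proof. by rewrite /heat_kernel0 => ->. Qed.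

Lemma heat_kernel0_le0 x y t : t <= 0 -> heat_kernel0 x y t = 0.
Proof. by rewrite /heat_kernel0 ltNge => ->. Qed.

Lemma heat_kernel0_ge0 x y t : 0 <= heat_kernel0 x y t.
Proof. by rewrite /heat_kernel0; case: ifP => // _; exact: heat_kernel_ge0. Qed.

Lemma measurable_heat_kernel0 d (T : measurableType d) (f g : T -> 'rV[R]_n) (h : T -> R) :
  measurable_fun [set: T] f -> measurable_fun [set: T] g -> measurable_fun [set: T] h ->
  measurable_fun [set: T] (fun z => heat_kernel0 (f z) (g z) (h z)).
Proof.
move=> mf mg mh; apply: measurable_fun_ifT => //; last exact: measurable_heat_kernel.
exact: measurable_fun_ltr.
Qed.

Definition heat w x t : R := \int[mu]_y (heat_kernel0 x y t * w y).

Lemma integrable_heat_kernel x t : 0 < t -> mu.-integrable setT (EFin \o (fun y => heat_kernel x y t)).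
Proof.
move=> t0; apply/integrableP; split.
  by apply/measurable_EFinP; exact: measurable_heat_kernelr.
rewrite (eq_integral (fun y => (heat_kernel x y t)%:E)) ?integral_heat_kernel ?ltry// => y _ /=.
by rewrite ger0_norm ?heat_kernel_ge0.
Qed.

Lemma integrable_heat_kernel0 x t : mu.-integrable setT (EFin \o (fun y => heat_kernel0 x y t)).
Proof.
have [t0|t0] := leP t 0.
  by apply: eq_integrable (integrable0 mu setT) => // y _ /=; rewrite heat_kernel0_le0.
by apply: eq_integrable (integrable_heat_kernel x t0) => // y _ /=; rewrite heat_kernel0E.
Qed.

Lemma Rintegral_heat_kernel x t : 0 < t -> \int[mu]_y heat_kernel x y t = 1.
Proof. by move=> t0; rewrite /Rintegral integral_heat_kernel. Qed.

Lemma Rintegral_heat_kernel0 x t : \int[mu]_y heat_kernel0 x y t = (0 < t)%R%:R.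
Proof.
have [t0|t0] := leP t 0.
  under eq_Rintegral do rewrite heat_kernel0_le0//.
  by rewrite Rintegral_cst// mul0r.
by under eq_Rintegral do rewrite heat_kernel0E//; exact: Rintegral_heat_kernel.
Qed.

Definition bounded_by (M : R) w := measurable_fun [set: 'rV[R]_n] w /\ forall y, `|w y| <= M.

Lemma bounded_by_ge0 M w : bounded_by M w -> 0 <= M.
Proof. by move=> [_ /(_ 0)]; exact: le_trans. Qed.

Lemma integrable_heat M w x t : bounded_by M w ->
  mu.-integrable setT (EFin \o (fun y => heat_kernel0 x y t * w y)).
Proof.
move=> [mw wM].
apply: (@dominated_integrable _ _ _ _ _ (fun y => M * heat_kernel0 x y t)).
- by apply: measurable_funM => //; exact: measurable_heat_kernel0.
- by have := integrableZl measurableT M (integrable_heat_kernel0 x t).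
- by move=> y; rewrite normrM mulrC ler_pM// ger0_norm// heat_kernel0_ge0.
Qed.

Lemma heat_le M w x t : bounded_by M w -> `|heat w x t| <= M * (0 < t)%R%:R.
Proof.
move=> bw; have [mw wM] := bw.
rewrite -(Rintegral_heat_kernel0 x) -RintegralZl//; last exact: integrable_heat_kernel0.
apply: normr_Rintegral_le.
- by apply: measurable_funM => //; exact: measurable_heat_kernel0.
- by have := integrableZl measurableT M (integrable_heat_kernel0 x t).
- by move=> y; rewrite normrM mulrC ler_pM// ger0_norm// heat_kernel0_ge0.
Qed.

Lemma heat_norm_le M w x t : bounded_by M w -> `|heat w x t| <= M.
Proof.
move=> bw; apply: le_trans (heat_le x t bw) _.
by rewrite ler_piMr ?(bounded_by_ge0 bw)//; case: (0 < t).
Qed.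

Lemma heat_ge0 w x t : (forall y, 0 <= w y) -> 0 <= heat w x t.
Proof. by move=> w0; apply: Rintegral_ge0 => y _; rewrite mulr_ge0// heat_kernel0_ge0. Qed.

Lemma heat_le0 w x t : t <= 0 -> heat w x t = 0.
Proof.
by move=> t0; rewrite /heat; under eq_Rintegral do rewrite heat_kernel0_le0// mul0r; rewrite Rintegral_cst// mul0r.
Qed.

Lemma heat_mono M M' w w' x t : bounded_by M w -> bounded_by M' w' ->
  (forall y, w y <= w' y) -> heat w x t <= heat w' x t.
Proof.
move=> bw bw' ww'; apply: le_Rintegral => //; [exact: integrable_heat bw|exact: integrable_heat bw'|].
by move=> y _; rewrite ler_wpM2l// heat_kernel0_ge0.
Qed.

Lemma heatB M M' w w' x t : bounded_by M w -> bounded_by M' w' ->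
  heat (fun y => w y - w' y) x t = heat w x t - heat w' x t.
Proof.
move=> bw bw'; rewrite /heat -RintegralB//; [|exact: integrable_heat bw|exact: integrable_heat bw'].
by apply: eq_Rintegral => y _; rewrite mulrBr.
Qed.

Lemma heatD M M' w w' x t : bounded_by M w -> bounded_by M' w' ->
  heat (fun y => w y + w' y) x t = heat w x t + heat w' x t.
Proof.
move=> bw bw'; rewrite /heat -RintegralD//; [|exact: integrable_heat bw|exact: integrable_heat bw'].
by apply: eq_Rintegral => y _; rewrite mulrDr.
Qed.

Lemma heat_cst c x t : 0 < t -> heat (fun=> c) x t = c.
Proof.
move=> t0; rewrite /heat; under eq_Rintegral do rewrite mulrC.
rewrite RintegralZl//; last exact: integrable_heat_kernel0.
by rewrite Rintegral_heat_kernel0 t0 mulr1.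
Qed.

Lemma measurable_heat d (T : measurableType d) (W : T * 'rV[R]_n -> R) (x : T -> 'rV[R]_n) (t : T -> R) :
  measurable_fun [set: T * 'rV[R]_n] W -> measurable_fun [set: T] x -> measurable_fun [set: T] t ->
  measurable_fun [set: T] (fun z => heat (fun y => W (z, y)) (x z) (t z)).
Proof.
move=> mW mx mt.
apply: (@measurable_Rintegral _ T _ _ R mu (fun z => heat_kernel0 (x z.1) z.2 (t z.1) * W z)).
apply: measurable_funM => //; apply: measurable_heat_kernel0 => //.
- exact: measurableT_comp mx measurable_fst.
- exact: measurableT_comp mt measurable_fst.
Qed.

(** Sources are extended by 0 to all times; b is the time from which they may act, so that a Duhamel
    integral started at b needs no separate operator. *)
Definition source b (M : R) (F : 'rV[R]_n -> R -> R) :=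
  [/\ measurable_fun [set: 'rV[R]_n * measurableTypeR R] (fun z => F z.1 z.2),
      forall y s, `|F y s| <= M & forall y s, s < b -> F y s = 0].

Lemma measurable_source b M F d (T : measurableType d) (f : T -> 'rV[R]_n) (g : T -> R) :
  source b M F -> measurable_fun [set: T] f -> measurable_fun [set: T] g ->
  measurable_fun [set: T] (fun z => F (f z) (g z)).
Proof. by move=> [mF _ _] mf mg; exact: (measurableT_comp mF (measurable_fun_pair mf mg)). Qed.

Lemma source_section b M F s : source b M F -> bounded_by M (F ^~ s).
Proof.
move=> [mF FM _]; split => [|y]; last exact: FM.
exact: (measurableT_comp mF (pair2_measurable _)).
Qed.

Lemma source_ge0 b M F : source b M F -> 0 <= M.
Proof. by move=> /(source_section 0)/bounded_by_ge0. Qed.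

(* heat vanishes at nonpositive times, so that only s < t contributes. *)
Definition duhamel F x t : R := \int[lebesgue_measure]_s heat (F ^~ s) x (t - s).

Lemma duhamel_integrand_le b M F x t s : source b M F ->
  `|heat (F ^~ s) x (t - s)| <= M * \1_`[b, t[%classic s.
Proof.
move=> sF; have [_ _ F0] := sF; rewrite indicE.
have [sb|bs] := ltP s b.
  rewrite memNset ?mulr0//=; last by rewrite in_itv/= leNgt sb.
  rewrite /heat; under eq_Rintegral do rewrite F0// mulr0.
  by rewrite Rintegral_cst// mul0r normr0.
apply: le_trans (heat_le x (t - s) (source_section s sF)) _.
by rewrite subr_gt0 mem_setE in_itv/= bs.
Qed.

Lemma measurable_duhamel_integrand b M F x t : source b M F ->
  measurable_fun [set: measurableTypeR R] (fun s => heat (F ^~ s) x (t - s)).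
Proof.
move=> sF.
apply: (@measurable_heat _ (measurableTypeR R) (fun z => F z.2 z.1) (cst x) (fun s => t - s)).
- exact: measurable_source sF measurable_snd measurable_fst.
- exact: measurable_cst.
- exact: measurable_funB.
Qed.

Lemma integrable_scaled_itv (M b t : R) :
  lebesgue_measure.-integrable [set: measurableTypeR R] (EFin \o (fun s => M * \1_`[b, t[%classic s)).
Proof. by have := integrableZl measurableT M (integrable_indic_itv b t true true). Qed.

Lemma Rintegral_scaled_itv (M b t : R) : b <= t ->
  \int[lebesgue_measure]_s (M * \1_`[b, t[%classic s) = M * (t - b).
Proof.
move=> bt; rewrite RintegralZl//; last exact: integrable_indic_itv.
congr (_ * _); rewrite /Rintegral integral_indic// setIT.
apply: etrans (congr1 fine (lebesgue_measure_itv `[b, t[)) _; rewrite /= lte_fin.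
by case: ltP => // tb; apply/eqP; rewrite eq_sym subr_eq0 eq_le tb bt.
Qed.

Lemma measurable_duhamel b M F d (T : measurableType d) (x : T -> 'rV[R]_n) (t : T -> R) :
  source b M F ->
  measurable_fun [set: T] x -> measurable_fun [set: T] t ->
  measurable_fun [set: T] (fun z => duhamel F (x z) (t z)).
Proof.
move=> sF mx mt.
apply: (@measurable_Rintegral _ T _ (measurableTypeR R) R lebesgue_measure
   (fun z => heat (F ^~ z.2) (x z.1) (t z.1 - z.2))).
apply: (@measurable_heat _ (T * measurableTypeR R)%type (fun z => F z.2 z.1.2)
  (fun z => x z.1) (fun z => t z.1 - z.2)).
- apply: (measurable_source sF measurable_snd).
  exact: measurableT_comp measurable_snd measurable_fst.
- exact: measurableT_comp mx measurable_fst.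
- apply: measurable_funB; last exact: measurable_snd.
  exact: measurableT_comp mt measurable_fst.
Qed.

Lemma integrable_duhamel b M F x t : source b M F ->
  lebesgue_measure.-integrable [set: measurableTypeR R]
    (EFin \o (fun s => heat (F ^~ s) x (t - s))).
Proof.
move=> sF; apply: dominated_integrable (integrable_scaled_itv M b t) _.
  exact: measurable_duhamel_integrand sF.
by move=> s; exact: duhamel_integrand_le sF.
Qed.

Lemma duhamel_le b M F x t : source b M F -> b <= t -> `|duhamel F x t| <= M * (t - b).
Proof.
move=> sF bt; rewrite -Rintegral_scaled_itv//.
apply: normr_Rintegral_le (integrable_scaled_itv M b t) _.
  exact: measurable_duhamel_integrand sF.
by move=> s; exact: duhamel_integrand_le sF.
Qed.

Lemma duhamel_ge0 F x t : (forall y s, 0 <= F y s) -> 0 <= duhamel F x t.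
Proof. by move=> F0; apply: Rintegral_ge0 => s _; exact: heat_ge0. Qed.

Lemma duhamel_mono b M b' M' F F' x t : source b M F -> source b' M' F' ->
  (forall y s, F y s <= F' y s) -> duhamel F x t <= duhamel F' x t.
Proof.
move=> sF sF' FF'; apply: le_Rintegral => //.
- exact: integrable_duhamel sF.
- exact: integrable_duhamel sF'.
- by move=> s _; exact: heat_mono (source_section s sF) (source_section s sF') _.
Qed.

Lemma duhamelD b M b' M' F F' x t : source b M F -> source b' M' F' ->
  duhamel (fun y s => F y s + F' y s) x t = duhamel F x t + duhamel F' x t.
Proof.
move=> sF sF'; rewrite /duhamel -RintegralD//.
- apply: eq_Rintegral => s _.
  exact: heatD (source_section s sF) (source_section s sF').
- exact: integrable_duhamel sF.
- exact: integrable_duhamel sF'.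
Qed.

Definition before (a : R) (F : 'rV[R]_n -> R -> R) y s := if s < a then F y s else 0.
Definition after (a : R) (F : 'rV[R]_n -> R -> R) y s := if s < a then 0 else F y s.

Lemma source_before a b M F : source b M F -> source b M (before a F).
Proof.
move=> sF; have [mF FM F0] := sF; split.
- apply: measurable_fun_ifT => //; first exact: measurable_fun_ltr.
- by move=> y s; rewrite /before; case: ifP => // _; rewrite normr0 (source_ge0 sF).
- by move=> y s sb; rewrite /before F0// if_same.
Qed.

Lemma source_after a b M F : source b M F -> source a M (after a F).
Proof.
move=> sF; have [mF FM F0] := sF; split.
- apply: measurable_fun_ifT => //; first exact: measurable_fun_ltr.
- by move=> y s; rewrite /after; case: ifP => // _; rewrite normr0 (source_ge0 sF).
- by move=> y s sb; rewrite /after sb.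
Qed.

Lemma duhamel_before_after a b M F x t : source b M F ->
  duhamel F x t = duhamel (before a F) x t + duhamel (after a F) x t.
Proof.
move=> sF; rewrite -(duhamelD x t (source_before a sF) (source_after a sF)).
suff -> : (fun y s => before a F y s + after a F y s) = F by [].
apply/funext => y; apply/funext => s.
by rewrite /before /after; case: ifP => _; rewrite ?addr0 ?add0r.
Qed.

Lemma bounded_heat M w t : bounded_by M w -> bounded_by M (fun y => heat w y t).
Proof.
move=> bw; split => [|y]; last exact: heat_norm_le.
apply: (@measurable_heat _ 'rV[R]_n (fun z => w z.2) id (cst t)) => //.
exact: (measurableT_comp bw.1 measurable_snd).
Qed.

Lemma bounded_duhamel b M F t : source b M F -> b <= t ->
  bounded_by (M * (t - b)) (fun y => duhamel F y t).
Proof.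
move=> sF bt; split => [|y]; last exact: duhamel_le.
exact: measurable_duhamel sF _ _.
Qed.

Lemma EFin_heat M w x t : bounded_by M w ->
  (heat w x t)%:E = (\int[mu]_y (heat_kernel0 x y t * w y)%:E)%E.
Proof. by move=> bw; rewrite /heat EFin_Rintegral//; exact: integrable_heat bw. Qed.

(** Chapman-Kolmogorov after an exchange of integrals, which is Tonelli because w is nonnegative. *)
Lemma heat_heat M w x (t s : R) : bounded_by M w -> (forall y, 0 <= w y) -> 0 < t -> 0 < s ->
  heat (fun y => heat w y s) x t = heat w x (t + s).
Proof.
move=> bw w0 t0 s0; apply: EFin_inj.
rewrite (EFin_heat _ _ (bounded_heat s bw)) (EFin_heat _ _ bw).
have mg : measurable_fun [set: 'rV[R]_n * 'rV[R]_n]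
    (fun z => (heat_kernel0 x z.1 t * (heat_kernel0 z.1 z.2 s * w z.2))%:E).
  apply/measurable_EFinP; apply: measurable_funM; first exact: measurable_heat_kernel0.
  apply: measurable_funM; first exact: measurable_heat_kernel0.
  exact: (measurableT_comp bw.1 measurable_snd).
have g0 z : (0 <= (heat_kernel0 x z.1 t * (heat_kernel0 z.1 z.2 s * w z.2))%:E)%E.
  by rewrite lee_fin !mulr_ge0 ?heat_kernel0_ge0.
transitivity (\int[mu]_y \int[mu]_z (heat_kernel0 x y t * (heat_kernel0 y z s * w z))%:E)%E.
  apply: eq_integral => y _; rewrite EFinM (EFin_heat _ _ bw) -ge0_integralZl//.
  - apply/measurable_EFinP; apply: measurable_funM; last exact: bw.1.
    exact: measurable_heat_kernel0.
  - by move=> z _; rewrite lee_fin mulr_ge0 ?heat_kernel0_ge0.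
  - by rewrite lee_fin heat_kernel0_ge0.
rewrite (fubini_tonelli (fun z => (heat_kernel0 x z.1 t * (heat_kernel0 z.1 z.2 s * w z.2))%:E))//=.
apply: eq_integral => z _.
rewrite heat_kernel0E ?addr_gt0// EFinM -chapman_kolmogorov// muleC -ge0_integralZl//.
- by apply: eq_integral => y _; rewrite !heat_kernel0E// -EFinM; congr EFin; ring.
- by apply/measurable_EFinP; apply: measurable_funM; exact: measurable_heat_kernel.
- by move=> y _; rewrite lee_fin mulr_ge0 ?heat_kernel_ge0.
- by rewrite lee_fin.
Qed.

(** The semigroup law under the time integral: P_t P_(a - s) F(s) = P_(t + a - s) F(s) for s < a.
    For s >= a both integrands vanish, the left one because [heat] is 0 at nonpositive times, the
    right one because of the cut. *)
Lemma heat_duhamel b M F x (t a : R) : source b M F -> (forall y s, 0 <= F y s) -> 0 < t -> b <= a ->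
  heat (fun y => duhamel F y a) x t = duhamel (before a F) x (t + a).
Proof.
move=> sF F0 t0 ba; apply: EFin_inj.
rewrite (EFin_heat _ _ (bounded_duhamel sF ba)).
have sB := source_before a sF.
rewrite EFin_Rintegral; last exact: integrable_duhamel sB.
have mg : measurable_fun [set: 'rV[R]_n * measurableTypeR R]
    (fun z => (heat_kernel0 x z.1 t * heat (F ^~ z.2) z.1 (a - z.2))%:E).
  apply/measurable_EFinP; apply: measurable_funM; first exact: measurable_heat_kernel0.
  apply: (@measurable_heat _ ('rV[R]_n * measurableTypeR R)%type (fun z => F z.2 z.1.2)
    (fun z => z.1) (fun z => a - z.2)) => //.
  - apply: (measurable_source sF measurable_snd).
    exact: measurableT_comp measurable_snd measurable_fst.
  - exact: measurable_fst.
  - by apply: measurable_funB => //; exact: measurable_snd.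
have g0 z : (0 <= (heat_kernel0 x z.1 t * heat (F ^~ z.2) z.1 (a - z.2))%:E)%E.
  by rewrite lee_fin mulr_ge0 ?heat_kernel0_ge0// heat_ge0.
transitivity (\int[mu]_y \int[lebesgue_measure]_s (heat_kernel0 x y t * heat (F ^~ s) y (a - s))%:E)%E.
  apply: eq_integral => y _; rewrite EFinM EFin_Rintegral; last exact: integrable_duhamel sF.
  rewrite -ge0_integralZl//.
  - by apply/measurable_EFinP; exact: measurable_duhamel_integrand sF.
  - by move=> z _; rewrite lee_fin heat_ge0.
  - by rewrite lee_fin heat_kernel0_ge0.
rewrite (@fubini_tonelli _ _ _ _ _ mu lebesgue_measure
  (fun z => (heat_kernel0 x z.1 t * heat (F ^~ z.2) z.1 (a - z.2))%:E))//=.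
apply: eq_integral => s _.
rewrite -(EFin_heat x t (bounded_heat (a - s) (source_section s sF))).
congr EFin; rewrite /before; have [sa|sa] := ltP s a.
  have as0 : 0 < a - s by rewrite subr_gt0.
  by rewrite -addrA; exact: heat_heat (source_section s sF) _ t0 as0.
rewrite -[RHS](_ : 0 = _); last by rewrite /heat; under eq_Rintegral do rewrite mulr0; rewrite Rintegral_cst// mul0r.
rewrite /heat; under eq_Rintegral do rewrite [X in _ * X]heat_le0 ?subr_le0// mulr0.
by rewrite Rintegral_cst// mul0r.
Qed.

(** What the flow makes of a mild solution taken at time a. The Duhamel integral of the source after
    a is what remains to be added to get the solution at time t + a. *)
Lemma mild_restart b M M' w F x (t a : R) : bounded_by M' w -> source b M F ->
  (forall y, 0 <= w y) -> (forall y s, 0 <= F y s) -> 0 < t -> 0 < a -> b <= a ->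
  heat (fun y => heat w y a + duhamel F y a) x t =
  heat w x (t + a) + duhamel (before a F) x (t + a).
Proof.
move=> bw sF w0 F0 t0 a0 ba.
rewrite (heatD _ _ (bounded_heat a bw) (bounded_duhamel sF ba)).
by rewrite (heat_heat _ bw)// (heat_duhamel _ sF).
Qed.

End heat_operator.

(** * Power inequalities *)

Section power_inequalities.
Context (R : realType).
Implicit Types a b m p q t v y z : R.

(** The graph of v^p lies above its tangent at m. This is Young's inequality for v and m^(p - 1)
    with exponents p and p / (p - 1). *)
Lemma powR_tangent p m v : 1 < p -> 0 <= m -> 0 <= v ->
  p * m `^ (p - 1) * v - (p - 1) * m `^ p <= v `^ p.
Proof.
move=> p1 m0 v0; have p0 : 0 < p by exact: lt_trans p1.
have q0 : 0 < p - 1 by rewrite subr_gt0.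
have p00 : p != 0 by rewrite gt_eqF.
have q00 : p - 1 != 0 by rewrite gt_eqF.
have pq : p^-1 + (p / (p - 1))^-1 = 1 by field; rewrite ?p00 ?q00.
have := @conjugate_powR R v (m `^ (p - 1)) p (p / (p - 1)) v0 (powR_ge0 _ _) p0 _ pq.
rewrite divr_gt0// => /(_ isT).
rewrite -powRrM (_ : (p - 1) * (p / (p - 1)) = p); last by field; rewrite ?p00 ?q00.
rewrite (_ : m `^ p / (p / (p - 1)) = (p - 1) * m `^ p / p); last by field; rewrite ?p00 ?q00.
rewrite -mulrDl ler_pdivlMr// lerBlDr => H; apply: le_trans H.
by rewrite le_eqVlt; apply/orP; left; apply/eqP; ring.
Qed.

(** A one-sided second order Taylor bound. With z = q y / (1 + y) <= q ln (1 + y), the left side is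
    at most exp (- z) <= 1 / (1 + z) <= 1 - z + z^2, and q y - q y^2 <= z <= q y. *)
Lemma powRN1D_le q y : 0 < q -> 0 <= y -> (1 + y) `^ (- q) <= 1 - q * y * (1 - (q + 1) * y).
Proof.
move=> q0 y0; have y1 : 0 < 1 + y by rewrite ltr_wpDr.
pose z := q * (y / (1 + y)).
have z0 : 0 <= z by rewrite !mulr_ge0 ?invr_ge0 ?(ltW q0)// ltW.
have zq : q * y - q * y ^+ 2 <= z.
  rewrite /z -mulrBr ler_wpM2l ?(ltW q0)// ler_pdivlMr//.
  rewrite -subr_ge0 (_ : _ - _ = y ^+ 3); last by ring.
  by rewrite exprn_ge0.
have zu : z <= q * y.
  by rewrite /z ler_wpM2l ?(ltW q0)// ler_pdivrMr// ler_peMr// lerDl.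
have lnz : z <= q * ln (1 + y).
  rewrite /z ler_wpM2l ?(ltW q0)// -[ln _]opprK -lnV ?posrE// lerNr.
  rewrite [X in ln X](_ : _ = 1 + - (y / (1 + y))); last by field; rewrite gt_eqF.
  apply: le_ln1Dx; rewrite ltrN2 ltr_pdivrMr// mul1r ltrDr//.
rewrite /powR gt_eqF//.
apply: (@le_trans _ _ (1 + z)^-1).
  rewrite mulNr expRN lef_pV2 ?posrE ?expR_gt0 ?ltr_wpDr//.
  by apply: le_trans (expR_ge1Dx _); rewrite lerD2l.
apply: (@le_trans _ _ (1 - z + z ^+ 2)).
  rewrite -[leLHS]mul1r ler_pdivrMr ?ltr_wpDr//.
  rewrite -subr_ge0 (_ : _ - _ = z ^+ 3); last by ring.
  by rewrite exprn_ge0.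
have zz : z ^+ 2 <= (q * y) ^+ 2 by rewrite ler_pXn2r ?nnegrE// mulr_ge0// ltW.
rewrite -subr_ge0 (_ : _ - _ = (z - (q * y - q * y ^+ 2)) + ((q * y) ^+ 2 - z ^+ 2)).
  by rewrite addr_ge0// subr_ge0.
by ring.
Qed.

Lemma powRN_anti q a b : 0 <= q -> 0 < a -> a <= b -> b `^ (- q) <= a `^ (- q).
Proof.
move=> q0 a0 ab; have b0 := lt_le_trans a0 ab.
rewrite !powRN lef_pV2 ?posrE ?powR_gt0// ge0_ler_powR ?nnegrE//; exact: ltW.
Qed.

(* Euler scheme for g' = g^p, compared through g^(1-p). *)
Lemma superlinear_growth_time p t w0 B (g : R -> R) : 1 < p -> 0 < t -> 0 < w0 ->
  (forall s, 0 < s <= t -> w0 <= g s <= B) ->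
  (forall s1 s2, 0 < s1 -> s1 <= s2 -> s2 <= t -> g s1 + (s2 - s1) * g s1 `^ p <= g s2) ->
  (p - 1) * t <= w0 `^ (1 - p).
Proof.
move=> p1 t0 w00 gB gE.
pose q := p - 1; have q0 : 0 < q by rewrite subr_gt0.
rewrite -[1 - p]opprB -/q.
(* As q + 1 = p, this bounds the factor (q + 1) g^q of the second order term in one step. *)
pose C := p * B `^ q.
have C0 : 0 <= C by rewrite mulr_ge0 ?powR_ge0// ltW// (lt_trans _ p1).
have step s h : 0 < s -> 0 <= h -> s + h <= t ->
    g (s + h) `^ (- q) <= g s `^ (- q) - q * h * (1 - C * h).
  move=> s0 h0 sht.
  have st : 0 < s <= t by rewrite s0 (le_trans _ sht)// lerDl.
  have /andP[gs gsB] := gB s st.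
  have gs0 : 0 < g s := lt_le_trans w00 gs.
  have := gE s (s + h) s0; rewrite lerDl => /(_ h0 sht).
  rewrite addrAC subrr add0r => gsh.
  set v := g s in gs gsB gs0 gsh *.
  pose y := h * v `^ q.
  have y0 : 0 <= y by rewrite mulr_ge0// powR_ge0.
  have y1 : 0 < 1 + y by rewrite ltr_wpDr.
  have E : v + h * v `^ p = v * (1 + y).
    by rewrite /y mulrDr mulr1 mulrCA mulr_powRB1// ?(ltW gs0)// (lt_trans _ p1).
  rewrite E in gsh.
  apply: le_trans (powRN_anti (ltW q0) _ gsh) _; first by rewrite mulr_gt0.
  rewrite powRM ?(ltW gs0) ?(ltW y1)//.
  apply: le_trans (ler_wpM2l (powR_ge0 _ _) (powRN1D_le q0 y0)) _.
  have vq : v `^ (- q) * v `^ q = 1 by rewrite powRN mulVf// gt_eqF// powR_gt0.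
  rewrite mulrBr mulr1 lerD2l lerN2.
  rewrite (_ : v `^ (- q) * _ = q * h * (v `^ (- q) * v `^ q) * (1 - (q + 1) * y)); last by rewrite /y; ring.
  rewrite vq mulr1 ler_wpM2l ?mulr_ge0 ?(ltW q0)// lerD2l lerN2.
  rewrite /y /C /q subrK [h * _]mulrC mulrA ler_wpM2r// ler_wpM2l ?(ltW (lt_trans _ p1))//.
  by rewrite ge0_ler_powR ?nnegrE ?(ltW q0) ?(ltW gs0)// (le_trans _ gsB)// ltW.
(* The inequality for g holds at positive times only: the scheme starts at d = t / (N + 1) and
   reaches t in N steps. The missing first step and the second order terms make up the error, of
   order 1 / N. *)
have main (N : nat) : q * t - w0 `^ (- q) <= t / N.+1%:R * (q * (1 + C * t)).
  pose d := t / N.+1%:R.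
  have d0 : 0 < d by rewrite divr_gt0.
  have Nd : N%:R * d + d = t.
    by rewrite /d -[X in _ + X]mul1r -mulrDl natr1 mulrCA mulfV ?mulr1.
  have sum k : (k <= N)%N -> g (d + k%:R * d) `^ (- q) <=
      w0 `^ (- q) - k%:R * (q * d * (1 - C * d)).
    elim: k => [_|k IH kN].
      rewrite !mul0r addr0 subr0; apply: powRN_anti (ltW q0) w00 _.
      have /gB/andP[]// : 0 < d <= t by rewrite d0 -Nd lerDr mulr_ge0// ltW.
    rewrite -natr1 mulrDl mul1r addrA; apply: le_trans (step _ _ _ (ltW d0) _) _.
    - by rewrite ltr_wpDr// mulr_ge0// ltW.
    - rewrite -addrA addrC -Nd lerD2r// -[X in _ + X]mul1r -mulrDl natr1.
      by rewrite ler_wpM2r ?(ltW d0)// ler_nat.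
    - rewrite [leRHS](_ : _ =
        w0 `^ (- q) - k%:R * (q * d * (1 - C * d)) - q * d * (1 - C * d)); last by ring.
      by rewrite lerD2r IH// ltnW.
  have := le_trans (powR_ge0 _ _) (sum N (leqnn N)).
  have -> : N%:R * (q * d * (1 - C * d)) = q * (t - d) * (1 - C * d).
    by rewrite -Nd; ring.
  rewrite -/d => H.
  rewrite -subr_ge0 (_ : _ - _ = (w0 `^ (- q) - q * (t - d) * (1 - C * d)) + q * C * d ^+ 2); last by ring.
  by apply: addr_ge0 => //; rewrite mulr_ge0 ?sqr_ge0// mulr_ge0// ltW.
rewrite leNgt; apply/negP => H.
have H0 : 0 < q * t - w0 `^ (- q) by rewrite subr_gt0.
pose K := t * (q * (1 + C * t)).
pose N := Num.truncn (K / (q * t - w0 `^ (- q))).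
have : K / (q * t - w0 `^ (- q)) < N.+1%:R by exact: truncnS_gt.
rewrite ltr_pdivrMr// mulrC -ltr_pdivrMr// => KN.
by have := lt_le_trans KN (main N); rewrite /K mulrAC ltxx.
Qed.

End power_inequalities.

(** * Jensen's inequality for the flow *)

Section mild.
Context (R : realType) (n : nat).
Implicit Types (x y : 'rV[R]_n) (t s : R) (w phi : 'rV[R]_n -> R).
Local Notation mu := (lebesgue_rV R n).

Lemma heatZ M w (c : R) x t : bounded_by M w ->
  heat (fun y => c * w y) x t = c * heat w x t.
Proof.
move=> bw; rewrite /heat -RintegralZl//; last exact: integrable_heat bw.
by apply: eq_Rintegral => y _; rewrite mulrCA.
Qed.

Lemma bounded_byZ M w c : bounded_by M w -> bounded_by (`|c| * M) (fun y => c * w y).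
Proof.
move=> [mw wM]; split => [|y]; first exact: measurable_funM.
by rewrite normrM ler_wpM2l.
Qed.

Lemma bounded_by_cst c : bounded_by `|c| (fun _ : 'rV[R]_n => c).
Proof. by split => // y. Qed.

(** The tangent inequality at m = P_t w (x), integrated against a kernel of mass one: its left side
    integrates to p m^(p - 1) m - (p - 1) m^p = m^p. *)
Lemma jensen_heat p M M' w w' x t : 1 < p -> 0 < t ->
  bounded_by M w -> (forall y, 0 <= w y) ->
  bounded_by M' w' -> (forall y, w' y = w y `^ p) ->
  heat w x t `^ p <= heat w' x t.
Proof.
move=> p1 t0 bw w0 bw' ww'.
have m0 : 0 <= heat w x t by exact: heat_ge0.
set m := heat w x t in m0 *.
pose c1 := p * m `^ (p - 1); pose c2 := (p - 1) * m `^ p.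
have b1 := bounded_byZ c1 bw.
have b2 := bounded_by_cst c2.
apply: (@le_trans _ _ (heat (fun y => c1 * w y - c2) x t)).
  rewrite (heatB x t b1 b2) (heatZ c1 x t bw) heat_cst// -/m /c1 /c2.
  rewrite -mulrA [m `^ _ * m]mulrC mulr_powRB1//; last exact: lt_trans p1.
  by rewrite -mulrBl opprB addrC subrK mul1r.
have b3 : bounded_by (`|c1| * M + `|c2|) (fun y => c1 * w y - c2).
  split=> [|y]; first by apply: measurable_funB => //; exact: b1.1.
  by apply: le_trans (ler_normB _ _) _; rewrite lerD2r b1.2.
apply: (heat_mono x t b3 bw') => y; rewrite ww'.
exact: powR_tangent.
Qed.

Definition on_time (S : R) (f : 'rV[R]_n -> R -> R) y s := if (0 < s) && (s < S) then f y s else 0.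

(** Bridge from the integral equation of [is_solution], with extended real integrals over [0, t], to
    [duhamel]: the integrands agree for 0 < s < t, and the one of [duhamel] vanishes elsewhere. *)
Lemma integral_duhamel S M (f : 'rV[R]_n -> R -> R) x t :
  source 0 M (on_time S f) -> (forall y s, 0 <= on_time S f y s) -> 0 < t <= S ->
  (\int[lebesgue_measure]_(s in `[0%R, t]) \int[mu]_y (heat_kernel x y (t - s) * f y s)%:E =
   (duhamel (on_time S f) x t)%:E)%E.
Proof.
move=> sF F0 /andP[t0 tS].
have E s : s \in `]0, t[ ->
    (\int[mu]_y (heat_kernel x y (t - s) * f y s)%:E = (heat (on_time S f ^~ s) x (t - s))%:E)%E.
  rewrite in_itv/= => /andP[s0 st]; rewrite (EFin_heat _ _ (source_section s sF)).
  apply: eq_integral => y _.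
  by rewrite heat_kernel0E ?subr_gt0// /on_time s0 (lt_le_trans st tS).
rewrite integral_itv_bndoo; last first.
  have : measurable_fun `]0, t[ (fun s => (heat (on_time S f ^~ s) x (t - s))%:E).
    apply/measurable_EFinP; apply: measurable_funTS.
    exact: measurable_duhamel_integrand sF.
  by apply: eq_measurable_fun => s /[!inE] H; rewrite E.
rewrite integral_mkcond EFin_Rintegral; last exact: integrable_duhamel sF.
apply: eq_integral => s _; rewrite patchE; case: ifPn => [/[!inE] H|]; first by rewrite E.
rewrite notin_setE/= in_itv/= => /negP; rewrite negb_and -!leNgt => /orP[s0|ts].
  rewrite /heat; under eq_Rintegral do rewrite /on_time ltNge s0/= mulr0.
  by rewrite Rintegral_cst// mul0r.
by rewrite heat_le0// subr_le0.
Qed.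

End mild.

(** * Mild solutions *)

Section mild_solutions.
Context (R : realType) (n : nat).
Implicit Types (x y : 'rV[R]_n) (t s S : R) (phi : 'rV[R]_n -> R) (u f : 'rV[R]_n -> R -> R).
Local Notation mu := (lebesgue_rV R n).

Definition mild S phi f u := forall x t, 0 < t < S ->
  u x t = heat phi x t + duhamel (on_time S f) x t.

Lemma reaction_ge0 p (v : R) : 0 <= v -> 0 <= reaction p v.
Proof. by move=> v0; rewrite mulr_ge0// powR_ge0. Qed.

Lemma reactionE p (v : R) : 1 < p -> 0 <= v -> reaction p v = v `^ p.
Proof.
by move=> p1 v0; rewrite /reaction ger0_norm// mulrC mulr_powRB1// (lt_trans _ p1).
Qed.

Lemma open_slab S : open [set z : 'rV[R]_n * R | 0 < z.2 < S].
Proof.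
rewrite (_ : [set z | _] = snd @^-1` `]0, S[%classic); last first.
  by apply/seteqP; split=> z /=; rewrite in_itv.
by apply: open_comp => [z _|]; [exact: cvg_snd|exact: interval_open].
Qed.

Lemma measurable_on_time S f :
  {in [set z : 'rV[R]_n * R | 0 < z.2 < S], continuous (fun z => f z.1 z.2)} ->
  measurable_fun [set: 'rV[R]_n * measurableTypeR R] (fun z => on_time S f z.1 z.2).
Proof.
move=> cf; have := open_continuous_measurable_rV_R (@open_slab S) cf.
move/(measurable_restrictT _ (open_measurable_rV_R (@open_slab S))).
apply: eq_measurable_fun => z _; rewrite patchE /on_time.
by rewrite mem_setE.
Qed.

Lemma measurable_reaction p : measurable_fun [set: R] (reaction p).
Proof.
apply: measurable_funM => //; apply: (measurable_funR_comp (h := fun v : R => v `^ (p - 1))) => //.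
Qed.

Lemma source_reaction p S B u : 1 < p -> 0 <= B ->
  {in [set z : 'rV[R]_n * R | 0 < z.2 < S], continuous (fun z => u z.1 z.2)} ->
  (forall x t, 0 < t < S -> 0 <= u x t <= B) ->
  source 0 (B `^ p) (on_time S (fun y s => reaction p (u y s))).
Proof.
move=> p1 B0 cu uB; split.
- have := measurable_funR_comp (@measurable_reaction p) (measurable_on_time cu).
  apply: eq_measurable_fun => z _; rewrite /on_time; case: ifP => // _.
  by rewrite /reaction mulr0.
- move=> y s; rewrite /on_time; case: ifPn => [sS|]; last by rewrite normr0 powR_ge0.
  have /andP[u0 uBy] := uB y s sS; rewrite reactionE// ger0_norm ?powR_ge0//.
  by rewrite ge0_ler_powR ?nnegrE// ltW// (lt_trans _ p1).
- by move=> y s s0; rewrite /on_time ltNge (ltW s0).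
Qed.

Lemma on_time_ge0 S f : (forall y s, 0 < s < S -> 0 <= f y s) -> forall y s, 0 <= on_time S f y s.
Proof. by move=> f0 y s; rewrite /on_time; case: ifPn => // /f0. Qed.

Lemma mild_time_bound p S M MF phi u x : 1 < p -> 0 < S ->
  bounded_by M phi -> (forall y, 0 <= phi y) ->
  source 0 MF (on_time S (fun y s => reaction p (u y s))) ->
  (forall y s, 0 < s < S -> 0 <= u y s) ->
  mild S phi (fun y s => reaction p (u y s)) u ->
  0 < heat phi x S -> (p - 1) * S <= heat phi x S `^ (1 - p).
Proof.
move=> p1 S0 bphi phi0 sF u0 mu_ w00.
set F := on_time S _ in sF.
have F0 : forall y s, 0 <= F y s by apply: on_time_ge0 => y s /u0 H; exact: reaction_ge0.
have bF0 a y s : 0 <= before a F y s by rewrite /before; case: ifP.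
have MF0 := source_ge0 sF.
(* This is P_(S - s) u(s) (x) for 0 < s < S, written through the source alone so that it also makes
   sense at s = S. *)
pose G s := heat phi x S + duhamel (before s F) x S.
have Gmono s1 s2 : s1 <= s2 -> G s1 <= G s2.
  move=> s12; rewrite lerD2l.
  apply: duhamel_mono (source_before s1 sF) (source_before s2 sF) _ => y s.
  rewrite /before; case: ltP => [ss1|_]; first by rewrite (lt_le_trans ss1).
  by case: ifP.
have ub s : 0 < s < S -> bounded_by (M + MF * S) (u ^~ s).
  move=> sS; have /andP[s0 s1] := sS.
  have [m1 b1] := bounded_heat s bphi; have [m2 b2] := bounded_duhamel sF (ltW s0).
  split=> [|y].
    by apply: eq_measurable_fun (measurable_funD m1 m2) => y _; rewrite mu_.
  rewrite mu_//; apply: le_trans (ler_normD _ _) _; apply: lerD; first exact: b1.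
  by apply: le_trans (b2 y) _; rewrite subr0 ler_wpM2l// ltW.
have GE s : 0 < s < S -> G s = heat (u ^~ s) x (S - s).
  move=> sS; have /andP[s0 s1] := sS.
  have := @mild_restart R n 0 MF M phi F x (S - s) s bphi sF phi0 F0.
  rewrite subr_gt0 subrK /G => /(_ s1 s0 (ltW s0)) <-.
  by apply: eq_Rintegral => y _; rewrite mu_.
apply: (@superlinear_growth_time R p S (heat phi x S) (M + MF * S) G) => // [s /andP[s0 sS]|].
  rewrite lerDl duhamel_ge0//= lerD//.
    exact: le_trans (ler_norm _) (heat_norm_le _ _ bphi).
  apply: le_trans (ler_norm _) _.
  by apply: le_trans (duhamel_le x (source_before s sF) (ltW S0)) _; rewrite subr0.
(* For s in [s1, s2[, G(s1)^p <= G(s)^p, and by Jensen G(s)^p is at most the Duhamel integrand at s;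
   the integral of the latter over [s1, s2[ is G(s2) - G(s1). *)
move=> s1 s2 s10 s12 s2S.
have sB := source_before s2 sF.
have E : duhamel (before s2 F) x S = duhamel (before s1 F) x S + duhamel (after s1 (before s2 F)) x S.
  apply: etrans (duhamel_before_after s1 x S sB) _.
  suff -> : before s1 (before s2 F) = before s1 F by [].
  apply/funext => y; apply/funext => s.
  by rewrite /before; case: ltP => // ss1; rewrite (lt_le_trans ss1).
have -> : G s2 = G s1 + duhamel (after s1 (before s2 F)) x S by rewrite /G E addrA.
rewrite lerD2l.
have sA := source_after s1 sB.
rewrite mulrC -(Rintegral_scaled_itv _ s12).
apply: le_Rintegral => //.
- exact: integrable_scaled_itv.
- exact: integrable_duhamel sA.
- move=> s _; rewrite indicE; case: (boolP (s \in _)) => sI; last first.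
    rewrite mulr0 heat_ge0// => y; rewrite /after; case: ifP => //.
  move: sI; rewrite mem_setE in_itv/= => /andP[s1s ss2].
  have sS : 0 < s < S by rewrite (lt_le_trans s10)// (lt_le_trans ss2).
  rewrite mulr1; apply: (@le_trans _ _ (G s `^ p)).
    rewrite ge0_ler_powR ?nnegrE ?Gmono ?(ltW (lt_trans _ p1))//.
    + by rewrite addr_ge0 ?(ltW w00)// duhamel_ge0.
    + by rewrite addr_ge0 ?(ltW w00)// duhamel_ge0.
  rewrite GE//; apply: (jensen_heat x p1 _ (ub s sS)).
  + by rewrite subr_gt0; case/andP: sS.
  + by move=> y; exact: u0.
  + exact: source_section s sA.
  + move=> y; rewrite /after ltNge s1s/= /before ss2 /F /on_time sS.
    by rewrite reactionE// u0.
Qed.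

End mild_solutions.

(** * Volume of Euclidean balls *)

Section density.
Context (R : realType) (n : nat).
Implicit Types (x y : 'rV[R]_n) (r t : R).
Local Notation mu := (lebesgue_rV R n).

Lemma measurable_enorm : measurable_fun [set: 'rV[R]_n] (@enorm R n).
Proof.
apply: (measurable_funR_comp (h := Num.sqrt)).
  by apply: continuous_measurable_fun; exact: sqrt_continuous.
apply: measurable_sum => i; apply: measurable_funX; exact: measurable_coord.
Qed.

Lemma measurable_eball r : measurable (eball (0 : 'rV[R]_n) r).
Proof.
rewrite (_ : eball 0 r = setT `&` @enorm R n @^-1` `]-oo, r[%classic).
  exact: measurable_enorm.
by apply/seteqP; split => y /=; rewrite /eball/= in_itv/= subr0// => -[].
Qed.

Lemma eballP r y : 0 < r -> eball 0 r y <-> sqdist y 0 < r ^+ 2.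
Proof.
move=> r0; rewrite /eball/= -sqr_enorm.
have e0 : 0 <= enorm (y - 0) by exact: sqrtr_ge0.
by rewrite ltr_pXn2r ?nnegrE// ltW.
Qed.

Lemma enormZ (c : R) y : 0 <= c -> enorm (c *: y) = c * enorm y.
Proof.
move=> c0; rewrite /enorm -[c in RHS](ger0_norm c0) -sqrtr_sqr -sqrtrM ?sqr_ge0// mulr_sumr.
by congr Num.sqrt; apply: eq_bigr => i _; rewrite mxE exprMn.
Qed.

Lemma lebesgue_eball_scale (c r : R) : 0 < c ->
  (mu (eball 0 (c * r)) = (c ^+ n)%:E * mu (eball 0 r))%E.
Proof.
move=> c0.
have muE r' : (\int[mu]_y (\1_(eball 0 r') y)%:E = mu (eball 0 r'))%E.
  by rewrite integral_indic ?setIT//; exact: measurable_eball.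
rewrite -!muE (ge0_integral_affine 0 c0); last 2 first.
- by apply/measurable_EFinP; apply: measurable_indic; exact: measurable_eball.
- by move=> y; rewrite lee_fin.
congr (_ * _)%E; apply: eq_integral => y _; rewrite !indicE; congr (_%:R%:E).
congr nat_of_bool; apply/idP/idP; rewrite !inE /eball/= !subr0 addr0 enormZ ?(ltW c0)// ltr_pM2l//.
Qed.

(** On the ball the kernel centred at 0 at time 1 is at least a constant c > 0, and its mass is
    one. *)
Lemma lebesgue_eball_lty r : 0 < r -> (mu (eball 0 r) < +oo)%E.
Proof.
move=> r0; pose c := ((4 * pi * 1) `^ (n%:R / 2))^-1 * expR (- (r ^+ 2 / (4 * 1))) : R.
have c0 : 0 < c by rewrite mulr_gt0 ?expR_gt0// invr_gt0 powR_gt0// !mulr_gt0 ?pi_gt0.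
have : (c%:E * mu (eball 0 r) <= 1)%E.
  rewrite -(integral_heat_kernel (0 : 'rV[R]_n) ltr01).
  rewrite -(setIT (eball 0 r)) -integral_indic//; last exact: measurable_eball.
  rewrite -ge0_integralZl//; last 2 first.
  - by apply/measurable_EFinP; apply: measurable_indic; exact: measurable_eball.
  - by rewrite lee_fin ltW.
  apply: ge0_le_integral => //.
  - by move=> y _; rewrite -EFinM lee_fin mulr_ge0// ltW.
  - apply/measurable_EFinP; apply: measurable_funM => //.
    by apply: measurable_indic; exact: measurable_eball.
  - by apply/measurable_EFinP; exact: measurable_heat_kernelr.
  - move=> y _; rewrite -EFinM lee_fin indicE; case: (boolP (_ \in _)) => [/[!inE] yr|_].
      rewrite mulr1 heat_kernelE ler_wpM2l ?invr_ge0 ?powR_ge0// ler_expR lerN2 ler_wpM2r//.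
      by rewrite sqdistC ltW//; apply/eballP.
    by rewrite mulr0 heat_kernel_ge0.
move=> H; rewrite ltNge leye_eq; apply/negP => /eqP E.
by move: H; rewrite E gt0_muley ?lte_fin// leye_eq.
Qed.

(** If a ball were null, so would be its dilates and then the whole space, against the mass one of
    the kernel. *)
Lemma lebesgue_eball_gt0 r : 0 < r -> (0 < mu (eball 0 r))%E.
Proof.
move=> r0; rewrite lt0e measure_ge0 andbT; apply/eqP => E.
have E' k : mu (eball 0 (k.+1%:R * r)) = 0%E by rewrite lebesgue_eball_scale// E mule0.
have : mu setT = 0%E.
  apply/eqP; rewrite eq_le measure_ge0 andbT.
  rewrite (_ : setT = \bigcup_k eball 0 (k.+1%:R * r)); last first.
    apply/seteqP; split=> // y _; pose k := Num.truncn (enorm y / r).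
    exists k => //; rewrite /eball/= subr0 -ltr_pdivrMr//.
    exact: truncnS_gt.
  apply: le_trans (measure_sigma_subadditive _ _ _ (@subset_refl _ _)) _.
  - by move=> k; exact: measurable_eball.
  - by apply: bigcup_measurable => k _; exact: measurable_eball.
  - by rewrite eseries0// => k _ _; exact: E'.
move=> H; have := integral_heat_kernel (0 : 'rV[R]_n) ltr01.
rewrite null_set_integral//.
- by move=> /eqP; rewrite eq_sym onee_eq0.
- by apply/measurable_EFinP; exact: measurable_heat_kernelr.
Qed.

Lemma fine_eball r : 0 < r -> (mu (eball 0 r) = (fine (mu (eball 0 r)))%:E)%E.
Proof. by move=> r0; rewrite fineK// ge0_fin_numE// lebesgue_eball_lty. Qed.

End density.

(** * Upper density and the heat flow *)

Section heat_density.
Context (R : realType) (n : nat).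
Implicit Types (x y : 'rV[R]_n) (r t : R) (phi : 'rV[R]_n -> R).
Local Notation mu := (lebesgue_rV R n).

(** Coordinatewise, (a - b)^2 = (1 - 1/c) a^2 - (c - 1) b^2 + (a - c b)^2 / c. Dropping the last
    square gives a lower bound which at |x| = c r and |y| = r is exactly ((c - 1) r)^2. *)
Lemma sqdist_annulus (c r : R) x y : 1 < c -> 0 < r ->
  ~ eball 0 (c * r) x -> eball 0 r y -> ((c - 1) * r) ^+ 2 <= sqdist x y.
Proof.
move=> c1 r0 xc /(eballP _ r0) yr; have c0 : 0 < c by exact: lt_trans c1.
have {}xc : (c * r) ^+ 2 <= sqdist x 0.
  by rewrite leNgt; apply/negP => H; apply: xc; apply/eballP => //; rewrite mulr_gt0.
apply: (@le_trans _ _ ((1 - c^-1) * sqdist x 0 - (c - 1) * sqdist y 0)).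
  apply: (@le_trans _ _ ((1 - c^-1) * (c * r) ^+ 2 - (c - 1) * r ^+ 2)).
    by rewrite le_eqVlt; apply/orP; left; apply/eqP; field; rewrite gt_eqF.
  apply: lerB; first by rewrite ler_wpM2l// subr_ge0 invf_le1// ltW.
  by rewrite ler_wpM2l ?subr_ge0 ?(ltW c1) ?(ltW yr).
rewrite /sqdist !mulr_sumr -sumrB; apply: ler_sum => i _; rewrite !mxE !subr0.
rewrite -subr_ge0 (_ : _ - _ = (x ord0 i - c * y ord0 i) ^+ 2 / c).
  by rewrite divr_ge0 ?sqr_ge0 ?(ltW c0).
by field; rewrite gt_eqF.
Qed.

(** Chebyshev: outside the ball of radius c r, 1 is at most |x - y|^2 / ((c - 1) r)^2, and the
    second moment is controlled by [sqdist_heat_kernel]. *)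
Lemma heat_kernel_mass_ball (c r t : R) y : 1 < c -> 0 < r -> 0 < t -> eball 0 r y ->
  1 - 8 * t * 2 `^ (n%:R / 2) / ((c - 1) * r) ^+ 2 <=
  \int[mu]_x (\1_(eball 0 (c * r)) x * heat_kernel x y t).
Proof.
move=> c1 r0 t0 yr; have t20 : 0 < 2 * t by rewrite mulr_gt0.
set k := _ / _ ^+ 2.
have d0 : 0 < ((c - 1) * r) ^+ 2 by rewrite exprn_gt0// mulr_gt0// subr_gt0.
have k0 : 0 <= k by rewrite divr_ge0 ?(ltW d0)// !mulr_ge0 ?powR_ge0// ltW.
have i1 := integrable_heat_kernel y t0.
have i2 := integrable_heat_kernel y t20.
have i3 : mu.-integrable setT (EFin \o (fun x => k * heat_kernel y x (2 * t))).
  by have := integrableZl measurableT k i2.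
rewrite -[X in X - k](Rintegral_heat_kernel y t0) -[k in leLHS]mulr1 -(Rintegral_heat_kernel y t20).
rewrite -RintegralZl// -RintegralB//.
apply: le_Rintegral => //.
- by have := integrableB measurableT i1 i3.
- apply: dominated_integrable i1 _.
    apply: measurable_funM; last exact: measurable_heat_kernel.
    by apply: measurable_indic; exact: measurable_eball.
  move=> x; rewrite heat_kernelC indicE normrM (ger0_norm (heat_kernel_ge0 _ _ _)).
  by case: (_ \in _); rewrite ?normr1 ?mul1r// normr0 mul0r heat_kernel_ge0.
- move=> x _; rewrite indicE; case: (boolP (_ \in _)) => [_|].
    by rewrite mul1r heat_kernelC lerBlDr lerDl mulr_ge0// heat_kernel_ge0.
  rewrite notin_setE => xc; rewrite mul0r subr_le0 /k -mulrAC ler_pdivlMr//.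
  apply: le_trans (sqdist_heat_kernel y x t0).
  rewrite mulrC ler_wpM2r ?heat_kernel_ge0// sqdistC.
  exact: sqdist_annulus.
Qed.

(** The integral of a g(x, y, t) over x in B(0, c r) and y in E, |y| < r, is computed in both
    orders. Integrating in x first keeps almost all the mass of the kernel; integrating in y first
    gives at most P_t phi (x) <= a L for each x. The enlarged radius c r prevents a loss near the
    boundary. *)
Lemma mass_le_heat (c r t a L M : R) phi (E : set 'rV[R]_n) :
  1 < c -> 0 < r -> 0 < t -> 0 < a -> bounded_by M phi -> (forall y, 0 <= phi y) ->
  measurable E -> (forall y, E y -> a <= phi y) -> (forall x, heat phi x t <= a * L) -> 0 <= L ->
  0 <= 1 - 8 * t * 2 `^ (n%:R / 2) / ((c - 1) * r) ^+ 2 ->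
  ((1 - 8 * t * 2 `^ (n%:R / 2) / ((c - 1) * r) ^+ 2)%:E * mu (E `&` eball 0 r) <=
   (L * c ^+ n)%:E * mu (eball 0 r))%E.
Proof.
move=> c1 r0 t0 a0 bphi phi0 mE Ea hL L0; set k := 1 - _ => k0.
have c0 : 0 < c by exact: lt_trans c1.
have mB r' : measurable (eball (0 : 'rV[R]_n) r') by exact: measurable_eball.
pose A := E `&` eball 0 r; have mA : measurable A by exact: measurableI.
have mI (B : set 'rV[R]_n) : measurable B -> measurable_fun [set: 'rV[R]_n] (\1_B : _ -> R).
  exact: measurable_indic.
pose f (z : 'rV[R]_n * 'rV[R]_n) : \bar R :=
  ((\1_(eball 0 (c * r)) z.1 * heat_kernel z.1 z.2 t) * (a * \1_A z.2))%:E.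
have mf : measurable_fun setT f.
  apply/measurable_EFinP; apply: measurable_funM.
    apply: measurable_funM; last by apply: measurable_heat_kernel => //.
    exact: (measurableT_comp (mI _ (mB (c * r))) measurable_fst).
  apply: measurable_funM => //.
  exact: (measurableT_comp (mI _ mA) measurable_snd).
have f0 z : (0 <= f z)%E.
  rewrite lee_fin; apply: mulr_ge0; first by apply: mulr_ge0; rewrite ?heat_kernel_ge0.
  by apply: mulr_ge0 => //; exact: ltW.
have lower : ((a * k)%:E * mu A <= \int[mu]_y \int[mu]_x f (x, y))%E.
  rewrite -(setIT A) -integral_indic// -ge0_integralZl//; last 2 first.
  - by apply/measurable_EFinP; exact: measurable_indic.
  - by rewrite lee_fin mulr_ge0// ltW.
  apply: ge0_le_integral => //.
  - by move=> y _; rewrite -EFinM lee_fin mulr_ge0// mulr_ge0// ltW.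
  - apply/measurable_EFinP; apply: measurable_funM => //; exact: measurable_indic.
  - exact: (@measurable_fun_fubini_tonelli_G _ _ _ _ R mu f mf f0).
  move=> y _; rewrite -EFinM indicE; case: (boolP (y \in A)) => [/[!inE]yA|_]; last first.
    by rewrite mulr0; exact: integral_ge0.
  have -> : (\int[mu]_x f (x, y) = (a * \int[mu]_x (\1_(eball 0 (c * r)) x * heat_kernel x y t))%:E)%E.
    rewrite EFinM EFin_Rintegral; last first.
      apply: dominated_integrable (integrable_heat_kernel y t0) _.
        apply: measurable_funM; last exact: measurable_heat_kernel.
        exact: measurable_indic.
      move=> x; rewrite heat_kernelC indicE normrM (ger0_norm (heat_kernel_ge0 _ _ _)).
      by case: (_ \in _); rewrite ?normr1 ?mul1r// normr0 mul0r heat_kernel_ge0.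
    rewrite -ge0_integralZl//; last 3 first.
    - apply/measurable_EFinP; apply: measurable_funM; last exact: measurable_heat_kernel.
      exact: measurable_indic.
    - by move=> x _; rewrite lee_fin mulr_ge0// heat_kernel_ge0.
    - by rewrite lee_fin ltW.
    apply: eq_integral => x _; rewrite /f/= [\1_A y]indicE mem_set// mulr1 -EFinM.
    by congr EFin; rewrite mulrC.
  by rewrite lee_fin mulr1 ler_wpM2l ?(ltW a0)//; apply: heat_kernel_mass_ball => //; case: yA.
have upper : (\int[mu]_x \int[mu]_y f (x, y) <= (a * L)%:E * mu (eball 0 (c * r)))%E.
  rewrite -(setIT (eball 0 (c * r))) -integral_indic// -ge0_integralZl//; last 2 first.
  - by apply/measurable_EFinP; exact: measurable_indic.
  - by rewrite lee_fin mulr_ge0// ltW.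
  apply: ge0_le_integral => //.
  - by move=> x _; exact: integral_ge0.
  - exact: (@measurable_fun_fubini_tonelli_F _ _ _ _ R mu f mf f0).
  - apply/measurable_EFinP; apply: measurable_funM => //; exact: measurable_indic.
  move=> x _; rewrite -EFinM; case: (boolP (x \in eball 0 (c * r))) => xB; last first.
    rewrite (eq_integral (cst 0%E)) ?integral0 ?lee_fin ?mulr_ge0 ?(ltW a0)// => y _.
    by rewrite /f/= (_ : \1_(eball 0 (c * r)) x = 0) ?mul0r//; rewrite indicE (negbTE xB).
  rewrite indicE xB mulr1; apply: (@le_trans _ _ (heat phi x t)%:E); last by rewrite lee_fin.
  rewrite (EFin_heat _ _ bphi); apply: ge0_le_integral => //.
  - exact: (measurableT_comp mf (pair1_measurable x)).
  - apply/measurable_EFinP; apply: measurable_funM; last exact: bphi.1.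
    exact: measurable_heat_kernel0.
  - move=> y _; rewrite heat_kernel0E// lee_fin (_ : \1_(eball 0 (c * r)) x = 1) ?mul1r; last by rewrite indicE xB.
    rewrite ler_wpM2l ?heat_kernel_ge0//= indicE; case: (boolP (_ \in _)) => [|_]; last by rewrite mulr0.
    by rewrite inE mulr1 => -[/Ea].
have := le_trans lower _; rewrite -(fubini_tonelli f mf f0) => /(_ _ upper).
rewrite lebesgue_eball_scale// !EFinM -!muleA lee_pmul2l ?fin_numE//?lte_fin//.
Qed.

(** The contrapositive form of sup P_t phi >= a D(a). In [mass_le_heat] the mass lost is K / r^2,
    which tends to 0 as r grows, while c is fixed so close to 1 that L c^n < L + e. *)
Lemma upper_density_le_heat (t a L M : R) phi :
  0 < t -> 0 < a -> bounded_by M phi -> (forall y, 0 <= phi y) -> 0 <= L ->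
  (forall x, heat phi x t <= a * L) -> (upper_density phi a <= L%:E)%E.
Proof.
move=> t0 a0 bphi phi0 L0 hL; apply/lee_addgt0Pr => e e0.
have mE : measurable [set x | a <= phi x].
  have := bphi.1 measurableT `[a, +oo[%classic (measurable_itv _); rewrite setTI.
  by congr measurable; apply/seteqP; split => y /=; rewrite in_itv/= andbT.
have [c c1 cL] : exists2 c : R, 1 < c & L * c ^+ n < L + e.
  have cc : (fun c : R => L * c ^+ n) @ (1 : R) --> L * 1 ^+ n.
    by apply: cvgMl_tmp; exact: exprn_continuous.
  have /(cvgr_lt _ cc) : L * 1 ^+ n < L + e by rewrite expr1n mulr1 ltrDl.
  move=> /nbhs_ballP[d /= d0 dL]; exists (1 + d / 2); first by rewrite ltrDl divr_gt0.
  apply: dL; rewrite /ball/= opprD addrA subrr sub0r normrN gtr0_norm ?divr_gt0//.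
  by rewrite ltr_pdivrMr// ltr_pMr// ltr1n.
pose K := 8 * t * 2 `^ (n%:R / 2) / (c - 1) ^+ 2.
have c10 : 0 < (c - 1) ^+ 2 by rewrite exprn_gt0// subr_gt0.
have K0 : 0 < K by rewrite divr_gt0// !mulr_gt0// powR_gt0.
(* The relative gap between L c^n and L + e. For r > K / g + 1 the loss K / r^2 stays below it. *)
pose g := 1 - L * c ^+ n / (L + e).
have Le : 0 < L + e by rewrite ltr_wpDl.
have g0 : 0 < g by rewrite subr_gt0 ltr_pdivrMr// mul1r.
have g1 : g <= 1.
  by rewrite gerBl divr_ge0 ?(ltW Le)// mulr_ge0// exprn_ge0// ltW// (lt_trans _ c1).
rewrite /upper_density limf_esupE; apply: ge_ereal_inf.
exists (ereal_sup [set density [set x | a <= phi x] r | r in [set r | K / g + 1 < r]]).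
  exists [set r | K / g + 1 < r] => //.
  by exists (K / g + 1); split => //; exact: num_real.
apply: ge_ereal_sup => _ [r /= rK <-].
have Kg : 0 < K / g by rewrite divr_gt0.
have r1 : 1 < r by apply: lt_trans rK; rewrite ltrDr.
have r0 : 0 < r by exact: lt_trans r1.
have Kr : K / r ^+ 2 < g.
  rewrite ltr_pdivrMr ?exprn_gt0// mulrC -ltr_pdivrMr//.
  apply: (@lt_le_trans _ _ r); first by rewrite (le_lt_trans _ rK)// lerDl.
  by rewrite expr2 ler_peMr// ltW.
have E : 8 * t * 2 `^ (n%:R / 2) / ((c - 1) * r) ^+ 2 = K / r ^+ 2.
  by rewrite /K exprMn invfM mulrA.
have := @mass_le_heat c r t a L M phi [set x | a <= phi x] c1 r0 t0 a0 bphi phi0 mE (fun _ => id) hL L0.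
rewrite E subr_ge0 => /(_ (le_trans (ltW Kr) g1)) H.
have m0 := lebesgue_eball_gt0 n r0 : (0 < mu (eball 0 r))%E.
rewrite /density -EFinD.
have mr := fine_eball n r0.
set m := fine _ in mr; rewrite mr in m0 H *; rewrite lte_fin in m0.
have inv : (m%:E^-1 = (m^-1)%:E)%E by rewrite inver gt_eqF.
rewrite inv.
have fA : mu ([set x | a <= phi x] `&` eball 0 r) \is a fin_num.
  rewrite ge0_fin_numE//; apply: le_lt_trans (lebesgue_eball_lty n r0).
  by apply: le_measure; rewrite ?inE//; [apply: measurableI => //|]; exact: measurable_eball.
rewrite -(fineK fA) in H *; set mA := fine _ in H *.
rewrite -!EFinM !lee_fin in H *.
rewrite ler_pdivrMr//.
rewrite leNgt; apply/negP => mAm.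
have mA0 : 0 < mA by apply: le_lt_trans mAm; rewrite mulr_ge0// ltW.
have : (1 - g) * ((L + e) * m) <= (1 - g) * mA by rewrite ler_wpM2l ?subr_ge0// ltW.
have : (1 - g) * mA < (1 - K / r ^+ 2) * mA by rewrite ltr_pM2r// ltrD2l ltrN2.
move=> A1 A2; have := lt_le_trans (le_lt_trans A2 A1) H.
by rewrite /g opprB addrC subrK mulrA mulfVK ?gt_eqF// ltxx.
Qed.

End heat_density.

(** * Differentiation under the integral sign *)

Lemma is_derive_cvgP (R : realType) (V : normedModType R) (f : V -> R) (x v : V) (l : R) :
  is_derive x v f l <-> h^-1 *: (f (h *: v + x) - f x) @[h --> 0^'] --> l.
Proof.
split=> [[df <-]|cf]; first exact: df.
by apply: DeriveDef; [apply/cvg_ex; exists l|exact: cvg_lim].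
Qed.

Section derivative_lemmas.
Context (R : realType) (V : normedModType R).
Implicit Types (f g : V -> R) (x v : V).

Lemma is_derive_line f x v l :
  is_derive (0 : R) 1 (fun h => f (h *: v + x)) l <-> is_derive x v f l.
Proof.
by split=> D; have H := (is_derive_cvgP _ _ _ _).1 D;
  apply: (is_derive_cvgP _ _ _ _).2; apply: cvg_trans H;
  apply: near_eq_cvg; apply: nearW => h /=;
  rewrite addr0 scale0r add0r [h *: 1]mulr1.
Qed.

Lemma is_derive_lineh f x v l (h : R) :
  is_derive (h *: v + x) v f l -> is_derive h 1 (fun h => f (h *: v + x)) l.
Proof.
move=> D; have H := (is_derive_cvgP _ _ _ _).1 D.
apply: (is_derive_cvgP _ _ _ _).2; apply: cvg_trans H.
by apply: near_eq_cvg; apply: nearW => k /=; rewrite [k *: 1]mulr1 scalerDl addrA.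
Qed.

End derivative_lemmas.

Section dominated.
Context d (T : measurableType d) (R : realType) (mu : {measure set T -> \bar R}).

Lemma dominated_cvg_Rintegral (f_ : nat -> T -> R) (f g : T -> R) :
  (forall k, measurable_fun [set: T] (f_ k)) -> measurable_fun [set: T] f ->
  mu.-integrable [set: T] (EFin \o g) -> (forall k x, `|f_ k x| <= g x) ->
  (\forall x \ae mu, f_ k x @[k --> \oo] --> f x) ->
  \int[mu]_x f_ k x @[k --> \oo] --> \int[mu]_x f x.
Proof.
move=> mf mlim ig fg cf.
have mEf k : measurable_fun [set: T] (fun y => (f_ k y)%:E) by exact/measurable_EFinP.
have mElim : measurable_fun [set: T] (fun y => (f y)%:E) by exact/measurable_EFinP.
have cE : \forall y \ae mu, [set: T] y -> (f_ k y)%:E @[k --> \oo] --> (f y)%:E.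
  by apply: filterS cf => y cf _; apply: cvg_EFin; [exact: nearW|exact: cf].
have [i0 _ L] := @dominated_convergence _ T R mu setT measurableT
  (fun k y => (f_ k y)%:E) (fun y => (f y)%:E) (EFin \o g) mEf mElim cE ig
  (aeW _ (fun y k _ => fg k y)).
by apply: fine_cvg; rewrite fineK ?integrable_fin_num.
Qed.

(** Dominated convergence concerns sequences: a failure of continuity is turned into points within 1
    / (k + 1) of x0, the minimum with d0 keeping them where g dominates. *)
Lemma dominated_continuous (X : pseudoMetricType R) (f : X -> T -> R) (g : T -> R) (x0 : X) :
  (forall x, measurable_fun [set: T] (f x)) -> mu.-integrable [set: T] (EFin \o g) ->
  (\forall x \near x0, forall y, `|f x y| <= g y) ->
  (\forall y \ae mu, {for x0, continuous (f ^~ y)}) ->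
  {for x0, continuous (fun x => \int[mu]_y f x y)}.
Proof.
move=> mf ig fg cf; apply: continuous_at_ball => e e0.
apply: contrapT => H.
have [d0 /= d00 fgd] : nbhs_ball x0 (fun x => forall y, `|f x y| <= g y) by apply/nbhs_ballP.
have /choice[xs xsP] : forall k : nat, exists x, ball x0 (Num.min d0 k.+1%:R^-1) x /\
    ~ ball (\int[mu]_y f x0 y) e (\int[mu]_y f x y).
  move=> k; apply: contrapT => Hk; apply: H; apply/nbhs_ballP.
  exists (Num.min d0 k.+1%:R^-1) => /=; first by rewrite lt_min d00/=.
  by move=> x xb; apply: contrapT => Hx; apply: Hk; exists x.
have xg k y : `|f (xs k) y| <= g y.
  by apply: fgd; apply: le_ball (xsP k).1; rewrite ge_min lexx.
have cv : \forall y \ae mu, f (xs k) y @[k --> \oo] --> f x0 y.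
  apply: filterS cf => y cfy; apply/cvgrPdist_lt => eps eps0.
  have [d1 /= d10 fd] : nbhs_ball x0 (fun x => `|f x0 y - f x y| < eps).
    by apply/nbhs_ballP; move/cvgrPdist_lt : cfy; exact.
  near=> k; apply: fd; apply: le_ball (xsP k).1.
  rewrite ge_min; apply/orP; right; near: k.
  have := near_infty_natSinv_lt (PosNum d10).
  by apply: filterS => k /ltW.
have L := dominated_cvg_Rintegral (fun k => mf (xs k)) (mf x0) ig xg cv.
move/cvgrPdist_lt : L => /(_ _ e0)[N _ /(_ N (leqnn N))] /= LN.
by have [_] := xsP N; apply.
Unshelve. all: by end_near. Qed.

Lemma is_derive_under_integral (f df : R -> T -> R) (g : T -> R) (a e : R) : 0 < e ->
  (forall h, mu.-integrable [set: T] (EFin \o f h)) ->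
  mu.-integrable [set: T] (EFin \o g) ->
  (forall h y, `|h - a| < e -> is_derive h 1 (f ^~ y) (df h y)) ->
  (forall h y, `|h - a| < e -> `|df h y| <= g y) ->
  is_derive a 1 (fun h => \int[mu]_y f h y) (\int[mu]_y df a y).
Proof.
move=> e0 fa ig fdf dfg.
have Iab h : `]a - e, a + e[%classic h -> `|h - a| < e.
  by rewrite /= in_itv/= distrC ltr_distlC.
have Ia : `]a - e, a + e[%classic a by rewrite /= in_itv/= ltrBlDr ltrDl e0.
have p1 h y : `|h - a| < e -> partial1of2 f h y = df h y.
  by move=> he; rewrite /partial1of2 derive1E; have [_ ->] := fdf h y he.
have aa : `|a - a| < e by rewrite subrr normr0.
have g0 y : 0 <= g y by apply: le_trans (dfg a y aa).
have gub h y : `]a - e, a + e[%classic h -> setT y -> `|partial1of2 f h y| <= g y.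
  by move=> /Iab hI _; rewrite p1// dfg.
have := @cvg_differentiation_under_integral R _ T mu f setT measurableT a (a - e) (a + e) Ia
  (fun h _ => fa h)
  (fun h y hI _ => (@ex_derive _ _ _ _ _ _ _ (fdf h y (Iab h hI)))) g g0 ig gub.
have -> : \int[mu]_y partial1of2 f a y = \int[mu]_y df a y by apply: eq_Rintegral => y _; exact: p1.
move=> H; apply: (is_derive_cvgP _ _ _ _).2; apply: cvg_trans H.
by apply: near_eq_cvg; apply: nearW => h /=; rewrite [h *: 1]mulr1.
Qed.

End dominated.

(** * Spatial derivatives of the heat flow *)

Section heat_regularity.
Context (R : realType) (n : nat).
Implicit Types (x y : 'rV[R]_n) (t s : R) (w : 'rV[R]_n -> R) (i : 'I_n).
Local Notation mu := (lebesgue_rV R n).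
Local Notation dir i := (delta_mx ord0 i : 'rV[R]_n).

Definition dheat_kernel0 i x y t : R := if 0 < t then dheat_kernel i x y t else 0.

Lemma dheat_kernel0E i x y t : 0 < t -> dheat_kernel0 i x y t = dheat_kernel i x y t.
Proof. by rewrite /dheat_kernel0 => ->. Qed.

Lemma dheat_kernel0_le0 i x y t : t <= 0 -> dheat_kernel0 i x y t = 0.
Proof. by rewrite /dheat_kernel0 ltNge => ->. Qed.

(** A common majorant near (x0, t0) for the kernel and its derivatives, whose polynomial factors are
    at most A (1 + |x - y|^2). It allows differentiation under the integral and limits in [heat] and
    its derivatives. *)
Lemma heat_kernels_dom t0 : 0 < t0 -> exists2 C, 0 <= C &
  forall x0 x y t, sqdist x x0 <= t0 -> t0 / 2 <= t <= 2 * t0 ->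
  [/\ heat_kernel x y t <= C * heat_kernel x0 y (8 * t0),
      forall i, `|dheat_kernel i x y t| <= C * heat_kernel x0 y (8 * t0) &
      forall i, `|d2heat_kernel i x y t| <= C * heat_kernel x0 y (8 * t0)].
Proof.
move=> t0p; have [C C0 HC] := heat_kernel_local_dom n t0p.
pose A := 1 + t0^-1 + t0 ^- 2.
have i0 : 0 < t0^-1 by rewrite invr_gt0.
have j0 : 0 < t0 ^- 2 by rewrite invr_gt0 exprn_gt0.
have A1 : 1 <= A by rewrite /A -addrA lerDl addr_ge0// ltW.
have A0 : 0 <= A by apply: le_trans A1.
exists (A * C) => [|x0 x y t xx0 tt0]; first exact: mulr_ge0.
have /andP[tl tu] := tt0.
have tp : 0 < t by apply: lt_le_trans tl; rewrite divr_gt0.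
have K0 := heat_kernel_ge0 x y t.
have q0 := sqdist_ge0 x y.
have H := HC x0 x y t xx0 tt0.
have key a : a <= A * (1 + sqdist x y) -> a * heat_kernel x y t <= A * C * heat_kernel x0 y (8 * t0).
  move=> aA; apply: le_trans (ler_wpM2r K0 aA) _.
  by rewrite -!mulrA ler_wpM2l.
have t2 : (2 * t)^-1 <= t0^-1.
  by rewrite lef_pV2 ?posrE ?mulr_gt0// mulrC -ler_pdivrMr.
split=> [|i|i].
- rewrite -[leLHS]mul1r; apply: key.
  by apply: le_trans A1 _; rewrite ler_peMr// lerDl.
- rewrite /dheat_kernel normrM (ger0_norm K0); apply: key.
  rewrite normrN normrM [X in _ * X]ger0_norm ?invr_ge0 ?mulr_ge0 ?(ltW tp)//.
  apply: (@le_trans _ _ ((1 + sqdist x y) * t0^-1)).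
    apply: ler_pM => //; first by rewrite invr_ge0 mulr_ge0 ?(ltW tp).
    apply: (@le_trans _ _ (1 + (x ord0 i - y ord0 i) ^+ 2)); last by rewrite lerD2l sqdist_coord.
    rewrite -[(_ - _) ^+ 2]real_normK ?num_real//; move: `|_ - _| => v.
    rewrite -subr_ge0 (_ : _ - _ = (v - 1 / 2) ^+ 2 + 3 / 4); last by field.
    by rewrite addr_ge0 ?sqr_ge0// divr_ge0.
  rewrite mulrC ler_wpM2r ?addr_ge0// /A.
  by rewrite addrAC lerDr addr_ge0// ltW.
- rewrite /d2heat_kernel normrM (ger0_norm K0); apply: key.
  apply: le_trans (ler_normB _ _) _.
  rewrite [X in _ + X]ger0_norm ?invr_ge0 ?mulr_ge0 ?(ltW tp)//.
  rewrite [X in X + _]ger0_norm; last first.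
    by rewrite mulr_ge0 ?sqr_ge0// invr_ge0 mulr_ge0 ?sqr_ge0.
  apply: (@le_trans _ _ (sqdist x y * t0 ^- 2 + t0^-1)).
    apply: lerD => //; apply: ler_pM; rewrite ?sqr_ge0 ?sqdist_coord//.
      by rewrite invr_ge0 mulr_ge0 ?sqr_ge0.
    rewrite lef_pV2 ?posrE ?mulr_gt0 ?exprn_gt0//.
    rewrite (_ : 4 * t ^+ 2 = (2 * t) ^+ 2); last by ring.
    by rewrite ler_pXn2r ?nnegrE ?mulr_ge0 ?(ltW t0p) ?(ltW tp)// mulrC -ler_pdivrMr.
  rewrite /A mulrDr mulr1 addrC; apply: lerD; first by rewrite addrAC lerDr addr_ge0// ltW.
  by rewrite mulrC ler_wpM2r// lerDr addr_ge0// ltW.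
Qed.

Lemma measurable_dheat_kernel0 i d (T : measurableType d) (f g : T -> 'rV[R]_n) (h : T -> R) :
  measurable_fun [set: T] f -> measurable_fun [set: T] g -> measurable_fun [set: T] h ->
  measurable_fun [set: T] (fun z => dheat_kernel0 i (f z) (g z) (h z)).
Proof.
move=> mf mg mh; apply: measurable_fun_ifT => //.
  exact: measurable_fun_ltr.
apply: measurable_funM; last exact: measurable_heat_kernel.
apply: (measurable_funR_comp (h := -%R)) => //.
apply: measurable_funM.
  apply: measurable_funB.
  - exact: measurableT_comp (@measurable_coord R n i) mf.
  - exact: measurableT_comp (@measurable_coord R n i) mg.
apply: (measurable_funR_comp (h := fun r => r^-1)); first exact: measurable_invr.
exact: measurable_funM.
Qed.

Definition dheat i w x t : R := \int[mu]_y (dheat_kernel0 i x y t * w y).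

Lemma dheat_le0 i w x t : t <= 0 -> dheat i w x t = 0.
Proof.
by move=> t0; rewrite /dheat; under eq_Rintegral do rewrite dheat_kernel0_le0// mul0r;
  rewrite Rintegral_cst// mul0r.
Qed.

Definition dheat_const : R := 2 `^ (n%:R / 2).

Lemma dheat_const_ge0 : 0 <= dheat_const. Proof. exact: powR_ge0. Qed.

Lemma integrable_heat_kernel_scale (c : R) x t : 0 < t ->
  mu.-integrable setT (EFin \o (fun y => c * heat_kernel x y t)).
Proof. by move=> t0; have := integrableZl measurableT c (integrable_heat_kernel x t0). Qed.

Lemma dheat_norm_le i M w x t : bounded_by M w -> 0 < t ->
  `|dheat i w x t| <= M * dheat_const * (Num.sqrt t)^-1.
Proof.
move=> bw t0; have t20 : 0 < 2 * t by rewrite mulr_gt0.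
rewrite -[leRHS]mulr1 -(Rintegral_heat_kernel x t20) -RintegralZl//; last exact: integrable_heat_kernel.
apply: normr_Rintegral_le.
- by apply: measurable_funM; [exact: measurable_dheat_kernel0|exact: bw.1].
- exact: integrable_heat_kernel_scale.
- move=> y; rewrite dheat_kernel0E// normrM mulrC.
  apply: le_trans (ler_pM _ _ (bw.2 y) (dheat_kernel_le i x y t0)) _ => //.
  by rewrite le_eqVlt; apply/orP; left; apply/eqP; rewrite /dheat_const; ring.
Qed.

Lemma sqdist_line i x (h : R) : sqdist (h *: dir i + x) x = h ^+ 2.
Proof.
rewrite sqdist_delta subrr mulr0 addr0 /sqdist big1 ?add0r// => j _.
by rewrite subrr expr0n.
Qed.

Lemma is_derive_heat i M w x t : bounded_by M w -> 0 < t ->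
  is_derive x (dir i) (fun x => heat w x t) (dheat i w x t).
Proof.
move=> bw t0; apply/is_derive_line.
have [C C0 HC] := heat_kernels_dom t0.
have t80 : 0 < 8 * t by rewrite mulr_gt0.
rewrite (_ : dheat i w x t = \int[mu]_y (dheat_kernel i ((0 : R) *: dir i + x) y t * w y)); last first.
  by apply: eq_Rintegral => y _; rewrite scale0r add0r dheat_kernel0E.
(* For |h| < sqrt t the point h e_i + x is in the region where the kernel at time 8 t centred at x
   dominates. *)
apply: (@is_derive_under_integral _ _ R mu
  (fun h y => heat_kernel0 (h *: dir i + x) y t * w y)
  (fun h y => dheat_kernel i (h *: dir i + x) y t * w y)
  (fun y => M * C * heat_kernel x y (8 * t)) 0 (Num.sqrt t)).
- by rewrite sqrtr_gt0.
- by move=> h; exact: integrable_heat bw.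
- exact: integrable_heat_kernel_scale.
- move=> h y _; rewrite (_ : (fun h : R => _) = (fun h : R => heat_kernel (h *: dir i + x) y t) * cst (w y)); last first.
    by apply/funext => k; rewrite heat_kernel0E.
  have H := is_derive_heat_kernel i x y h t0.
  apply: is_derive_eq; rewrite /GRing.scale/= mulr0 add0r mulrC//.
- move=> h y; rewrite subr0 => ht.
  have h1 : sqdist (h *: dir i + x) x <= t.
    rewrite sqdist_line -[h ^+ 2]real_normK ?num_real// -[leRHS]sqr_sqrtr ?(ltW t0)//.
    by rewrite ler_pXn2r ?nnegrE ?sqrtr_ge0// ltW.
  have h2 : t / 2 <= t <= 2 * t.
    by rewrite ler_pdivrMr// mulrC ?ler_peMl ?(ltW t0) ?ler1n.
  have [_ /(_ i) H _] := HC x (h *: dir i + x) y t h1 h2.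
  rewrite normrM mulrC -mulrA; apply: ler_pM => //; exact: bw.2.
Qed.

End heat_regularity.

Lemma Rintegral_sum d (T : measurableType d) (R : realType) (mu : {measure set T -> \bar R})
    (I : Type) (r : seq I) (f : I -> T -> R) :
  (forall i, mu.-integrable [set: T] (EFin \o f i)) ->
  mu.-integrable [set: T] (EFin \o (fun y => \sum_(i <- r) f i y)) /\
  \int[mu]_y (\sum_(i <- r) f i y) = \sum_(i <- r) \int[mu]_y f i y.
Proof.
move=> intf; elim: r => [|i r [IH1 IH2]].
  rewrite big_nil (_ : (fun y => _) = cst 0); last by apply/funext => y; rewrite big_nil.
  split; first exact: integrable0.
  by rewrite Rintegral_cst// mul0r.
rewrite big_cons (_ : (fun y => _) = (fun y => f i y + \sum_(j <- r) f j y)); last first.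
  by apply/funext => y; rewrite big_cons.
split; first by have := integrableD measurableT (intf i) IH1.
by rewrite RintegralD// IH2.
Qed.

(** * Continuity, second derivatives and time derivative of the heat flow *)

Section continuity_kernel.
Context (R : realType) (n : nat).
Implicit Types (x y : 'rV[R]_n) (t s : R) (w : 'rV[R]_n -> R) (i : 'I_n).
Local Notation mu := (lebesgue_rV R n).
Local Notation dir i := (delta_mx ord0 i : 'rV[R]_n).

Section composed.
Context (X : topologicalType) (z0 : X).

Lemma continuous_for_comp (h : R -> R) (f : X -> R) :
  {for z0, continuous f} -> {for f z0, continuous h} -> {for z0, continuous (fun z => h (f z))}.
Proof. by move=> cf ch; exact: (continuous_comp cf ch). Qed.

Lemma near_eq_continuous_for (f g : X -> R) :
  (\forall z \near z0, f z = g z) -> {for z0, continuous f} -> {for z0, continuous g}.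
Proof.
move=> fg cf; rewrite /prop_for /continuous_at -(nbhs_singleton fg).
by apply: cvg_trans cf; apply: near_eq_cvg; apply: filterS fg.
Qed.

Lemma continuous_for_sum (I : Type) (r : seq I) (f : I -> X -> R) :
  (forall j, {for z0, continuous (f j)}) -> {for z0, continuous (fun z => \sum_(j <- r) f j z)}.
Proof.
move=> cf; elim: r => [|j r IH].
  rewrite (_ : (fun z => _) = cst 0); first exact: cst_continuous.
  by apply/funext => z; rewrite big_nil.
rewrite (_ : (fun z => _) = f j \+ (fun z => \sum_(j <- r) f j z)).
  by apply: continuousD => //; exact: cf.
by apply/funext => z; rewrite big_cons.
Qed.

Lemma continuous_sqdist (f g : X -> 'rV[R]_n) :
  {for z0, continuous f} -> {for z0, continuous g} ->
  {for z0, continuous (fun z => sqdist (f z) (g z))}.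
Proof.
move=> cf cg; apply: continuous_for_sum => i.
have ci (k : X -> 'rV[R]_n) : {for z0, continuous k} -> {for z0, continuous (fun z => k z ord0 i)}.
  by move=> ck; apply: (continuous_comp ck (g := fun v : 'rV[R]_n => v ord0 i)); exact: coord_continuous.
apply: (continuous_for_comp (h := fun r : R => r ^+ 2)); last exact: exprn_continuous.
by apply: continuousB; exact: ci.
Qed.

Lemma continuous_heat_kernel (f g : X -> 'rV[R]_n) (h : X -> R) :
  {for z0, continuous f} -> {for z0, continuous g} -> {for z0, continuous h} -> 0 < h z0 ->
  {for z0, continuous (fun z => heat_kernel (f z) (g z) (h z))}.
Proof.
move=> cf cg ch h0.
rewrite (_ : (fun z => _) = fun z => (4 * pi * h z) `^ (- (n%:R / 2)) *
   expR (- (sqdist (f z) (g z) / (4 * h z)))); last first.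
  by apply/funext => z; rewrite heat_kernelE -powRN.
have p0 : 0 < 4 * pi * h z0 by rewrite !mulr_gt0 ?pi_gt0.
apply: continuousM.
  apply: (continuous_for_comp (h := fun r : R => r `^ _)).
    by apply: continuousM => //; exact: cst_continuous.
  apply: differentiable_continuous; apply/derivable1_diffP.
  by have [] := is_derive1_powR (- (n%:R / 2)) p0.
apply: (continuous_for_comp (h := expR)); last exact: continuous_expR.
apply: (continuous_for_comp (h := -%R)); last exact: oppr_continuous.
apply: continuousM; first exact: continuous_sqdist.
apply: continuousV; first by rewrite mulf_neq0// gt_eqF.
by apply: continuousM => //; exact: cst_continuous.
Qed.

Lemma continuous_dheat_kernel i (f g : X -> 'rV[R]_n) (h : X -> R) :
  {for z0, continuous f} -> {for z0, continuous g} -> {for z0, continuous h} -> 0 < h z0 ->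
  {for z0, continuous (fun z => dheat_kernel i (f z) (g z) (h z))}.
Proof.
move=> cf cg ch h0.
have ci (k : X -> 'rV[R]_n) : {for z0, continuous k} -> {for z0, continuous (fun z => k z ord0 i)}.
  by move=> ck; apply: (continuous_comp ck (g := fun v : 'rV[R]_n => v ord0 i)); exact: coord_continuous.
apply: continuousM; last exact: continuous_heat_kernel.
apply: (continuous_for_comp (h := -%R)); last exact: oppr_continuous.
apply: continuousM; first by apply: continuousB; exact: ci.
apply: continuousV; first by rewrite mulf_neq0// gt_eqF.
by apply: continuousM => //; exact: cst_continuous.
Qed.

End composed.

Lemma continuous_fst_at (z0 : 'rV[R]_n * R) : {for z0, continuous (fun z : 'rV[R]_n * R => z.1)}.
Proof. exact: cvg_fst. Qed.

Lemma continuous_snd_at (z0 : 'rV[R]_n * R) : {for z0, continuous (fun z : 'rV[R]_n * R => z.2)}.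
Proof. exact: cvg_snd. Qed.

Lemma continuous_cst_at (z0 : 'rV[R]_n * R) (T : topologicalType) (c : T) :
  {for z0, continuous (fun _ : 'rV[R]_n * R => c)}.
Proof. exact: cvg_cst. Qed.

Lemma continuous_heat_kernel_at x0 t0 y : 0 < t0 ->
  {for ((x0, t0) : 'rV[R]_n * R), continuous (fun z : 'rV[R]_n * R => heat_kernel z.1 y z.2)}.
Proof.
move=> t0p; apply: continuous_heat_kernel t0p.
- exact: continuous_fst_at.
- exact: continuous_cst_at.
- exact: continuous_snd_at.
Qed.

Lemma continuous_dheat_kernel_at i x0 t0 y : 0 < t0 ->
  {for ((x0, t0) : 'rV[R]_n * R), continuous (fun z : 'rV[R]_n * R => dheat_kernel i z.1 y z.2)}.
Proof.
move=> t0p; apply: continuous_dheat_kernel t0p.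
- exact: continuous_fst_at.
- exact: continuous_cst_at.
- exact: continuous_snd_at.
Qed.

Lemma near_heat_dom x0 t0 : 0 < t0 ->
  \forall z \near ((x0, t0) : 'rV[R]_n * R), sqdist z.1 x0 <= t0 /\ t0 / 2 <= z.2 <= 2 * t0.
Proof.
move=> t0p.
have c1 : {for ((x0, t0) : 'rV[R]_n * R), continuous (fun z : 'rV[R]_n * R => sqdist z.1 x0)}.
  by apply: continuous_sqdist; [exact: cvg_fst|exact: cst_continuous].
have c2 : {for ((x0, t0) : 'rV[R]_n * R), continuous (fun z : 'rV[R]_n * R => z.2)}.
  exact: cvg_snd.
have e1 : sqdist x0 x0 < t0 by rewrite /sqdist big1// => i _; rewrite subrr expr0n.
have e2 : t0 / 2 < t0 by rewrite ltr_pdivrMr// ltr_pMr// ltr1n.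
have e3 : t0 < 2 * t0 by rewrite ltr_pMl// ltr1n.
near=> z; split; first by apply: ltW; near: z; exact: (cvgr_lt _ c1).
by apply/andP; split; apply: ltW; near: z; [exact: (cvgr_gt _ c2)|exact: (cvgr_lt _ c2)].
Unshelve. all: by end_near. Qed.

Lemma continuous_heat M w x0 t0 : bounded_by M w -> 0 < t0 ->
  {for ((x0, t0) : 'rV[R]_n * R), continuous (fun z : 'rV[R]_n * R => heat w z.1 z.2)}.
Proof.
move=> bw t0p; have [C C0 HC] := heat_kernels_dom n t0p.
have t80 : 0 < 8 * t0 by rewrite mulr_gt0.
apply: (@dominated_continuous _ _ R mu ('rV[R]_n * R)%type
  (fun z y => heat_kernel0 z.1 y z.2 * w y)
  (fun y => M * C * heat_kernel x0 y (8 * t0))).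
- by move=> z; apply: measurable_funM; [exact: measurable_heat_kernel0|exact: bw.1].
- exact: integrable_heat_kernel_scale.
- apply: filterS (near_heat_dom x0 t0p) => z [z1 z2] y.
  have [H _ _] := HC x0 z.1 y z.2 z1 z2.
  rewrite normrM (ger0_norm (heat_kernel0_ge0 _ _ _)) heat_kernel0E; last first.
    by case/andP: z2 => + _; apply: lt_le_trans; rewrite divr_gt0.
  by rewrite mulrC -mulrA; apply: ler_pM => //; [exact: heat_kernel_ge0|exact: bw.2].
- apply: aeW => y.
  apply: continuousM; last exact: cst_continuous.
  apply: (@near_eq_continuous_for _ _ (fun z : 'rV[R]_n * R => heat_kernel z.1 y z.2)).
    apply: filterS (near_heat_dom x0 t0p) => z [_ /andP[z2 _]]; rewrite heat_kernel0E//.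
    by apply: lt_le_trans z2; rewrite divr_gt0.
  exact: continuous_heat_kernel_at.
Qed.

Lemma continuous_dheat i M w x0 t0 : bounded_by M w -> 0 < t0 ->
  {for ((x0, t0) : 'rV[R]_n * R), continuous (fun z : 'rV[R]_n * R => dheat i w z.1 z.2)}.
Proof.
move=> bw t0p; have [C C0 HC] := heat_kernels_dom n t0p.
have t80 : 0 < 8 * t0 by rewrite mulr_gt0.
apply: (@dominated_continuous _ _ R mu ('rV[R]_n * R)%type
  (fun z y => dheat_kernel0 i z.1 y z.2 * w y)
  (fun y => M * C * heat_kernel x0 y (8 * t0))).
- by move=> z; apply: measurable_funM; [exact: measurable_dheat_kernel0|exact: bw.1].
- exact: integrable_heat_kernel_scale.
- apply: filterS (near_heat_dom x0 t0p) => z [z1 z2] y.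
  have [_ /(_ i) H _] := HC x0 z.1 y z.2 z1 z2.
  rewrite normrM dheat_kernel0E; last first.
    by case/andP: z2 => + _; apply: lt_le_trans; rewrite divr_gt0.
  by rewrite mulrC -mulrA; apply: ler_pM => //; exact: bw.2.
- apply: aeW => y.
  apply: continuousM; last exact: cst_continuous.
  apply: (@near_eq_continuous_for _ _ (fun z : 'rV[R]_n * R => dheat_kernel i z.1 y z.2)).
    apply: filterS (near_heat_dom x0 t0p) => z [_ /andP[z2 _]]; rewrite dheat_kernel0E//.
    by apply: lt_le_trans z2; rewrite divr_gt0.
  exact: continuous_dheat_kernel_at.
Qed.

Definition d2heat i w x t : R := \int[mu]_y (d2heat_kernel i x y t * w y).

Lemma is_derive_dheat i M w x t : bounded_by M w -> 0 < t ->
  is_derive x (dir i) (fun x => dheat i w x t) (d2heat i w x t).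
Proof.
move=> bw t0; apply/is_derive_line.
have [C C0 HC] := heat_kernels_dom n t0.
have t80 : 0 < 8 * t by rewrite mulr_gt0.
rewrite (_ : d2heat i w x t = \int[mu]_y (d2heat_kernel i ((0 : R) *: dir i + x) y t * w y)); last first.
  by apply: eq_Rintegral => y _; rewrite scale0r add0r.
have h2 : t / 2 <= t <= 2 * t.
  by rewrite ler_pdivrMr// mulrC ?ler_peMl ?(ltW t0) ?ler1n.
apply: (@is_derive_under_integral _ _ R mu
  (fun h y => dheat_kernel0 i (h *: dir i + x) y t * w y)
  (fun h y => d2heat_kernel i (h *: dir i + x) y t * w y)
  (fun y => M * C * heat_kernel x y (8 * t)) 0 (Num.sqrt t)).
- by rewrite sqrtr_gt0.
- move=> h; apply: (@dominated_integrable _ _ _ _ _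
    (fun y => M * C * heat_kernel (h *: dir i + x) y (8 * t))).
  + by apply: measurable_funM; [exact: measurable_dheat_kernel0|exact: bw.1].
  + exact: integrable_heat_kernel_scale.
  + move=> y; rewrite dheat_kernel0E// normrM mulrC -mulrA; apply: ler_pM => //; first exact: bw.2.
    have [|_ /(_ i)//] := HC (h *: dir i + x) (h *: dir i + x) y t _ h2.
    by rewrite /sqdist big1 ?(ltW t0)// => j _; rewrite subrr expr0n.
- exact: integrable_heat_kernel_scale.
- move=> h y _; rewrite (_ : (fun h : R => _) = (fun h : R => dheat_kernel i (h *: dir i + x) y t) * cst (w y)); last first.
    by apply/funext => k; rewrite dheat_kernel0E.
  have H := is_derive_dheat_kernel i x y h t0.
  by apply: is_derive_eq; rewrite /GRing.scale/= mulr0 add0r mulrC.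
- move=> h y; rewrite subr0 => ht.
  have h1 : sqdist (h *: dir i + x) x <= t.
    rewrite sqdist_line -[h ^+ 2]real_normK ?num_real// -[leRHS]sqr_sqrtr ?(ltW t0)//.
    by rewrite ler_pXn2r ?nnegrE ?sqrtr_ge0// ltW.
  have [_ _ /(_ i) H] := HC x (h *: dir i + x) y t h1 h2.
  by rewrite normrM mulrC -mulrA; apply: ler_pM => //; exact: bw.2.
Qed.

Lemma measurable_d2heat_kernel i x t : measurable_fun [set: 'rV[R]_n] (fun y => d2heat_kernel i x y t).
Proof.
apply: measurable_funM; last exact: measurable_heat_kernel.
apply: measurable_funB => //; apply: measurable_funM => //.
apply: measurable_funX; apply: measurable_funB => //; exact: measurable_coord.
Qed.

Lemma is_derive_time_heat M w x t : bounded_by M w -> 0 < t ->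
  is_derive t 1 (heat w x) (\sum_i d2heat i w x t).
Proof.
move=> bw t0; have [C C0 HC] := heat_kernels_dom n t0.
have t80 : 0 < 8 * t by rewrite mulr_gt0.
have t20 : 0 < t / 2 by rewrite divr_gt0.
have xx : sqdist x x <= t by rewrite /sqdist big1 ?(ltW t0)// => j _; rewrite subrr expr0n.
have tt : t / 2 <= t <= 2 * t.
  by rewrite ler_pdivrMr// mulrC ?ler_peMl ?(ltW t0) ?ler1n.
have dom s y i : t / 2 <= s <= 2 * t ->
    `|d2heat_kernel i x y s * w y| <= M * C * heat_kernel x y (8 * t).
  move=> st; have [_ _ /(_ i) H] := HC x x y s xx st.
  by rewrite normrM mulrC -mulrA; apply: ler_pM => //; exact: bw.2.
have idom i : mu.-integrable setT (EFin \o (fun y => d2heat_kernel i x y t * w y)).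
  apply: dominated_integrable (integrable_heat_kernel_scale (M * C) x t80) _.
    by apply: measurable_funM; [exact: measurable_d2heat_kernel|exact: bw.1].
  by move=> y; exact: dom.
have -> : \sum_i d2heat i w x t = \int[mu]_y (\sum_i d2heat_kernel i x y t * w y).
  by rewrite (Rintegral_sum _ idom).2.
have near_t h : `|h - t| < t / 2 -> t / 2 <= h <= 2 * t.
  by rewrite ltr_distlC => /andP[h1 h2]; apply/andP; split; lra.
apply: (@is_derive_under_integral _ _ R mu
  (fun h y => heat_kernel0 x y h * w y)
  (fun h y => \sum_i d2heat_kernel i x y h * w y)
  (fun y => n%:R * (M * C) * heat_kernel x y (8 * t)) t (t / 2)) => //.
- by move=> h; exact: integrable_heat bw.
- exact: integrable_heat_kernel_scale.
- move=> h y ht; have /andP[h1 _] := near_t h ht.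
  have h0 : 0 < h by apply: lt_le_trans h1.
  have H := is_derive_time_heat_kernel x y h0.
  apply: (@near_eq_is_derive _ _ _ (heat_kernel x y * cst (w y))).
    have : \forall k \near h, 0 < k by exact: lt_nbhsr.
    by apply: filterS => k k0; rewrite heat_kernel0E.
  by apply: is_derive_eq; rewrite /GRing.scale/= mulr0 add0r mulrC mulr_suml.
- move=> h y ht; apply: le_trans (ler_norm_sum _ _ _) _.
  apply: (@le_trans _ _ (\sum_(i < n) M * C * heat_kernel x y (8 * t))).
    by apply: ler_sum => i _; apply: dom; exact: near_t.
  by rewrite sumr_const card_ord -[leLHS]mulr_natl mulrA.
Qed.

End continuity_kernel.

(** * Translations, and the limit of the flow at time 0 *)

Section translation.
Context (R : realType) (n : nat).
Implicit Types (x y v : 'rV[R]_n) (t s : R) (w : 'rV[R]_n -> R) (i : 'I_n).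
Local Notation mu := (lebesgue_rV R n).
Local Notation dir i := (delta_mx ord0 i : 'rV[R]_n).

Lemma Rintegral_shift v (f : 'rV[R]_n -> R) : measurable_fun [set: 'rV[R]_n] f ->
  \int[mu]_y f y = \int[mu]_y f (y + v).
Proof.
move=> mf; rewrite /Rintegral; congr fine; rewrite integralE [RHS]integralE.
have mE : measurable_fun [set: 'rV[R]_n] (EFin \o f) by exact/measurable_EFinP.
have H (g : 'rV[R]_n -> \bar R) : measurable_fun setT g -> (forall y, 0 <= g y)%E ->
    (\int[mu]_y g y = \int[mu]_y g (y + v)%R)%E.
  move=> mg g0; rewrite (ge0_integral_affine v ltr01 mg g0) expr1n mul1e.
  by apply: eq_integral => y _; rewrite scale1r.
congr (_ - _)%E.
- rewrite (H ((EFin \o f)^\+)%E); [|exact: measurable_funepos|exact: funepos_ge0].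
  by apply: eq_integral => y _; rewrite !funeposE.
- rewrite (H ((EFin \o f)^\-)%E); [|exact: measurable_funeneg|exact: funeneg_ge0].
  by apply: eq_integral => y _; rewrite !funenegE.
Qed.

Lemma heat_kernel0_shift x y v t : heat_kernel0 (x + v) (y + v) t = heat_kernel0 x y t.
Proof.
rewrite /heat_kernel0 !heat_kernelE.
suff -> : sqdist (x + v) (y + v) = sqdist x y by [].
by apply: eq_bigr => i _; rewrite !mxE; ring.
Qed.

Lemma heat_shift M w x v t : bounded_by M w ->
  heat w (x + v) t = heat (fun y => w (y + v)) x t.
Proof.
move=> bw; rewrite /heat (Rintegral_shift v).
  by apply: eq_Rintegral => y _; rewrite heat_kernel0_shift.
by apply: measurable_funM; [exact: measurable_heat_kernel0|exact: bw.1].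
Qed.

Lemma measurable_shift w v : measurable_fun [set: 'rV[R]_n] w ->
  measurable_fun [set: 'rV[R]_n] (fun y => w (y + v)).
Proof.
move=> mw; have := measurableT_comp mw (measurable_affine_rV 1 v).
by apply: eq_measurable_fun => y _ /=; rewrite scale1r.
Qed.

(* Differentiating under the integral after moving the translation from the
   kernel to w. *)
Lemma dheat_heat i M M' w w' x t : bounded_by M w -> bounded_by M' w' ->
  (forall y, is_derive y (dir i) w (w' y)) -> 0 < t ->
  dheat i w x t = heat w' x t.
Proof.
move=> bw bw' dw t0.
have d1 := (is_derive_line _ _ _ _).2 (is_derive_heat i x bw t0).
have d2 : is_derive (0 : R) 1 (fun h : R => heat w (h *: dir i + x) t) (heat w' x t).
  rewrite (_ : (fun h : R => _) = (fun h : R => \int[mu]_y (heat_kernel0 x y t * w (h *: dir i + y)))); last first.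
    apply/funext => h; rewrite addrC (heat_shift x _ t bw).
    by apply: eq_Rintegral => y _; rewrite [y + _]addrC.
  rewrite (_ : heat w' x t = \int[mu]_y (heat_kernel0 x y t * w' ((0 : R) *: dir i + y))); last first.
    by apply: eq_Rintegral => y _; rewrite scale0r add0r.
  have bshift h : bounded_by M (fun y => w (h *: dir i + y)).
    split=> [|y]; last exact: bw.2.
    have := measurable_shift (h *: dir i) bw.1.
    by apply: eq_measurable_fun => y _; rewrite addrC.
  apply: (@is_derive_under_integral _ _ R mu
    (fun h y => heat_kernel0 x y t * w (h *: dir i + y))
    (fun h y => heat_kernel0 x y t * w' (h *: dir i + y))
    (fun y => M' * heat_kernel x y t) 0 1) => //.
  - by move=> h; exact: integrable_heat (bshift h).
  - exact: integrable_heat_kernel_scale.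
  - move=> h y _.
    rewrite (_ : (fun h : R => _) = cst (heat_kernel0 x y t) * (fun h : R => w (h *: dir i + y))); last by [].
    have H := is_derive_lineh (dw (h *: dir i + y)).
    by apply: is_derive_eq; rewrite /GRing.scale/= mulr0 addr0.
  - move=> h y _; rewrite normrM heat_kernel0E// ger0_norm ?heat_kernel_ge0// mulrC.
    by rewrite ler_wpM2r ?heat_kernel_ge0// bw'.2.
have [_ <-] := d1; by have [_ <-] := d2.
Qed.

Lemma d2heat_heat i M M' M'' w w' w'' x t : bounded_by M w -> bounded_by M' w' -> bounded_by M'' w'' ->
  (forall y, is_derive y (dir i) w (w' y)) -> (forall y, is_derive y (dir i) w' (w'' y)) -> 0 < t ->
  d2heat i w x t = heat w'' x t.
Proof.
move=> bw bw' bw'' dw dw' t0.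
have [_ <-] := is_derive_dheat i x bw t0.
rewrite (_ : (fun x => dheat i w x t) = (fun x => heat w' x t)); last first.
  by apply/funext => y; exact: dheat_heat bw bw' dw t0.
have [_ ->] := is_derive_heat i x bw' t0.
exact: dheat_heat bw' bw'' dw' t0.
Qed.

(** Near (x, t0), W varies by less than e / 2. At distance d1 or more from x its variation is at
    most 2 M <= 2 M |x - y|^2 / d1^2, and the second moment of the kernel at time s is O(s). Letting
    the data W(t) move with t is what the time derivative will need. *)
Lemma heat_approx (W : 'rV[R]_n -> R -> R) (M : R) x (t0 d0 : R) : 0 < d0 ->
  (forall t, `|t - t0| < d0 -> bounded_by M (W ^~ t)) ->
  {for ((x, t0) : 'rV[R]_n * R), continuous (fun z : 'rV[R]_n * R => W z.1 z.2)} ->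
  forall e : R, 0 < e -> exists2 d : R, 0 < d &
    forall t s, `|t - t0| < d -> 0 < s -> s < d -> `|heat (W ^~ t) x s - W x t0| <= e.
Proof.
move=> d00 bW cW e e0.
have [d1 /= d10 Wd] : nbhs_ball ((x, t0) : 'rV[R]_n * R) (fun z => `|W x t0 - W z.1 z.2| < e / 2).
  apply/nbhs_ballP; move/cvgrPdist_lt : cW; apply; exact: divr_gt0.
have M0 : 0 <= M by apply: bounded_by_ge0 (bW t0 _); rewrite subrr normr0.
pose C := 2 * M * (8 * 2 `^ (n%:R / 2)) / d1 ^+ 2 + 1.
have C0 : 0 < C by rewrite ltr_wpDl// divr_ge0 ?sqr_ge0// !mulr_ge0// powR_ge0.
pose d := Num.min (Num.min d0 d1) (e / 2 / C).
have dp : 0 < d by rewrite !lt_min d00 d10/= !divr_gt0.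
exists d => // t s td s0 sd.
have td0 : `|t - t0| < d0 by apply: lt_le_trans td _; rewrite !ge_min lexx.
have td1 : `|t - t0| < d1 by apply: lt_le_trans td _; rewrite !ge_min lexx orbT.
have b1 := bW t td0.
have b2 := bounded_by_cst n (W x t0).
rewrite -[X in _ - X](heat_cst (W x t0) x s0) -(heatB x s b1 b2).
have s20 : 0 < 2 * s by rewrite mulr_gt0.
pose c2 := 2 * M / d1 ^+ 2 * (8 * s * 2 `^ (n%:R / 2)).
have ik := integrable_heat_kernel x s0.
have ik2 := integrable_heat_kernel x s20.
have b3 : 2 * M / d1 ^+ 2 >= 0 by rewrite divr_ge0 ?sqr_ge0// mulr_ge0.
apply: (@le_trans _ _ (\int[mu]_y (e / 2 * heat_kernel x y s + c2 * heat_kernel x y (2 * s)))).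
  apply: normr_Rintegral_le.
  - apply: measurable_funM; first exact: measurable_heat_kernel0.
    by apply: measurable_funB => //; exact: b1.1.
  - by have := integrableD measurableT (integrable_heat_kernel_scale (e / 2) x s0) (integrable_heat_kernel_scale c2 x s20).
  - move=> y; rewrite normrM heat_kernel0E// ger0_norm ?heat_kernel_ge0// mulrC.
    have k0 := heat_kernel_ge0 x y s; have k20 := heat_kernel_ge0 x y (2 * s).
    have key : 2 * M / d1 ^+ 2 * sqdist x y * heat_kernel x y s <= c2 * heat_kernel x y (2 * s).
      by rewrite /c2 -[leLHS]mulrA -[leRHS]mulrA ler_wpM2l//; exact: sqdist_heat_kernel.
    have [yd|yd] := ltP (sqdist x y) (d1 ^+ 2).
      have : `|W x t0 - W y t| < e / 2.
        apply: (Wd (y, t)); split => /=; last by rewrite /ball/= distrC.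
        split => // a b; rewrite ord1 /ball/=.
        have := le_lt_trans (sqdist_coord x y b) yd.
        rewrite -[X in X < _]real_normK ?num_real// ltr_pXn2r ?nnegrE//; exact: ltW.
      rewrite distrC => /ltW H; apply: le_trans (ler_wpM2r k0 H) _.
      by rewrite lerDl mulr_ge0// mulr_ge0// !mulr_ge0 ?powR_ge0// ltW.
    have H : `|W y t - W x t0| <= 2 * M.
      apply: le_trans (ler_normB _ _) _; rewrite mulr2n mulrDl mul1r; apply: lerD; first exact: b1.2.
      by apply: (bW t0 _).2; rewrite subrr normr0.
    apply: le_trans (ler_wpM2r k0 H) _.
    apply: le_trans (le_trans _ key) _.
      rewrite ler_wpM2r// -mulrA ler_peMr ?mulr_ge0// mulrC ler_pdivlMr ?exprn_gt0// mul1r//.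
    by rewrite lerDr mulr_ge0// divr_ge0// ltW.
rewrite RintegralD//; [|exact: integrable_heat_kernel_scale|exact: integrable_heat_kernel_scale].
rewrite (RintegralZl (e / 2) measurableT ik) (RintegralZl c2 measurableT ik2).
rewrite !Rintegral_heat_kernel// !mulr1.
rewrite [leRHS](splitr e) lerD2l.
have : s * C <= e / 2.
  by rewrite -ler_pdivlMr//; apply: ltW; apply: lt_le_trans sd _; rewrite ge_min lexx orbT.
apply: le_trans; rewrite /C mulrDr mulr1.
rewrite (_ : s * _ = c2); last by rewrite /c2; field; rewrite gt_eqF.
by rewrite lerDl ltW.
Qed.

End translation.

(** * Regularity of the Duhamel term *)

Section singular_kernel.
Context (R : realType).
Implicit Types a t s : R.

(** Up to a constant, the majorant of the gradient of the Duhamel integrand. *)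
Definition inv_sqrt a t s : R := \1_`[a, t[%classic s * (Num.sqrt (t - s))^-1.

Lemma inv_sqrt_ge0 a t s : 0 <= inv_sqrt a t s.
Proof. by rewrite mulr_ge0// invr_ge0 sqrtr_ge0. Qed.

Lemma measurable_inv_sqrt a t : measurable_fun [set: measurableTypeR R] (inv_sqrt a t).
Proof.
apply: measurable_funM; first exact: measurable_indic.
apply: (measurable_funR_comp (h := fun r => r^-1)); first exact: measurable_invr.
apply: (measurable_funR_comp (h := Num.sqrt)).
  by apply: continuous_measurable_fun; exact: sqrt_continuous.
exact: measurable_funB.
Qed.

Lemma integral_inv_sqrt_itv a t b : a < b -> b < t ->
  (\int[lebesgue_measure]_(s in `[a, b]) ((Num.sqrt (t - s))^-1)%:E <= (2 * Num.sqrt (t - a))%:E)%E.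
Proof.
move=> ab bt; pose F s : R := - (2 * Num.sqrt (t - s)).
have dF s : s < t -> is_derive s 1 F ((Num.sqrt (t - s))^-1).
  move=> st; have st0 : 0 < t - s by rewrite subr_gt0.
  have d1 : is_derive s 1 (fun s : R => t - s) (-1).
    by apply: is_derive_eq; rewrite add0r mul1r.
  have d2 := @is_derive1_comp _ Num.sqrt (fun s : R => t - s) s _ _ (is_derive1_sqrt st0) d1.
  have d3 := @is_deriveZ _ _ _ (Num.sqrt \o (fun s : R => t - s)) (-2) s 1 _ d2.
  rewrite (_ : F = (-2) \*: (Num.sqrt \o (fun s : R => t - s))); last first.
    by apply/funext => r; rewrite /F -mulNr.
  apply: is_derive_eq d3 _.
  rewrite /GRing.scale/= mulrN1 mulrNN invfM mulrA mulfV ?mul1r//.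
have c1 (s : R) : s < t -> {for s, continuous (fun s : R => (Num.sqrt (t - s))^-1)}.
  move=> st; have st0 : 0 < t - s by rewrite subr_gt0.
  apply: continuousV; first by rewrite gt_eqF// sqrtr_gt0.
  apply: (continuous_comp (f := fun s : R => t - s) (g := Num.sqrt)); last exact: sqrt_continuous.
  by apply: continuousB; [exact: cvg_cst|exact: cvg_id].
have cs : {within `[a, b], continuous (fun s : R => (Num.sqrt (t - s))^-1)}.
  apply: continuous_in_subspaceT => s; rewrite inE/= in_itv/= => /andP[_ sb].
  exact: c1 (le_lt_trans sb bt).
have cF s : s < t -> {for s, continuous F}.
  by move=> st; apply: differentiable_continuous; apply/derivable1_diffP; have [] := dF s st.
rewrite (@continuous_FTC2 R _ F a b ab cs).
- rewrite -EFinB lee_fin /F opprK addrC gerBl mulr_ge0// sqrtr_ge0.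
- split.
  + move=> s; rewrite in_itv/= => /andP[_ sb]; by have [] := dF s (lt_trans sb bt).
  + by apply: cvg_at_right_filter; apply: cF; exact: lt_trans bt.
  + by apply: cvg_at_left_filter; apply: cF.
- move=> s; rewrite in_itv/= => /andP[_ sb].
  by rewrite derive1E; have [_ ->] := dF s (lt_trans sb bt).
Qed.

(** The primitive is available on [a, b] for b < t only; the intervals [a, c k] exhaust [a, t[ and
    monotone convergence concludes. *)
Lemma integral_inv_sqrt_le a t : a <= t ->
  (\int[lebesgue_measure]_s (inv_sqrt a t s)%:E <= (2 * Num.sqrt (t - a))%:E)%E.
Proof.
rewrite le_eqVlt => /predU1P[<-|at_].
  rewrite (eq_integral (cst 0%E)); first by rewrite integral0 lee_fin mulr_ge0// sqrtr_ge0.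
  move=> s _; rewrite /inv_sqrt indicE memNset ?mul0r//= in_itv/= => /andP[H1 H2].
  by have := le_lt_trans H1 H2; rewrite ltxx.
(* With k + 2 in the denominator, a < c k holds already at k = 0. *)
pose c k := t - (t - a) / k.+2%:R.
have c0 k : 0 < (t - a) / k.+2%:R by rewrite divr_gt0 ?subr_gt0.
have ct k : c k < t by rewrite /c ltrBlDr ltrDl.
have ac k : a < c k.
  by rewrite /c ltrBrDr -ltrBrDl ltr_pdivrMr// ltr_pMr ?subr_gt0// ltr1n.
pose D k : set (measurableTypeR R) := `[a, c k]%classic.
have cvD : (\int[lebesgue_measure]_(s in D k) (inv_sqrt a t s)%:E)%E @[k --> \oo] -->
    (\int[lebesgue_measure]_(s in \bigcup_k D k) (inv_sqrt a t s)%:E)%E.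
  apply: ge0_nondecreasing_set_cvg_integral.
  - move=> k l kl; apply/subsetPset; apply: subset_itvl; rewrite bnd_simp /c lerD2l lerN2.
    by rewrite ler_wpM2l ?subr_ge0 ?(ltW at_)// lef_pV2 ?posrE// ler_nat !ltnS.
  - by move=> k; exact: measurable_itv.
  - move=> k; apply/measurable_EFinP; apply: measurable_funTS; exact: measurable_inv_sqrt.
  - by move=> k s _; rewrite lee_fin inv_sqrt_ge0.
have -> : (\int[lebesgue_measure]_s (inv_sqrt a t s)%:E =
    \int[lebesgue_measure]_(s in \bigcup_k D k) (inv_sqrt a t s)%:E)%E.
  rewrite [RHS]integral_mkcond; apply: eq_integral => s _; rewrite patchE.
  case: ifPn => // sD; rewrite /inv_sqrt indicE memNset ?mul0r//= in_itv/= => /andP[as_ st].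
  move: sD; rewrite notin_setE; apply.
  pose k := Num.truncn ((t - a) / (t - s)).
  exists k => //; rewrite /D/= in_itv/= as_/= /c lerBrDr addrC -lerBrDr.
  rewrite ler_pdivrMr// mulrC -ler_pdivrMr ?subr_gt0//.
  by apply: ltW; apply: lt_trans (truncnS_gt _) _; rewrite ltr_nat.
have <- := cvg_lim (@ereal_hausdorff R) cvD.
apply: lime_le; first by apply/cvg_ex; eexists; exact: cvD.
apply: nearW => k; apply: le_trans (integral_inv_sqrt_itv (ac k) (ct k)).
apply: ge0_le_integral => //.
- exact: measurable_itv.
- by move=> s _; rewrite lee_fin inv_sqrt_ge0.
- apply/measurable_EFinP; apply: measurable_funTS; exact: measurable_inv_sqrt.
- apply/measurable_EFinP; apply: measurable_funTS.
  apply: (measurable_funR_comp (h := fun r => r^-1)); first exact: measurable_invr.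
  apply: (measurable_funR_comp (h := Num.sqrt)).
    by apply: continuous_measurable_fun; exact: sqrt_continuous.
  exact: measurable_funB.
- move=> s _; rewrite lee_fin /inv_sqrt ler_piMl ?invr_ge0 ?sqrtr_ge0//.
Qed.

Lemma integrable_inv_sqrt (c a t : R) :
  lebesgue_measure.-integrable [set: measurableTypeR R] (EFin \o (fun s => c * inv_sqrt a t s)).
Proof.
have : lebesgue_measure.-integrable [set: measurableTypeR R] (EFin \o inv_sqrt a t).
  apply/integrableP; split; first by apply/measurable_EFinP; exact: measurable_inv_sqrt.
  under eq_integral do rewrite /= ger0_norm ?inv_sqrt_ge0//.
  have [at_|ta] := leP a t; first by apply: le_lt_trans (integral_inv_sqrt_le at_) _; exact: ltry.
  rewrite (eq_integral (cst 0%E)) ?integral0 ?ltry//.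
  move=> s _; rewrite /inv_sqrt indicE memNset ?mul0r//= in_itv/= => /andP[H1 H2].
  by have := lt_trans (le_lt_trans H1 H2) ta; rewrite ltxx.
by move=> /(integrableZl measurableT c).
Qed.

Lemma Rintegral_inv_sqrt_le (c a t : R) : 0 <= c -> a <= t ->
  \int[lebesgue_measure]_s (c * inv_sqrt a t s) <= c * (2 * Num.sqrt (t - a)).
Proof.
move=> c0 at_; have i1 := integrable_inv_sqrt 1 a t.
have i2 : lebesgue_measure.-integrable [set: measurableTypeR R] (EFin \o inv_sqrt a t).
  by apply: eq_integrable i1 => // s _ /=; rewrite mul1r.
rewrite RintegralZl// ler_wpM2l// -lee_fin EFin_Rintegral//.
exact: integral_inv_sqrt_le.
Qed.

End singular_kernel.

Lemma close_via_approximations (R : realType) (a b c d e : R) :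
  `|a - c| <= e / 3 -> `|b - d| <= e / 3 -> `|c - d| < e / 3 -> `|a - b| < e.
Proof.
move=> ac bd cd; have -> : a - b = (a - c) + (c - d) - (b - d) by ring.
apply: le_lt_trans (ler_normB _ _) _.
rewrite (_ : e = e / 3 + e / 3 + e / 3); last by field.
apply: ltr_leD => //; apply: le_lt_trans (ler_normD _ _) _.
exact: ler_ltD.
Qed.

Section duhamel_regularity.
Context (R : realType) (n : nat).
Implicit Types (x y : 'rV[R]_n) (b t s M : R) (F : 'rV[R]_n -> R -> R) (i : 'I_n).
Local Notation mu := (lebesgue_rV R n).
Local Notation dir i := (delta_mx ord0 i : 'rV[R]_n).

Definition dduhamel i F x t : R := \int[lebesgue_measure]_s dheat i (F ^~ s) x (t - s).

Lemma dduhamel_integrand_le i b M F x t s : source b M F ->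
  `|dheat i (F ^~ s) x (t - s)| <= M * dheat_const R n * inv_sqrt b t s.
Proof.
move=> sF; have [_ _ F0] := sF.
have c0 := dheat_const_ge0 R n; have M0 := source_ge0 sF.
have [sb|bs] := ltP s b.
  rewrite /dheat; under eq_Rintegral do rewrite F0// mulr0.
  by rewrite Rintegral_cst// mul0r normr0 mulr_ge0 ?inv_sqrt_ge0// mulr_ge0.
have [ts|st] := leP t s.
  by rewrite dheat_le0 ?subr_le0// normr0 mulr_ge0 ?inv_sqrt_ge0// mulr_ge0.
rewrite /inv_sqrt indicE mem_set ?mul1r//=; last by rewrite in_itv/= bs.
by apply: dheat_norm_le (source_section s sF) _; rewrite subr_gt0.
Qed.

Lemma measurable_dduhamel_integrand i b M F x t : source b M F ->
  measurable_fun [set: measurableTypeR R] (fun s => dheat i (F ^~ s) x (t - s)).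
Proof.
move=> sF.
apply: (@measurable_Rintegral _ (measurableTypeR R) _ _ R mu
  (fun z => dheat_kernel0 i x z.2 (t - z.1) * F z.2 z.1)).
apply: measurable_funM.
  apply: measurable_dheat_kernel0; [exact: measurable_cst|exact: measurable_snd|].
  by apply: measurable_funB => //; exact: measurable_fst.
exact: measurable_source sF measurable_snd measurable_fst.
Qed.

Lemma integrable_dduhamel i b M F x t : source b M F ->
  lebesgue_measure.-integrable [set: measurableTypeR R]
    (EFin \o (fun s => dheat i (F ^~ s) x (t - s))).
Proof.
move=> sF; apply: dominated_integrable (integrable_inv_sqrt (M * dheat_const R n) b t) _.
  exact: measurable_dduhamel_integrand sF.
by move=> s; exact: dduhamel_integrand_le sF.
Qed.

Lemma dduhamel_le i b M F x t : source b M F -> b <= t ->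
  `|dduhamel i F x t| <= M * dheat_const R n * (2 * Num.sqrt (t - b)).
Proof.
move=> sF bt.
have Mc : 0 <= M * dheat_const R n.
  by rewrite mulr_ge0 ?(source_ge0 sF) ?dheat_const_ge0.
apply: le_trans (Rintegral_inv_sqrt_le Mc bt).
apply: normr_Rintegral_le (integrable_inv_sqrt _ b t) _.
  exact: measurable_dduhamel_integrand sF.
by move=> s; exact: dduhamel_integrand_le sF.
Qed.

(** The integrable majorant in (t - s)^(-1/2) is uniform in x, so that the radius 1 of
    differentiation is arbitrary. *)
Lemma is_derive_duhamel i b M F x t : source b M F ->
  is_derive x (dir i) (fun x => duhamel F x t) (dduhamel i F x t).
Proof.
move=> sF; apply/is_derive_line.
rewrite (_ : dduhamel i F x t = \int[lebesgue_measure]_s dheat i (F ^~ s) ((0 : R) *: dir i + x) (t - s)); last first.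
  by rewrite scale0r add0r.
apply: (@is_derive_under_integral _ _ R lebesgue_measure
  (fun h s => heat (F ^~ s) (h *: dir i + x) (t - s))
  (fun h s => dheat i (F ^~ s) (h *: dir i + x) (t - s))
  (fun s => M * dheat_const R n * inv_sqrt b t s) 0 1) => //.
- by move=> h; exact: integrable_duhamel sF.
- exact: integrable_inv_sqrt.
- move=> h s _; have [ts|st] := leP t s.
    rewrite dheat_le0 ?subr_le0//.
    rewrite (_ : (fun h : R => _) = cst 0); first exact: is_derive_cst.
    by apply/funext => k; rewrite heat_le0// subr_le0.
  apply: (@is_derive_lineh R _ (fun z => heat (F ^~ s) z (t - s))).
  by apply: is_derive_heat (source_section s sF) _; rewrite subr_gt0.
- by move=> h s _; exact: dduhamel_integrand_le sF.
Qed.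

Lemma ae_neq (t : R) (P : R -> Prop) : (forall s, s != t -> P s) ->
  \forall s \ae (@lebesgue_measure R), P s.
Proof.
move=> HP; exists [set t]; split; first exact: measurable_set1.
  exact: lebesgue_measure_set1.
by move=> s /= H; apply: contrapT => /eqP st; apply: H; exact: HP.
Qed.

Lemma continuous_shift_time (s : R) (z0 : 'rV[R]_n * R) :
  {for z0, continuous (fun z : 'rV[R]_n * R => (z.1, z.2 - s))}.
Proof.
apply: continuous_at_ball => e e0; apply/nbhs_ballP; exists e => //= z [z1 z2].
split => //=; rewrite /ball/= opprB addrA subrK; exact: z2.
Qed.

Lemma near_time_lt (z0 : 'rV[R]_n * R) (c : R) : z0.2 < c ->
  \forall z \near z0, z.2 < c.
Proof. by move=> zc; apply: (cvgr_lt _ (@continuous_snd_at R n z0)). Qed.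

Lemma near_time_gt (z0 : 'rV[R]_n * R) (c : R) : c < z0.2 ->
  \forall z \near z0, c < z.2.
Proof. by move=> zc; apply: (cvgr_gt _ (@continuous_snd_at R n z0)). Qed.

Lemma continuous_duhamel b M F (z0 : 'rV[R]_n * R) : source b M F ->
  {for z0, continuous (fun z : 'rV[R]_n * R => duhamel F z.1 z.2)}.
Proof.
move=> sF; apply: (@dominated_continuous _ _ R lebesgue_measure ('rV[R]_n * R)%type
  (fun z s => heat (F ^~ s) z.1 (z.2 - s))
  (fun s => M * \1_`[b, z0.2 + 1[%classic s)).
- by move=> z; exact: measurable_duhamel_integrand sF.
- exact: integrable_scaled_itv.
- have : \forall z \near z0, z.2 < z0.2 + 1 by apply: near_time_lt; rewrite ltrDl.
  apply: filterS => z zlt s; apply: le_trans (duhamel_integrand_le z.1 z.2 s sF) _.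
  rewrite ler_wpM2l ?(source_ge0 sF)// !indicE ler_nat.
  case: (boolP (s \in `[b, z.2[%classic)) => //; rewrite inE/= in_itv/= => /andP[bs sz].
  by rewrite mem_set//= in_itv/= bs (lt_trans sz).
(* At s equal to the time of z0 the integrand may jump, because of the value 0 at nonpositive times;
   a single time is negligible. *)
- apply: (@ae_neq z0.2) => s sz.
  have [zs|sz'] := ltP z0.2 s.
    apply: (@near_eq_continuous_for _ _ _ (cst 0)).
      apply: filterS (near_time_lt zs) => z zs'.
      by rewrite heat_le0// subr_le0 ltW.
    exact: continuous_cst_at.
  have {sz'}sz : 0 < z0.2 - s by rewrite subr_gt0 lt_neqAle sz.
  have H := @continuous_heat R n M (F ^~ s) z0.1 _ (source_section s sF) sz.
  exact: (continuous_comp (@continuous_shift_time s z0) H).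
Qed.

(* The integrand is singular at s = t; without the times s >= t - e it is
   continuous in (x, t), and the error is O(sqrt e) uniformly in (x, t). *)
Definition dduhamel_cut i e F x t : R :=
  \int[lebesgue_measure]_s (if s < t - e then dheat i (F ^~ s) x (t - s) else 0).

Lemma dduhamel_cut_le i b M F e x t : source b M F -> 0 < e ->
  `|dduhamel i F x t - dduhamel_cut i e F x t| <= M * dheat_const R n * (2 * Num.sqrt e).
Proof.
move=> sF e0.
have Mc : 0 <= M * dheat_const R n.
  by rewrite mulr_ge0 ?(source_ge0 sF) ?dheat_const_ge0.
have mcut : measurable_fun [set: measurableTypeR R]
    (fun s => if s < t - e then dheat i (F ^~ s) x (t - s) else 0).
  apply: measurable_fun_ifT => //; first exact: measurable_fun_ltr.
  exact: measurable_dduhamel_integrand sF.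
have icut : lebesgue_measure.-integrable [set: measurableTypeR R]
    (EFin \o (fun s => if s < t - e then dheat i (F ^~ s) x (t - s) else 0)).
  apply: dominated_integrable (integrable_inv_sqrt (M * dheat_const R n) b t) _ => //.
  move=> s; case: ifP => _; first exact: dduhamel_integrand_le sF.
  by rewrite normr0 mulr_ge0// inv_sqrt_ge0.
rewrite /dduhamel /dduhamel_cut -RintegralB//; last exact: integrable_dduhamel sF.
have te : t - e <= t by rewrite gerBl ltW.
rewrite [X in Num.sqrt X](_ : e = t - (t - e)); last by rewrite opprB addrC subrK.
apply: le_trans (Rintegral_inv_sqrt_le Mc te).
apply: normr_Rintegral_le (integrable_inv_sqrt _ (t - e) t) _.
  by apply: measurable_funB => //; exact: measurable_dduhamel_integrand sF.
move=> s; case: ifPn => [_|]; first by rewrite subrr normr0 mulr_ge0// inv_sqrt_ge0.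
rewrite -leNgt subr0 => es; have [ts|st] := leP t s.
  by rewrite dheat_le0 ?subr_le0// normr0 mulr_ge0// inv_sqrt_ge0.
rewrite /inv_sqrt indicE mem_set ?mul1r//=; last by rewrite in_itv/= es.
by apply: dheat_norm_le (source_section s sF) _; rewrite subr_gt0.
Qed.

Lemma continuous_dduhamel_cut i b M F e (z0 : 'rV[R]_n * R) : source b M F -> 0 < e ->
  {for z0, continuous (fun z : 'rV[R]_n * R => dduhamel_cut i e F z.1 z.2)}.
Proof.
move=> sF e0.
have Mc : 0 <= M * dheat_const R n.
  by rewrite mulr_ge0 ?(source_ge0 sF) ?dheat_const_ge0.
apply: (@dominated_continuous _ _ R lebesgue_measure ('rV[R]_n * R)%type
  (fun z s => if s < z.2 - e then dheat i (F ^~ s) z.1 (z.2 - s) else 0)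
  (fun s => M * dheat_const R n * (Num.sqrt e)^-1 * \1_`[b, z0.2 + 1[%classic s)).
- move=> z; apply: measurable_fun_ifT => //; first exact: measurable_fun_ltr.
  exact: measurable_dduhamel_integrand sF.
- exact: integrable_scaled_itv.
- have : \forall z \near z0, z.2 < z0.2 + 1 by apply: near_time_lt; rewrite ltrDl.
  apply: filterS => z zlt s; case: ifPn => [sze|_]; last first.
    by rewrite normr0 mulr_ge0// mulr_ge0// invr_ge0 sqrtr_ge0.
  apply: le_trans (dduhamel_integrand_le i z.1 z.2 s sF) _.
  rewrite -[leRHS]mulrA ler_wpM2l// /inv_sqrt !indicE.
  case: (boolP (s \in `[b, z.2[%classic)) => [|_]; last by rewrite mul0r mulr_ge0// invr_ge0 sqrtr_ge0.
  rewrite inE/= in_itv/= => /andP[bs sz].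
  rewrite mem_set//= ?in_itv/= ?bs ?(lt_trans sz)// mul1r mulr1.
  have es : e < z.2 - s by rewrite ltrBrDr addrC -ltrBrDr.
  have zs0 : 0 < z.2 - s := lt_trans e0 es.
  by rewrite lef_pV2 ?posrE ?sqrtr_gt0// ler_sqrt// ltW.
- apply: (@ae_neq (z0.2 - e)) => s sz.
  have [zs|sz'] := ltP (z0.2 - e) s.
    apply: (@near_eq_continuous_for _ _ _ (cst 0)).
      have : z0.2 < s + e by rewrite -ltrBlDr.
      move/near_time_lt; apply: filterS => z zs'.
      by rewrite ltrBrDr ltNge (ltW zs').
    exact: continuous_cst_at.
  have {sz'}sz : s < z0.2 - e by rewrite lt_neqAle sz.
  have sz0 : 0 < z0.2 - s by rewrite subr_gt0 (lt_trans sz)// gtrBl.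
  apply: (@near_eq_continuous_for _ _ _ (fun z : 'rV[R]_n * R => dheat i (F ^~ s) z.1 (z.2 - s))).
    have : s + e < z0.2 by rewrite -ltrBrDr.
    by move/near_time_gt; apply: filterS => z zs; rewrite ltrBrDr zs.
  have H := @continuous_dheat R n i M (F ^~ s) z0.1 _ (source_section s sF) sz0.
  exact: (continuous_comp (@continuous_shift_time s z0) H).
Qed.

Lemma continuous_dduhamel i b M F (z0 : 'rV[R]_n * R) : source b M F ->
  {for z0, continuous (fun z : 'rV[R]_n * R => dduhamel i F z.1 z.2)}.
Proof.
move=> sF; apply: continuous_at_ball => e e0.
have Mc : 0 <= M * dheat_const R n.
  by rewrite mulr_ge0 ?(source_ge0 sF) ?dheat_const_ge0.
pose K := M * dheat_const R n * 2 + 1.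
have K0 : 0 < K by rewrite ltr_wpDl// mulr_ge0.
(* The error of the cut is at most K sqrt d = e / 3. *)
pose d := (e / 3 / K) ^+ 2.
have d0 : 0 < d by rewrite exprn_gt0// !divr_gt0.
have cutd x t : `|dduhamel i F x t - dduhamel_cut i d F x t| <= e / 3.
  apply: le_trans (dduhamel_cut_le i x t sF d0) _.
  rewrite /d sqrtr_sqr gtr0_norm ?divr_gt0// mulrA.
  rewrite mulrCA ler_piMr ?divr_ge0 ?(ltW e0)//.
  by rewrite ler_pdivrMr// mul1r /K lerDl.
have e30 : 0 < e / 3 by rewrite divr_gt0.
have := (cvgrPdist_lt _ _).1 (@continuous_dduhamel_cut i b M F d z0 sF d0) _ e30.
by move=> /(_ _); apply: filterS => z; exact: close_via_approximations (cutd _ _) (cutd _ _).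
Qed.

End duhamel_regularity.

(** * Derivative of the reaction term *)

Section reaction_derivative.
Context (R : realType).
Implicit Types (p a l : R).

Lemma is_derive_reaction p a : 1 < p -> 0 <= a ->
  is_derive a 1 (reaction p) (p * a `^ (p - 1)).
Proof.
move=> p1; have q0 : 0 < p - 1 by rewrite subr_gt0.
rewrite le_eqVlt => /predU1P[<-|a0]; last first.
  apply: (@near_eq_is_derive _ _ _ (fun v => v `^ p)); last exact: is_derive1_powR.
  have : \forall k \near a, 0 < k by exact: lt_nbhsr.
  apply: filterS => k k0; rewrite /reaction gtr0_norm// mulrC mulr_powRB1 ?(ltW k0)//.
  exact: lt_trans p1.
(* At 0 the difference quotient is |h|^(p - 1) for h of either sign; it is below e once |h| < e^(1 /
   (p - 1)). *)
rewrite powR0 ?gt_eqF// mulr0; apply: (is_derive_cvgP _ _ _ _).2.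
apply/cvgrPdist_lt => e e0.
have d0 : 0 < e `^ (p - 1)^-1 by exact: powR_gt0.
near=> h.
have h0 : h != 0 by near: h; exact: nbhs_dnbhs_neq.
rewrite sub0r normrN /reaction !normr0 mulr0 subr0 addr0 [h *: 1]mulr1.
rewrite /GRing.scale/= mulrCA mulVf// mulr1 ger0_norm ?powR_ge0//.
have hd : `|h| < e `^ (p - 1)^-1.
  near: h; apply: dnbhs0_lt; exact: d0.
rewrite -[ltRHS](powRr1 (ltW e0)) -[X in e `^ X](mulVf (_ : p - 1 != 0)) ?gt_eqF// powRrM.
by rewrite gt0_ltr_powR// nnegrE ?powR_ge0.
Unshelve. all: by end_near. Qed.

Lemma is_derive_reaction_comp (V : normedModType R) (f : V -> R) (x d : V) p l : 1 < p ->
  0 <= f x -> is_derive x d f l ->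
  is_derive x d (fun y => reaction p (f y)) (p * f x `^ (p - 1) * l).
Proof.
move=> p1 fx /(is_derive_line _ _ _ _).2 df; apply/is_derive_line.
apply: (@is_derive1_comp _ (reaction p) (fun h : R => f (h *: d + x)) (0 : R)) => //.
rewrite scale0r add0r; exact: is_derive_reaction.
Qed.

End reaction_derivative.

(** * Increments in time *)

Section time_derivative.
Context (R : realType) (n : nat).
Implicit Types (x y : 'rV[R]_n) (t s : R) (w : 'rV[R]_n -> R) (i : 'I_n).
Local Notation mu := (lebesgue_rV R n).
Local Notation dir i := (delta_mx ord0 i : 'rV[R]_n).

(** The mean value theorem for s |-> P_s w (x), whose derivative is P_s applied to the Laplacian of
    w once both derivatives have been moved to the data. *)
Lemma heat_increment M M' M'' w (w' w'' : 'I_n -> 'rV[R]_n -> R) x (h : R) :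
  bounded_by M w -> (forall i, bounded_by (M' i) (w' i)) -> (forall i, bounded_by (M'' i) (w'' i)) ->
  (forall i y, is_derive y (dir i) w (w' i y)) ->
  (forall i y, is_derive y (dir i) (w' i) (w'' i y)) ->
  {for x, continuous w} -> 0 < h ->
  exists2 s, 0 < s < h & heat w x h - w x = h * \sum_i heat (w'' i) x s.
Proof.
move=> bw bw' bw'' dw dw' cw h0.
(* [heat] is 0 at time 0, so the limit value is put in by hand. *)
pose g s := if 0 < s then heat w x s else w x.
have dg s : 0 < s -> is_derive s 1 g (\sum_i heat (w'' i) x s).
  move=> s0; apply: (@near_eq_is_derive _ _ _ (heat w x)).
    have : \forall k \near s, 0 < k by exact: lt_nbhsr.
    by apply: filterS => k k0; rewrite /g k0.
  have := is_derive_time_heat x bw s0.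
  by rewrite (eq_bigr (fun i => heat (w'' i) x s))// => i _; exact: (d2heat_heat _ bw (bw' i) (bw'' i) (dw i) (dw' i) s0).
have cg : {within `[0, h], continuous g}.
  apply/(continuous_within_itvP _ h0); split.
  - move=> s; rewrite in_itv/= => /andP[s0 _].
    apply: differentiable_continuous; apply/derivable1_diffP.
    by have [] := dg s s0.
  - rewrite /g ltxx; apply/cvgrPdist_le => e e0.
    have cW : {for ((x, 0) : 'rV[R]_n * R), continuous (fun z : 'rV[R]_n * R => w z.1)}.
      exact: (continuous_comp (@continuous_fst_at R n (x, 0)) cw).
    have [d d0 Hd] := @heat_approx R n (fun y _ => w y) M x 0 1 ltr01 (fun _ _ => bw) cW e e0.
    near=> s; have s0 : 0 < s by near: s; exact: nbhs_right_gt.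
    have sd : s < d by near: s; exact: nbhs_right_lt.
    by rewrite s0 distrC; apply: (Hd 0 s) => //; rewrite subrr normr0.
  - apply: cvg_at_left_filter; apply: differentiable_continuous; apply/derivable1_diffP.
    by have [] := dg h h0.
have [||s] := @MVT R g (fun s => \sum_i heat (w'' i) x s) 0 h h0.
- by move=> s; rewrite in_itv/= => /andP[s0 _]; exact: dg.
- exact: cg.
rewrite in_itv/= => sh; rewrite /g h0 ltxx subr0 => E.
by exists s => //; rewrite E mulrC.
Unshelve. all: by end_near. Qed.

(** Over a short interval the flow hardly changes the source: by [heat_approx], P_(t2 - s) F(s) (x)
    is within e of F(x, t0) for every s in [t1, t2[. *)
Lemma duhamel_increment b M F x t0 (e : R) : source b M F -> 0 < e ->
  {for ((x, t0) : 'rV[R]_n * R), continuous (fun z : 'rV[R]_n * R => F z.1 z.2)} ->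
  exists2 d : R, 0 < d & forall t1 t2, t1 < t2 -> `|t1 - t0| < d -> `|t2 - t0| < d ->
    `|duhamel (after t1 F) x t2 - (t2 - t1) * F x t0| <= e * (t2 - t1).
Proof.
move=> sF e0 cF.
have [d d0 Hd] := @heat_approx R n F M x t0 1 ltr01 (fun t _ => source_section t sF) cF e e0.
exists (d / 2); first by rewrite divr_gt0.
move=> t1 t2 t12 t1d t2d.
have sA := source_after t1 sF.
have i2 := integrable_scaled_itv (F x t0) t1 t2.
rewrite [(t2 - t1) * _]mulrC -(Rintegral_scaled_itv (F x t0) (ltW t12)).
rewrite -(Rintegral_scaled_itv e (ltW t12)) /duhamel -RintegralB//; last exact: integrable_duhamel sA.
apply: normr_Rintegral_le (integrable_scaled_itv e t1 t2) _.
  apply: measurable_funB; first exact: measurable_duhamel_integrand sA.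
  by apply: measurable_funM => //; exact: measurable_indic.
move=> s; rewrite !indicE; case: (boolP (s \in `[t1, t2[%classic)).
  rewrite inE/= in_itv/= => /andP[s1 s2]; rewrite !mulr1.
  rewrite (_ : after t1 F ^~ s = F ^~ s); last first.
    by apply/funext => y; rewrite /after ltNge s1.
  move: t1d t2d; rewrite !ltr_distl => /andP[a1 a2] /andP[b1 b2].
  apply: Hd; rewrite ?subr_gt0//.
    by rewrite ltr_distl; apply/andP; split; lra.
  by lra.
rewrite notin_setE/= in_itv/= => /negP; rewrite negb_and -!leNgt -ltNge !mulr0 subr0 => /orP[s1|s2].
  rewrite /heat; under eq_Rintegral do rewrite /after s1 mulr0.
  by rewrite Rintegral_cst// mul0r normr0.
by rewrite heat_le0 ?normr0// subr_le0.
Qed.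

End time_derivative.

(** * Mild solutions are classical *)

Section time_derivative_mild.
Context (R : realType) (n : nat).
Implicit Types (x y : 'rV[R]_n) (t s : R) (w : 'rV[R]_n -> R) (i : 'I_n).
Local Notation mu := (lebesgue_rV R n).
Local Notation dir i := (delta_mx ord0 i : 'rV[R]_n).

Lemma heat_sum M (f : 'I_n -> 'rV[R]_n -> R) x t : (forall i, bounded_by M (f i)) ->
  heat (fun y => \sum_i f i y) x t = \sum_i heat (f i) x t.
Proof.
move=> bf; rewrite /heat.
rewrite -(Rintegral_sum _ (fun i => integrable_heat x t (bf i))).2.
by apply: eq_Rintegral => y _; rewrite mulr_sumr.
Qed.

(** The mild formula only goes forward in time, so that a left quotient at t0 is estimated from a
    time t1 < t0. Increments over [t1, t2] with either end at t0 cover both sides. *)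
Lemma is_derive_from_increments (g : R -> R) (t0 l : R) :
  (forall e : R, 0 < e -> exists2 d : R, 0 < d & forall t1 t2, t1 < t2 -> `|t1 - t0| < d -> `|t2 - t0| < d ->
    `|g t2 - g t1 - (t2 - t1) * l| <= e * (t2 - t1)) ->
  is_derive t0 1 g l.
Proof.
move=> H; apply: (is_derive_cvgP _ _ _ _).2.
apply/cvgrPdist_lt => e e0.
have e20 : 0 < e / 2 by rewrite divr_gt0.
have [d dp Hd] := H _ e20.
near=> h.
have h0 : h != 0 by near: h; exact: nbhs_dnbhs_neq.
have hd : `|h| < d by near: h; apply: dnbhs0_lt.
have t00 : `|t0 - t0| < d by rewrite subrr normr0.
have thd : `|h + t0 - t0| < d by rewrite addrK.
rewrite [h *: 1]mulr1 /GRing.scale/=.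
have e2 : e / 2 < e by rewrite ltr_pdivrMr// ltr_pMr// ltr1n.
apply: le_lt_trans e2.
have nh : 0 < `|h| by rewrite normr_gt0.
rewrite -(ler_pM2r nh) -normrM.
rewrite (_ : (l - h^-1 * (g (h + t0) - g t0)) * h = - (g (h + t0) - g t0 - h * l)); last by field.
rewrite normrN; have [hp|hn|/eqP] := ltgtP 0 h; last by rewrite eq_sym (negbTE h0).
  have := Hd t0 (h + t0) _ t00 thd; rewrite ltrDr => /(_ hp).
  by rewrite addrK (gtr0_norm hp).
have := Hd (h + t0) t0 _ thd t00; rewrite gtrDr => /(_ hn).
rewrite opprD addrCA subrr addr0 (ltr0_norm hn).
have -> : g (h + t0) - g t0 - h * l = - (g t0 - g (h + t0) - - h * l) by ring.
by rewrite normrN.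
Unshelve. all: by end_near. Qed.

(** With h = t2 - t1, the increment of V is h P_s applied to the Laplacian of V(t1), for some 0 < s
    < h, plus a Duhamel integral over [t1, t2]. Both are close to h times their values at (x, t0).
    [V1] and [V2] stand for the first and the pure second derivatives of V. *)
Lemma is_derive_time_mild b0 b S M M0 M1 M2 (F V : 'rV[R]_n -> R -> R)
    (V1 V2 : 'I_n -> 'rV[R]_n -> R -> R) x t0 :
  b < t0 < S -> source b0 M F ->
  (forall t1 t2 x, b < t1 -> t1 < t2 -> t2 < S ->
    V x t2 = heat (V ^~ t1) x (t2 - t1) + duhamel (after t1 F) x t2) ->
  (forall t, b < t < S -> bounded_by M0 (V ^~ t)) ->
  (forall i t, b < t < S -> bounded_by M1 (V1 i ^~ t)) ->
  (forall i t, b < t < S -> bounded_by M2 (V2 i ^~ t)) ->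
  (forall i y t, b < t < S -> is_derive y (dir i) (V ^~ t) (V1 i y t)) ->
  (forall i y t, b < t < S -> is_derive y (dir i) (V1 i ^~ t) (V2 i y t)) ->
  (forall t, b < t < S -> {for x, continuous (V ^~ t)}) ->
  (forall i, {for ((x, t0) : 'rV[R]_n * R), continuous (fun z : 'rV[R]_n * R => V2 i z.1 z.2)}) ->
  {for ((x, t0) : 'rV[R]_n * R), continuous (fun z : 'rV[R]_n * R => F z.1 z.2)} ->
  is_derive t0 1 (V x) (\sum_i V2 i x t0 + F x t0).
Proof.
move=> bt0S sF HV bV bV1 bV2 dV dV1 cV cV2 cF; have /andP[bt0 t0S] := bt0S.
apply: is_derive_from_increments => e e0.
pose L y t := \sum_i V2 i y t.
pose d0 := Num.min (t0 - b) (S - t0).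
have d00 : 0 < d0 by rewrite lt_min !subr_gt0 bt0.
have inI t : `|t - t0| < d0 -> b < t < S.
  rewrite lt_min => /andP[]; rewrite !ltr_distl => /andP[a1 a2] /andP[a3 a4].
  by apply/andP; split; lra.
clearbody d0.
have cL : {for ((x, t0) : 'rV[R]_n * R), continuous (fun z : 'rV[R]_n * R => L z.1 z.2)}.
  by apply: continuous_for_sum => i; exact: cV2.
have bL t : `|t - t0| < d0 -> bounded_by (n%:R * M2) (L ^~ t).
  move=> /inI tI; split.
    by apply: measurable_sum => i; exact: (bV2 i t tI).1.
  move=> y; apply: le_trans (ler_norm_sum _ _ _) _.
  apply: (@le_trans _ _ (\sum_(i < n) M2)); last by rewrite sumr_const card_ord -[leLHS]mulr_natl.
  by apply: ler_sum => i _; exact: (bV2 i t tI).2.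
have e20 : 0 < e / 2 by rewrite divr_gt0.
have [d1 d10 H1] := heat_approx d00 bL cL e20.
have [d2 d20 H2] := duhamel_increment sF e20 cF.
(* With d1 / 2, the intermediate time s < t2 - t1 is below d1. *)
pose d := Num.min d0 (Num.min (d1 / 2) d2).
have dp : 0 < d by rewrite !lt_min d00 d20 divr_gt0.
exists d => // t1 t2 t12 t1d t2d.
have [t1d0 t1d1 t1d2] : [/\ `|t1 - t0| < d0, `|t1 - t0| < d1 / 2 & `|t1 - t0| < d2].
  by move: t1d; rewrite !lt_min => /and3P[].
have [t2d0 t2d1 t2d2] : [/\ `|t2 - t0| < d0, `|t2 - t0| < d1 / 2 & `|t2 - t0| < d2].
  by move: t2d; rewrite !lt_min => /and3P[].
have t1I := inI t1 t1d0; have t2I := inI t2 t2d0.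
have /andP[bt1 _] := t1I; have /andP[_ t2S] := t2I.
have h0 : 0 < t2 - t1 by rewrite subr_gt0.
have [s /andP[s0 sh] Es] := heat_increment (bV t1 t1I) (fun i => bV1 i t1 t1I) (fun i => bV2 i t1 t1I)
  (fun i y => dV i y t1 t1I) (fun i y => dV1 i y t1 t1I) (cV t1 t1I) h0.
rewrite -(heat_sum x s (fun i => bV2 i t1 t1I)) in Es.
have A1 : `|heat (L ^~ t1) x s - L x t0| <= e / 2.
  move: t1d1 t2d1; rewrite !ltr_distl => /andP[a1 a2] /andP[b1 b2].
  apply: H1 => //; last by lra.
  by rewrite ltr_distl; apply/andP; split; lra.
have A2 := H2 t1 t2 t12 t1d2 t2d2.
rewrite (HV t1 t2 x bt1 t12 t2S).
set X := heat _ x (t2 - t1) in Es *; set Y := duhamel _ x t2 in A2 *.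
have -> : X + Y - V x t1 - (t2 - t1) * (L x t0 + F x t0) =
    (X - V x t1 - (t2 - t1) * L x t0) + (Y - (t2 - t1) * F x t0) by ring.
rewrite Es -mulrBr; apply: le_trans (ler_normD _ _) _.
have -> : e * (t2 - t1) = (t2 - t1) * (e / 2) + e / 2 * (t2 - t1) by field.
by apply: lerD => //; rewrite normrM (gtr0_norm h0); apply: ler_wpM2l => //; exact: ltW.
Qed.

End time_derivative_mild.

(** * The mild formula started at an arbitrary time *)

Section propagation.
Context (R : realType) (n : nat).
Implicit Types (x y : 'rV[R]_n) (t s b : R) (w : 'rV[R]_n -> R) (i : 'I_n) (F : 'rV[R]_n -> R -> R).
Local Notation mu := (lebesgue_rV R n).
Local Notation dir i := (delta_mx ord0 i : 'rV[R]_n).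

Definition propagate b w F x t := heat w x (t - b) + duhamel F x t.
Definition dpropagate b w F i x t := dheat i w x (t - b) + dduhamel i F x t.

Lemma continuous_forD (X : topologicalType) (z0 : X) (f g : X -> R) :
  {for z0, continuous f} -> {for z0, continuous g} -> {for z0, continuous (fun z => f z + g z)}.
Proof. by move=> cf cg; exact: (cvgD cf cg). Qed.

Lemma continuous_section (f : 'rV[R]_n -> R -> R) x t :
  {for ((x, t) : 'rV[R]_n * R), continuous (fun z : 'rV[R]_n * R => f z.1 z.2)} ->
  {for x, continuous (f ^~ t)}.
Proof.
move=> cf; apply: (@cvg_comp _ _ _ (fun y => (y, t)) (fun z => f z.1 z.2) _ _ _ _ cf).
apply: (@continuous_at_ball _ _ _ (fun y => (y, t)) x) => e e0.
by apply/nbhs_ballP; exists e => //= z xz; split => //; exact: ballxx.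
Qed.

Lemma continuous_propagate b M M' w F x t : bounded_by M w -> source b M' F -> b < t ->
  {for ((x, t) : 'rV[R]_n * R), continuous (fun z : 'rV[R]_n * R => propagate b w F z.1 z.2)}.
Proof.
move=> bw sF bt; apply: continuous_forD; last exact: continuous_duhamel sF.
have t0 : 0 < t - b by rewrite subr_gt0.
exact: (cvg_comp _ _ (@continuous_shift_time _ _ b (x, t)) (continuous_heat bw t0)).
Qed.

Lemma continuous_dpropagate i b M M' w F x t : bounded_by M w -> source b M' F -> b < t ->
  {for ((x, t) : 'rV[R]_n * R), continuous (fun z : 'rV[R]_n * R => dpropagate b w F i z.1 z.2)}.
Proof.
move=> bw sF bt; apply: continuous_forD; last exact: continuous_dduhamel sF.
have t0 : 0 < t - b by rewrite subr_gt0.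
exact: (cvg_comp _ _ (@continuous_shift_time _ _ b (x, t)) (@continuous_dheat R n i M w _ _ bw t0)).
Qed.

Lemma is_derive_propagate i b M M' w F x t : bounded_by M w -> source b M' F -> b < t ->
  is_derive x (dir i) (fun x => propagate b w F x t) (dpropagate b w F i x t).
Proof.
move=> bw sF bt; have t0 : 0 < t - b by rewrite subr_gt0.
have := is_derive_heat i x bw t0; have := is_derive_duhamel i x t sF.
move=> d2 d1; exact: (is_deriveD d1 d2).
Qed.

(** The gradient of the flow may be of size (t - b)^(-1/2); a uniform bound requires a distance c -
    b from the starting time. *)
Lemma bounded_dpropagate i b M M' w F t S (c : R) : bounded_by M w -> source b M' F ->
  b < c -> c <= t <= S ->
  bounded_by (M * dheat_const R n * (Num.sqrt (c - b))^-1 +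
    M' * dheat_const R n * (2 * Num.sqrt (S - b))) (fun x => dpropagate b w F i x t).
Proof.
move=> bw sF bc /andP[ct tS]; have bt : b < t by exact: lt_le_trans ct.
have t0 : 0 < t - b by rewrite subr_gt0.
have c0 : 0 < c - b by rewrite subr_gt0.
split => [|x].
  apply: (open_continuous_measurable_rV openT) => x _.
  exact: (continuous_section (f := dpropagate b w F i) (@continuous_dpropagate i _ _ _ _ _ x _ bw sF bt)).
apply: le_trans (ler_normD _ _) _; apply: lerD.
  apply: le_trans (dheat_norm_le i x bw t0) _.
  apply: ler_wpM2l; first by apply: mulr_ge0; [exact: bounded_by_ge0 bw|exact: dheat_const_ge0].
  by rewrite lef_pV2 ?posrE ?sqrtr_gt0// ler_sqrt; lra.
apply: le_trans (dduhamel_le i x sF (ltW bt)) _.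
apply: ler_wpM2l; first by apply: mulr_ge0; [exact: source_ge0 sF|exact: dheat_const_ge0].
by apply: ler_wpM2l => //; rewrite ler_sqrt; lra.
Qed.

End propagation.

(** * The equation for the gradient *)

Section mild_regularity.
Context (R : realType) (n : nat).
Implicit Types (x y : 'rV[R]_n) (t s b : R) (i : 'I_n).
Local Notation mu := (lebesgue_rV R n).
Local Notation dir i := (delta_mx ord0 i : 'rV[R]_n).

Lemma is_derive_unique (V : normedModType R) (f : V -> R) (x d : V) (l l' : R) :
  is_derive x d f l -> is_derive x d f l' -> l = l'.
Proof. by move=> [_ <-] [_ <-]. Qed.

(** [dheat_heat] at each time s in [b, t[; for the other s both integrands vanish. *)
Lemma dheat_duhamel i b M M' F F' x t : 0 < b -> source b M F -> source b M' F' ->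
  (forall y s, b <= s < t -> is_derive y (dir i) (F ^~ s) (F' y s)) ->
  dduhamel i F x t = duhamel F' x t.
Proof.
move=> b0 sF sF' dF; apply: eq_Rintegral => s _.
have [_ _ F0] := sF; have [_ _ F'0] := sF'.
have [ts|st] := leP t s.
  by rewrite dheat_le0 ?heat_le0// subr_le0.
have [sb|bs] := ltP s b.
  transitivity (0 : R).
    by rewrite /dheat; under eq_Rintegral do rewrite F0// mulr0; rewrite Rintegral_cst// mul0r.
  by rewrite /heat; under eq_Rintegral do rewrite F'0// mulr0; rewrite Rintegral_cst// mul0r.
apply: (@dheat_heat _ _ i M M') => //; last by rewrite subr_gt0.
- exact: source_section sF.
- exact: source_section sF'.
- by move=> y; apply: dF; rewrite bs.
Qed.

Variables (p S M MF B : R) (phi : 'rV[R]_n -> R) (v : 'rV[R]_n -> R -> R).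
Hypotheses (p1 : 1 < p) (bphi : bounded_by M phi) (phi0 : forall y, 0 <= phi y).
Hypothesis vB : forall y s, 0 < s < S -> 0 <= v y s <= B.
Local Notation f := (fun y s => reaction p (v y s)).
Local Notation F := (on_time S f).
Hypotheses (sF : source 0 MF F) (mv : mild S phi f v).
Local Notation dv i := (dpropagate 0 phi F i).

Let F0 y s : 0 <= F y s.
Proof. by apply: on_time_ge0 => {}y {}s /(vB y)/andP[v0 _]; exact: reaction_ge0. Qed.

Lemma mild_propagate x t : 0 < t < S -> v x t = propagate 0 phi F x t.
Proof. by move=> tS; apply: etrans (mv x tS) _; rewrite /propagate subr0. Qed.

Lemma continuous_mild x t : 0 < t < S ->
  {for ((x, t) : 'rV[R]_n * R), continuous (fun z : 'rV[R]_n * R => v z.1 z.2)}.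
Proof.
move=> /andP[t0 tS]; have := continuous_propagate (x := x) bphi sF t0.
apply: near_eq_continuous_for; near=> z; apply/esym/mild_propagate; apply/andP; split; near: z.
  exact: near_time_gt.
exact: near_time_lt.
Unshelve. all: by end_near. Qed.

Lemma is_derive_mild i x t : 0 < t < S -> is_derive x (dir i) (v ^~ t) (dv i x t).
Proof.
move=> tS; have /andP[t0 _] := tS.
have -> : v ^~ t = (fun x => propagate 0 phi F x t) by apply/funext => y; exact: mild_propagate.
exact: is_derive_propagate bphi sF t0.
Qed.

Lemma bounded_mild t : 0 < t < S -> bounded_by B (v ^~ t).
Proof.
move=> tS; split => [|x].
  apply: (open_continuous_measurable_rV openT) => x _.
  exact: (continuous_section (f := v) (@continuous_mild x t tS)).
by have /andP[v0 ?] := vB x tS; rewrite ger0_norm.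
Qed.

Lemma mild_from a x t : 0 < a -> a < t -> t < S ->
  v x t = propagate a (v ^~ a) (after a F) x t.
Proof.
move=> a0 at_ tS; have aS : 0 < a < S by rewrite a0 (lt_trans at_).
have tt : 0 < t < S by rewrite tS (lt_trans a0).
apply: etrans (mv x tt) _.
rewrite /propagate (_ : v ^~ a = (fun y => heat phi y a + duhamel F y a)); last first.
  by apply/funext => y; exact: mv.
have ta : 0 < t - a by rewrite subr_gt0.
apply: etrans (congr1 (fun z => z + duhamel (after a F) x t) (esym (mild_restart x bphi sF phi0 F0 ta a0 (ltW a0)))).
by rewrite subrK -addrA -(duhamel_before_after a x t sF).
Qed.

(** The i-th partial derivative of the source, by the chain rule. *)
Definition dreaction i := on_time S (fun y s => p * v y s `^ (p - 1) * dv i y s).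

(** The bound on the gradient of v degenerates at time 0, hence the cut at b > 0. When S <= b the
    cut leaves nothing. *)
Lemma source_dreaction b : 0 < b -> exists M1, forall i, source b M1 (after b (dreaction i)).
Proof.
move=> b0.
have mdv i : measurable_fun [set: 'rV[R]_n * measurableTypeR R] (fun z => on_time S (dv i) z.1 z.2).
  apply: measurable_on_time => -[x t]; rewrite inE/= => /andP[t0 _].
  exact: continuous_dpropagate bphi sF t0.
have mvt : measurable_fun [set: 'rV[R]_n * measurableTypeR R] (fun z => on_time S v z.1 z.2).
  by apply: measurable_on_time => -[x t]; rewrite inE/=; exact: continuous_mild.
have [bS|Sb] := ltP b S; last first.
  exists 0 => i; have -> : after b (dreaction i) = (fun _ _ => 0).
    apply/funext => y; apply/funext => s; rewrite /after; case: ltP => // bs.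
    by rewrite /dreaction /on_time [s < S]ltNge (le_trans Sb)// andbF.
  by split => // *; rewrite normr0.
pose K := M * dheat_const R n * (Num.sqrt (b - 0))^-1 +
    MF * dheat_const R n * (2 * Num.sqrt (S - 0)).
have B0 : 0 <= B.
  have /andP[] : 0 <= v 0 b <= B by apply: vB; rewrite b0.
  exact: le_trans.
exists (p * B `^ (p - 1) * K) => i.
have K0 : 0 <= K.
  have bb : b <= b <= S by rewrite lexx ltW.
  exact: bounded_by_ge0 (bounded_dpropagate i bphi sF b0 bb).
have p0 : 0 <= p by exact: ltW (lt_trans _ p1).
have C0 : 0 <= p * B `^ (p - 1) * K := mulr_ge0 (mulr_ge0 p0 (powR_ge0 _ _)) K0.
split.
- apply: measurable_fun_ifT => //; first exact: measurable_fun_ltr.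
  rewrite [X in measurable_fun _ X](_ : _ = (fun z : 'rV[R]_n * measurableTypeR R =>
    p * on_time S v z.1 z.2 `^ (p - 1) * on_time S (dv i) z.1 z.2)); last first.
    by apply/funext => z; rewrite /dreaction /on_time; case: ifP; rewrite ?mulr0.
  apply: measurable_funM => //; apply: measurable_funM => //.
  by apply: (measurable_funR_comp (h := fun z : R => z `^ (p - 1))) mvt; exact: measurable_powR.
- move=> y s; rewrite /after; case: ltP => [_|bs].
    by rewrite normr0.
  rewrite /dreaction /on_time; case: ifP => [sS|_]; last first.
    by rewrite normr0.
  have /andP[v0 vle] := vB y sS.
  rewrite normrM; apply: ler_pM => //.
    rewrite ger0_norm ?mulr_ge0 ?powR_ge0//.
    apply: ler_wpM2l => //.
    by apply: ge0_ler_powR => //; rewrite subr_ge0 ltW.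
  have bss : b <= s <= S by rewrite bs ltW//; case/andP: sS.
  exact: (bounded_dpropagate i bphi sF b0 bss).2.
- by move=> y s sb; rewrite /after sb.
Qed.

(** The formula for v restarted at b is differentiated, and the derivative is moved from the kernel
    to v(b) and to the source, both of which are differentiable at positive times. The result has
    the form of a mild formula, so that the gradient can in turn be differentiated with the
    integrable singularity only. *)
Lemma dmild_from i b x t : 0 < b -> b < t -> t < S ->
  dv i x t = propagate b (dv i ^~ b) (after b (dreaction i)) x t.
Proof.
move=> b0 bt tS.
have bS : 0 < b < S by rewrite b0 (lt_trans bt).
have tt : 0 < t < S by rewrite tS (lt_trans b0).
have [M1 /(_ i) sF1] := source_dreaction b0.
have sb := source_after b sF.
have bb : b <= b <= S by rewrite lexx ltW//; case/andP: bS.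
have bdv := bounded_dpropagate i bphi sF b0 bb.
have bv := bounded_mild bS.
have tb : 0 < t - b by rewrite subr_gt0.
apply: (is_derive_unique (is_derive_mild i x tt)).
have -> : v ^~ t = (fun y => propagate b (v ^~ b) (after b F) y t).
  by apply/funext => y; exact: mild_from.
have E1 := dheat_heat x bv bdv (fun y => is_derive_mild i y bS) tb.
suff E2 : dduhamel i (after b F) x t = duhamel (after b (dreaction i)) x t.
  by rewrite [propagate _ (dv i ^~ b) _ _ _]/propagate -E1 -E2; exact: is_derive_propagate bv sb bt.
apply: dheat_duhamel b0 sb sF1 _ => y s /andP[bs st].
have ss : 0 < s < S by lra.
have -> : after b (dreaction i) y s = p * v y s `^ (p - 1) * dv i y s.
  by rewrite /after ltNge bs /= /dreaction /on_time ss.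
have -> : (after b F) ^~ s = (fun y => reaction p (v y s)).
  by apply/funext => z; rewrite /after ltNge bs /= /on_time ss.
have /andP[v0 _] := vB y ss.
exact: is_derive_reaction_comp p1 v0 (is_derive_mild i y ss).
Qed.

Theorem mild_classical x t : 0 < t < S ->
  [/\ is_derive t 1 (v x) (laplacian (v ^~ t) x + reaction p (v x t)),
      forall i, derivable (v ^~ t) x (dir i) &
      forall i, derivable ('D_(dir i) (v ^~ t)) x (dir i)].
Proof.
move=> tt; have /andP[t0 tS] := tt.
(* Two successive losses of time: the gradient equation starts at b > 0, and the second derivatives
   it yields are bounded uniformly from c > b on. *)
pose b := t / 4; pose c := t / 2.
have b0 : 0 < b by rewrite /b; lra.
have bc : b < c by rewrite /b /c; lra.
have ct : c < t by rewrite /c; lra.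
clearbody b c.
have bS : 0 < b < S by lra.
have [M1 sF1] := source_dreaction b0.
have bb : b <= b <= S by lra.
have bdv i := bounded_dpropagate i bphi sF b0 bb.
pose d2v i := dpropagate b (dv i ^~ b) (after b (dreaction i)) i.
have d2vP i y s : c < s < S -> is_derive y (dir i) (dv i ^~ s) (d2v i y s).
  move=> /andP[cs sS].
  have -> : (dv i ^~ s) = (fun y => propagate b (dv i ^~ b) (after b (dreaction i)) y s).
    by apply/funext => z; apply: dmild_from => //; lra.
  by apply: is_derive_propagate (bdv i) (sF1 i) _; lra.
have DE i : 'D_(dir i) (v ^~ t) = dv i ^~ t.
  by apply/funext => y; have [_ ->] := is_derive_mild i y tt.
have ctS : c < t < S by lra.
split=> [||i]; last 2 first.
- by move=> i; have [] := is_derive_mild i x tt.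
- by rewrite DE; have [] := d2vP i x t ctS.
have -> : laplacian (v ^~ t) x = \sum_i d2v i x t.
  by apply: eq_bigr => i _; rewrite DE; have [_ ->] := d2vP i x t ctS.
have FE y s : 0 < s < S -> F y s = reaction p (v y s) by rewrite /on_time => ->.
rewrite -(FE x t tt).
have [M2 dM2] : exists M2, forall i s, c < s < S -> bounded_by M2 (d2v i ^~ s).
  exists ((M * dheat_const R n * (Num.sqrt (b - 0))^-1 +
    MF * dheat_const R n * (2 * Num.sqrt (S - 0))) * dheat_const R n * (Num.sqrt (c - b))^-1 +
    M1 * dheat_const R n * (2 * Num.sqrt (S - b))) => i s /andP[cs sS].
  by apply: bounded_dpropagate (bdv i) (sF1 i) bc _; lra.
have [K dK] : exists K, forall i s, c < s < S -> bounded_by K (dv i ^~ s).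
  exists (M * dheat_const R n * (Num.sqrt (c - 0))^-1 +
    MF * dheat_const R n * (2 * Num.sqrt (S - 0))) => i s /andP[cs sS].
  by apply: bounded_dpropagate bphi sF _ _; lra.
apply: (@is_derive_time_mild R n 0 c S MF B K M2 F v (fun i => dv i) d2v x t ctS sF _ _ dK dM2).
- by move=> t1 t2 y ct1 t12 t2S; apply: mild_from => //; lra.
- by move=> s /andP[cs sS]; apply: bounded_mild; lra.
- by move=> i y s /andP[cs sS]; apply: is_derive_mild; lra.
- by move=> s /andP[cs sS]; apply: (continuous_section (f := v)); apply: continuous_mild; lra.
- by move=> i; apply: continuous_dpropagate (bdv i) (sF1 i) _; lra.
- have cr : {for v x t, continuous (reaction p)}.
    have /andP[v0 _] := vB x tt.
    have [dr _] := is_derive_reaction p1 v0.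
    exact/differentiable_continuous/derivable1_diffP.
  have := continuous_for_comp (z0 := (x, t)) (f := fun z : 'rV[R]_n * R => v z.1 z.2) (@continuous_mild x t tt) cr.
  apply: near_eq_continuous_for; near=> z; apply/esym/FE; apply/andP; split; near: z.
    exact: near_time_gt.
  exact: near_time_lt.
Unshelve. all: by end_near. Qed.

End mild_regularity.

(** * Continuation of bounded solutions *)

Section solutions_are_mild.
Context (R : realType) (n : nat).
Implicit Types (x y : 'rV[R]_n) (t s : R) (u : 'rV[R]_n -> R -> R).
Local Notation mu := (lebesgue_rV R n).

Lemma heat_integral M w x t : bounded_by M w -> 0 < t ->
  (\int[mu]_y (heat_kernel x y t * w y)%:E)%E = (heat w x t)%:E.
Proof.
move=> bw t0; rewrite (EFin_heat _ _ bw).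
by apply: eq_integral => y _; rewrite heat_kernel0E.
Qed.

Lemma solution_continuous_slab p phi (T : \bar R) u S : is_solution p phi T u ->
  (S%:E <= T)%E -> {in [set z : 'rV[R]_n * R | 0 < z.2 < S], continuous (fun z => u z.1 z.2)}.
Proof.
move=> su ST; have cu := solution_continuous su.
rewrite -continuous_open_subspace; last exact: open_slab.
apply: continuous_subspaceW cu => -[x t]/= /andP[t0 tS]; split; first exact: ltW.
by apply: lt_le_trans ST; rewrite lte_fin.
Qed.

Lemma solution_mild p M B phi (T : \bar R) u S : 1 < p -> 0 <= B -> bounded_by M phi ->
  is_solution p phi T u -> (S%:E <= T)%E ->
  (forall x t, 0 < t < S -> u x t <= B) ->
  source 0 (B `^ p) (on_time S (fun y s => reaction p (u y s))) /\
  mild S phi (fun y s => reaction p (u y s)) u.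
Proof.
move=> p1 B0 bphi su ST uB.
have tT t : t < S -> (t%:E < T)%E by move=> tS; apply: lt_le_trans ST; rewrite lte_fin.
have u0 x t : 0 < t < S -> 0 <= u x t.
  by move=> /andP[t0 tS]; apply: (solution_ge0 su) (ltW t0) (tT _ tS).
have sF : source 0 (B `^ p) (on_time S (fun y s => reaction p (u y s))).
  apply: source_reaction => //; first exact: solution_continuous_slab su ST.
  by move=> x t tS; rewrite u0// uB.
split => // x t tS; have /andP[t0 tS'] := tS.
apply: EFin_inj; rewrite (solution_integral su x t0 (tT _ tS')) (heat_integral _ bphi t0).
rewrite (integral_duhamel x sF) ?EFinD// => [|]; last by rewrite t0 ltW.
by move=> y s; apply: on_time_ge0 => {}y {}s sS; exact/reaction_ge0/u0.
Qed.

Lemma heat_ae_le M w (a : R) x t : bounded_by M w -> (forall y, 0 <= w y) -> 0 < t ->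
  (\forall y \ae mu, (w y)%:E <= a%:E)%E -> 0 <= a -> heat w x t <= a.
Proof.
move=> bw w0 t0 wa a0; rewrite -[leRHS](heat_cst (n := n) a x t0) -lee_fin.
rewrite (EFin_heat _ _ bw) (EFin_heat _ _ (bounded_by_cst _ a)).
apply: ae_ge0_le_integral => //.
- by move=> y _; rewrite lee_fin mulr_ge0// heat_kernel0_ge0.
- by apply/measurable_EFinP; apply: measurable_funM bw.1; exact: measurable_heat_kernel0.
- by move=> y _; rewrite lee_fin mulr_ge0// heat_kernel0_ge0.
- by apply/measurable_EFinP; apply: measurable_funM => //; exact: measurable_heat_kernel0.
- by apply: filterS wa => y + _; rewrite !lee_fin => wa; apply: ler_wpM2l; rewrite ?heat_kernel0_ge0.
Qed.

(** An almost everywhere bound passes to P_s w (x) for s > 0, and P_s w (x) tends to w(x) at a point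
    of continuity. This makes the essential supremum a pointwise bound. *)
Lemma continuous_ae_le M w (a : R) x : bounded_by M w -> (forall y, 0 <= w y) ->
  {for x, continuous w} -> (\forall y \ae mu, (w y)%:E <= a%:E)%E -> 0 <= a -> w x <= a.
Proof.
move=> bw w0 cw wa a0; suff H (e : R) : 0 < e -> w x <= a + e by apply/ler_addgt0Pr => e; exact: H.
move=> e0; have cW : {for ((x, 0) : 'rV[R]_n * R), continuous (fun z : 'rV[R]_n * R => w z.1)}.
  exact: (cvg_comp _ _ (@continuous_fst_at R n (x, 0)) cw).
have [d d0 H] := @heat_approx R n (fun y _ => w y) M x 0 1 ltr01 (fun _ _ => bw) cW e e0.
have := H 0 (d / 2); rewrite subrr normr0 => /(_ d0).
have d2 : 0 < d / 2 by rewrite divr_gt0.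
have d3 : d / 2 < d by rewrite ltr_pdivrMr// ltr_pMr// ltr1n.
move=> /(_ d2 d3); rewrite ler_distl => /andP[+ _].
by have := heat_ae_le x bw w0 d2 wa a0; lra.
Qed.

End solutions_are_mild.

(** * A bound from one time onwards *)

Section bootstrap.
Context (R : realType) (n : nat).
Implicit Types (x y : 'rV[R]_n) (t s : R).
Local Notation mu := (lebesgue_rV R n).
Variables (p S M B : R) (phi : 'rV[R]_n -> R) (v : 'rV[R]_n -> R -> R).
Hypotheses (p1 : 1 < p) (bphi : bounded_by M phi) (phi0 : forall y, 0 <= phi y).
Hypothesis vB : forall y s, 0 < s < S -> 0 <= v y s <= B.
Local Notation f := (fun y s => reaction p (v y s)).
Local Notation F := (on_time S f).
Hypotheses (sF : source 0 (B `^ p) F) (mv : mild S phi f v).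

(** Three contributions: the flow of u(t1) gives at most A, the source on [t1, a], where the
    solution is below 2 A, at most A / 2, and the source on [a, t], estimated by the crude bound B,
    at most A / 2. *)
Lemma mild_step_le (t1 a t A h : R) x : 0 < t1 -> t1 <= a -> a < t -> t < S -> t <= a + h -> 0 < A ->
  (S - t1) * (2 * A) `^ p <= A / 2 -> h * B `^ p <= A / 2 ->
  (forall y, v y t1 <= A) -> (forall y s, t1 <= s <= a -> v y s <= 2 * A) -> v x t <= 2 * A.
Proof.
move=> t10 t1a at_ tS th A0 SA hB vA vA2.
have t1t : t1 < t := le_lt_trans t1a at_.
have t1S : 0 < t1 < S by rewrite t10 (lt_trans t1t).
have bA : bounded_by A (v ^~ t1).
  split=> [|y]; first exact: (bounded_mild bphi vB sF mv t1S).1.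
  by have /andP[v0 _] := vB y t1S; rewrite ger0_norm.
have sG := source_after t1 sF.
have [mb _ b0] := source_before a sG.
have sb : source t1 ((2 * A) `^ p) (before a (after t1 F)).
  split => // y s; rewrite /before /after /on_time.
  case: ltP => [sa|]; last by rewrite normr0 powR_ge0.
  case: ltP => [|t1s]; first by rewrite normr0 powR_ge0.
  case: ifP => [sS|_]; last by rewrite normr0 powR_ge0.
  have /andP[v0 _] := vB y sS.
  rewrite ger0_norm ?reaction_ge0// reactionE//.
  have vA' : v y s <= 2 * A by apply: vA2; rewrite t1s ltW.
  have p0 : 0 <= p by exact: ltW (lt_trans ltr01 p1).
  have A20 : 0 <= 2 * A := le_trans v0 vA'.
  by apply: (ge0_ler_powR p0 v0 A20).
have sa := source_after a sG.
rewrite (mild_from bphi phi0 vB sF mv x t10 t1t tS) /propagate.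
have := heat_norm_le x (t - t1) bA.
have := duhamel_before_after a x t sG.
have := duhamel_le x sb (ltW t1t).
have := duhamel_le x sa (ltW at_).
set D1 := duhamel (after a _) _ _; set D2 := duhamel (before a _) _ _.
set D3 := duhamel _ _ _; set D4 := heat _ _ _.
rewrite !ler_norml => /andP[_ H1] /andP[_ H2] -> /andP[_ H3].
have H4 : (2 * A) `^ p * (t - t1) <= (S - t1) * (2 * A) `^ p.
  by rewrite mulrC; apply: ler_wpM2r; [exact: powR_ge0|lra].
have H5 : B `^ p * (t - a) <= h * B `^ p.
  by rewrite mulrC; apply: ler_wpM2r; [exact: powR_ge0|lra].
lra.
Qed.

(* The a priori bound B only serves on time steps so short that it contributes
   at most A / 2: the resulting bound 2 A depends neither on B nor on S. *)
Lemma mild_bootstrap (t1 A : R) x t : 0 < t1 -> t1 <= t -> t < S -> 0 < A ->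
  (S - t1) * (2 * A) `^ p <= A / 2 -> (forall y, v y t1 <= A) -> v x t <= 2 * A.
Proof.
move=> t10 t1t tS A0 SA vA.
(* The added 1 keeps the denominator positive; h B^p <= A / 2 follows. *)
pose h := (A / 2) / (B `^ p + 1).
have Bp : 0 <= B `^ p := powR_ge0 _ _.
have h0 : 0 < h by rewrite divr_gt0//; lra.
have hB : h * B `^ p <= A / 2.
  rewrite /h mulrAC ler_pdivrMr; last by lra.
  by apply: ler_wpM2l; lra.
clearbody h.
have main k : forall y s, t1 <= s < S -> s <= t1 + k%:R * h -> v y s <= 2 * A.
  elim: k => [|k IH] y s /andP[t1s sS].
    rewrite mul0r addr0 => st1; have -> : s = t1 by lra.
    by have := vA y; lra.
  rewrite -natr1 mulrDl mul1r addrA => sh.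
  have kh : 0 <= k%:R * h by rewrite mulr_ge0// ltW.
  have [sk|ks] := leP s (t1 + k%:R * h); first by apply: IH => //; rewrite t1s.
  apply: (@mild_step_le t1 (t1 + k%:R * h) s A h) => //; first by rewrite lerDl.
  by move=> z r /andP[r1 r2]; apply: IH => //; lra.
pose k := Num.truncn ((t - t1) / h).
apply: (main k.+1); first by rewrite t1t.
have : (t - t1) / h <= k.+1%:R by exact/ltW/truncnS_gt.
by rewrite ler_pdivrMr//; lra.
Qed.

End bootstrap.

(** * Monotone iteration beyond T *)

Section picard_extension.
Context (R : realType) (n : nat).
Implicit Types (x y : 'rV[R]_n) (t s : R) (w : 'rV[R]_n -> R -> R).
Local Notation mu := (lebesgue_rV R n).

Lemma eq_duhamel (F F' : 'rV[R]_n -> R -> R) x t :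
  (forall y s, s < t -> F y s = F' y s) -> duhamel F x t = duhamel F' x t.
Proof.
move=> FF'; apply: eq_Rintegral => s _.
have [st|ts] := ltP s t; last by rewrite !heat_le0// subr_le0.
by apply: eq_Rintegral => y _; rewrite FF'.
Qed.

Lemma cvg_heat M (w_ : nat -> 'rV[R]_n -> R) (w : 'rV[R]_n -> R) x t :
  (forall k, bounded_by M (w_ k)) -> (forall y, w_ k y @[k --> \oo] --> w y) ->
  heat (w_ k) x t @[k --> \oo] --> heat w x t.
Proof.
move=> bw cw; apply: (dominated_cvg_Rintegral (g := fun y => M * heat_kernel0 x y t)).
- by move=> k; apply: measurable_funM (bw k).1; exact: measurable_heat_kernel0.
- apply: measurable_funM; first exact: measurable_heat_kernel0.
  by apply: (measurable_fun_cvg (fun k => (bw k).1)) => y _; exact: cw.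
- by have := integrableZl measurableT M (integrable_heat_kernel0 x t).
- move=> k y; rewrite normrM ger0_norm ?heat_kernel0_ge0// mulrC.
  by apply: ler_wpM2r; [exact: heat_kernel0_ge0|exact: (bw k).2].
- by apply: aeW => y; apply: cvgMl_tmp; exact: cw.
Qed.

Lemma cvg_duhamel b M (F_ : nat -> 'rV[R]_n -> R -> R) F x t :
  (forall k, source b M (F_ k)) -> (forall y s, F_ k y s @[k --> \oo] --> F y s) ->
  duhamel (F_ k) x t @[k --> \oo] --> duhamel F x t.
Proof.
move=> sF cF.
have ch s : heat (F_ k ^~ s) x (t - s) @[k --> \oo] --> heat (F ^~ s) x (t - s).
  by apply: (@cvg_heat M) => [k|y]; [exact: source_section (sF k)|exact: cF].
have mh k : measurable_fun [set: measurableTypeR R] (fun s => heat (F_ k ^~ s) x (t - s)).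
  exact: measurable_duhamel_integrand (sF k).
apply: (dominated_cvg_Rintegral (T := measurableTypeR R)
  (g := fun s => M * \1_`[b, t[%classic s)).
- exact: mh.
- by apply: (measurable_fun_cvg mh) => s _; exact: ch.
- exact: integrable_scaled_itv.
- by move=> k s; exact: duhamel_integrand_le (sF k).
- exact/aeW.
Qed.

Variables (p T T' M B C : R) (phi : 'rV[R]_n -> R) (u : 'rV[R]_n -> R -> R).
Hypotheses (p1 : 1 < p) (bphi : bounded_by M phi) (phi0 : forall y, 0 <= phi y).
Hypothesis uB : forall y s, 0 < s < T -> 0 <= u y s <= B.
Hypotheses (sF : source 0 (B `^ p) (on_time T (fun y s => reaction p (u y s))))
  (mv : mild T phi (fun y s => reaction p (u y s)) u).
Hypotheses (TT' : T <= T') (B0 : 0 <= B) (BC : B <= C)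
  (C0 : M + B `^ p * T' + C `^ p * (T' - T) <= C).

Local Notation react w := (fun y s => reaction p (w y s)).

Definition picard_step w := on_time T' (fun x t => heat phi x t + duhamel (react w) x t).
Definition picard k := iter k picard_step (on_time T u).

(** The invariant of the iteration. The bound C survives a step because the source is at most B^p
    before T, where w is u, and at most C^p during the remaining time T' - T; this is the sum
    estimated in [C0]. *)
Let admissible w := [/\ measurable_fun [set: 'rV[R]_n * measurableTypeR R] (fun z => w z.1 z.2),
  forall y s, 0 <= w y s <= C, forall y s, s < T -> w y s = on_time T u y s &
  forall y s, s <= 0 -> w y s = 0].

Let p0 : 0 <= p. Proof. exact: ltW (lt_trans ltr01 p1). Qed.

Let powp a b : 0 <= a -> a <= b -> a `^ p <= b `^ p.
Proof. by move=> a0 ab; apply: (ge0_ler_powR p0) => //; exact: le_trans ab. Qed.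

Let source_admissible w : admissible w -> source 0 (C `^ p) (react w).
Proof.
move=> [mw wC _ w0]; split.
- exact: (measurable_funR_comp (h := reaction p) (measurable_reaction p) mw).
- move=> y s; have /andP[w0' wC'] := wC y s.
  by rewrite ger0_norm ?reaction_ge0// reactionE// powp.
- by move=> y s s0; rewrite w0 ?ltW// /reaction mulr0.
Qed.

Let react_ge0 w : admissible w -> forall y s, 0 <= reaction p (w y s).
Proof. by move=> [_ wC _ _] y s; apply: reaction_ge0; have /andP[] := wC y s. Qed.

Let on_time_reaction y s : on_time T (react u) y s = reaction p (on_time T u y s).
Proof. by rewrite /on_time; case: ifP => // _; rewrite /reaction mulr0. Qed.

(** Causality: the Duhamel term at time t only sees w at times s < t, where it is u, and u solves
    the mild equation. *)
Let picard_step_before w x t : admissible w -> 0 < t < T ->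
  heat phi x t + duhamel (react w) x t = u x t.
Proof.
move=> [_ _ wu _] tT; have /andP[_ tT'] := tT.
apply: etrans (esym (mv x tT)); congr (_ + _).
by apply: eq_duhamel => y s st; rewrite wu ?(lt_trans st)// on_time_reaction.
Qed.

Let picard_step_le w x t : admissible w -> 0 < t -> t < T' ->
  0 <= heat phi x t + duhamel (react w) x t <= C.
Proof.
move=> aw t0 tT'; apply/andP; split.
  by apply: addr_ge0; [exact: heat_ge0|apply: duhamel_ge0; exact: react_ge0].
have [tT|Tt] := ltP t T.
  have tt : 0 < t < T by rewrite t0.
  rewrite (picard_step_before x aw tt); apply: le_trans BC.
  by have /andP[] := uB x tt.
have sw := source_admissible aw; have [_ _ wu _] := aw.
have sb : source 0 (B `^ p) (before T (react w)).
  have [mb _ b0] := source_before T sw; split => // y s.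
  rewrite /before; case: ltP => [sT|_]; last by rewrite normr0 powR_ge0.
  rewrite wu// /on_time; case: ifP => [ss|_]; last by rewrite /reaction mulr0 normr0 powR_ge0.
  have /andP[u0 uB'] := uB y ss.
  by rewrite ger0_norm ?reaction_ge0// reactionE// powp.
have sa := source_after T sw.
have := duhamel_before_after T x t sw.
have := duhamel_le x sb (ltW t0).
have := duhamel_le x sa Tt.
have := heat_norm_le x t bphi.
set D1 := duhamel (after T _) _ _; set D2 := duhamel (before T _) _ _.
set D3 := duhamel _ _ _; set D4 := heat _ _ _.
rewrite !ler_norml => /andP[_ H1] /andP[_ H2] /andP[_ H3] ->.
have H4 : C `^ p * (t - T) <= C `^ p * (T' - T).
  by apply: ler_wpM2l; [exact: powR_ge0|lra].
have H5 : B `^ p * (t - 0) <= B `^ p * T'.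
  by apply: ler_wpM2l; [exact: powR_ge0|lra].
apply: le_trans C0; rewrite -addrA.
exact: lerD H1 (lerD (le_trans H3 H5) (le_trans H2 H4)).
Qed.

Let admissible_step w : admissible w -> admissible (picard_step w).
Proof.
move=> aw; have sw := source_admissible aw; split.
- apply: measurable_fun_ifT => //.
    by apply: measurable_and; apply: measurable_fun_ltr.
  apply: measurable_funD.
    by apply: (@measurable_heat R n _ _ (fun z => phi z.2)) => //; exact: (measurableT_comp bphi.1 measurable_snd).
  exact: measurable_duhamel sw _ _.
- move=> y s; rewrite /picard_step /on_time; case: ifP => [/andP[s0 sT]|_].
    exact: picard_step_le.
  by rewrite lexx (le_trans B0 BC).
- move=> y s sT; rewrite /picard_step /on_time sT (lt_le_trans sT TT') !andbT.
  case: ifP => // s0; have sT0 : 0 < s < T by rewrite s0.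
  exact: picard_step_before.
- by move=> y s s0; rewrite /picard_step /on_time ltNge s0.
Qed.

Let admissible_picard k : admissible (picard k).
Proof.
elim: k => [|k]; last exact: admissible_step.
split=> //.
- by apply: (@measurable_on_time R n T u) => -[x t]; rewrite inE/= => tT; exact: (continuous_mild bphi sF mv tT).
- move=> y s; rewrite /= /on_time; case: ifP => [sT|_]; last by rewrite lexx (le_trans B0).
  by have /andP[-> /=] := uB y sT; move/le_trans; apply.
- by move=> y s s0; rewrite /= /on_time ltNge s0.
Qed.

(** The first two iterates agree before T, and the initial one is 0 afterwards; the order then
    propagates since v^p and the Duhamel operator are monotone. *)
Let picard_nondecreasing k y s : picard k y s <= picard k.+1 y s.
Proof.
elim: k y s => [|k IH] y s.
  have [_ wC wu _] := admissible_picard 1.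
  have [sT|Ts] := ltP s T; first by rewrite wu.
  rewrite {1}/picard /= /on_time [s < T]ltNge Ts/= andbF.
  by have /andP[] := wC y s.
rewrite -[leLHS]/(picard_step (picard k) y s) -[leRHS]/(picard_step (picard k.+1) y s).
rewrite /picard_step /on_time; case: ifP => // _.
rewrite lerD2l; have ak := admissible_picard k; have ak1 := admissible_picard k.+1.
apply: duhamel_mono (source_admissible ak) (source_admissible ak1) _ => z r.
have [_ wC _ _] := ak; have [_ wC1 _ _] := ak1.
have /andP[w0 _] := wC z r; have /andP[w1 _] := wC1 z r.
by rewrite !reactionE// powp.
Qed.

Definition picard_limit y s := limn (fun k => picard k y s).

Let picard_cvg y s : picard k y s @[k --> \oo] --> picard_limit y s.
Proof.
apply: nondecreasing_is_cvgn.
  by apply/nondecreasing_seqP => k; exact: picard_nondecreasing.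
exists C => _ [k _ <-]; have [_ wC _ _] := admissible_picard k.
by have /andP[] := wC y s.
Qed.

Let admissible_limit : admissible picard_limit.
Proof.
split.
- have mP k : measurable_fun [set: 'rV[R]_n * measurableTypeR R] (fun z => picard k z.1 z.2).
    by have [] := admissible_picard k.
  by apply: (measurable_fun_cvg mP) => z _; exact: picard_cvg.
- move=> y s; apply/andP; split.
    apply: limr_ge; first exact: picard_cvg.
    by apply: nearW => k; have [_ /(_ y s)/andP[]] := admissible_picard k.
  apply: limr_le; first exact: picard_cvg.
  by apply: nearW => k; have [_ /(_ y s)/andP[]] := admissible_picard k.
- move=> y s sT; rewrite /picard_limit.
  under eq_fun => k do (have [_ _ -> //] := admissible_picard k).
  exact: lim_cst.
- move=> y s s0; rewrite /picard_limit.
  under eq_fun => k do (have [_ _ _ -> //] := admissible_picard k).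
  exact: lim_cst.
Qed.

Lemma picard_limit_bounds y s : 0 <= picard_limit y s <= C.
Proof. by have [] := admissible_limit. Qed.

Lemma picard_limit_before y s : 0 < s < T -> picard_limit y s = u y s.
Proof.
move=> sT; have [_ _ E _] := admissible_limit; have /andP[_ sT'] := sT.
by rewrite E// /on_time sT.
Qed.

Let on_time_limit : on_time T' (react picard_limit) = react picard_limit.
Proof.
apply/funext => y; apply/funext => s; rewrite /on_time; case: ifP => // /negbT.
rewrite negb_and -!leNgt => sT; suff -> : picard_limit y s = 0 by rewrite /reaction mulr0.
have [s0|s0] := leP s 0; first by have [_ _ _ ->] := admissible_limit.
rewrite leNgt s0 /= in sT.
rewrite /picard_limit (_ : (fun k => picard k y s) = (fun=> 0)) ?lim_cst//.
apply/funext => -[|k] /=; rewrite /picard_step /on_time ltNge.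
  by rewrite -ltNge s0 /= ltNge (le_trans TT' sT).
by rewrite -ltNge s0/= ltNge sT.
Qed.

Lemma source_picard_limit : source 0 (C `^ p) (on_time T' (react picard_limit)).
Proof. by rewrite on_time_limit; exact: source_admissible admissible_limit. Qed.

(** The convergence is only pointwise, but the uniform bound C lets dominated convergence pass to
    the limit in the Duhamel term. *)
Lemma mild_picard_limit : mild T' phi (react picard_limit) picard_limit.
Proof.
move=> x t tT'; rewrite on_time_limit.
have c1 : picard k.+1 x t @[k --> \oo] --> picard_limit x t.
  by rewrite (cvg_shiftS (fun k => picard k x t)); exact: picard_cvg.
have c2 : picard k.+1 x t @[k --> \oo] --> heat phi x t + duhamel (react picard_limit) x t.
  have -> : (fun k => picard k.+1 x t) = (fun k => heat phi x t + duhamel (react (picard k)) x t).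
    by apply/funext => k; rewrite /picard iterS -/(picard k) /picard_step /on_time tT'.
  apply: cvgD; first exact: cvg_cst.
  apply: (@cvg_duhamel 0 (C `^ p)) => [k|y s]; first exact: source_admissible (admissible_picard k).
  have [v0 _] := andP (picard_limit_bounds y s).
  have [dr _] := is_derive_reaction p1 v0.
  have cr : {for picard_limit y s, continuous (reaction p)}.
    exact/differentiable_continuous/derivable1_diffP.
  have cv : picard k y s @[k --> \oo] --> picard_limit y s by exact: picard_cvg.
  exact: (cvg_comp _ _ cv cr).
exact: (cvg_unique _ c1 c2).
Qed.

End picard_extension.

Section extension.
Context (R : realType) (n : nat).
Implicit Types (x y : 'rV[R]_n) (t s : R) (u w : 'rV[R]_n -> R -> R).
Local Notation mu := (lebesgue_rV R n).

Lemma bounded_solution_extends p M B phi (T : R) u : 1 < p -> 0 < T -> 0 <= B ->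
  bounded_by M phi -> (forall y, 0 <= phi y) -> is_solution p phi T%:E u ->
  (forall x t, 0 < t < T -> u x t <= B) ->
  exists T' w, [/\ T < T', is_solution p phi T'%:E w &
    forall x t, t < T -> w x t = u x t].
Proof.
move=> p1 T0 B0 bphi phi0 su uB.
have [sF mu_] := solution_mild p1 B0 bphi su (lexx _) uB.
have u0B y s : 0 < s < T -> 0 <= u y s <= B.
  move=> sT; rewrite uB// andbT; have /andP[s0 sT'] := sT.
  by apply: (solution_ge0 su) (ltW s0) _; rewrite lte_fin.
have M0 := bounded_by_ge0 bphi.
have Bp : 0 <= B `^ p := powR_ge0 _ _.
have BT : 0 <= B `^ p * (T + 1) by apply: mulr_ge0; lra.
(* The 1 pays for C^p (T' - T), which is 1 by the choice of T' = T + C^(-p). It also gives C >= 1,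
   so that T' <= T + 1. *)
pose C := M + B `^ p * (T + 1) + 1 + B.
have C1 : 1 <= C by rewrite /C; lra.
have Cp1 : 1 <= C `^ p.
  have := @ge0_ler_powR R p (ltW (lt_trans ltr01 p1)) 1 C.
  by rewrite powR1; apply; rewrite ?nnegrE//; lra.
pose T' := T + (C `^ p)^-1.
have Cp0 : 0 < C `^ p by lra.
have d0 : 0 < (C `^ p)^-1 by rewrite invr_gt0.
have d1 : (C `^ p)^-1 <= 1 by rewrite invf_le1.
have TT' : T < T' by rewrite /T' ltrDl.
have MC : M <= C by rewrite /C; lra.
have BC : B <= C by rewrite /C; lra.
have C0 : M + B `^ p * T' + C `^ p * (T' - T) <= C.
  have -> : C `^ p * (T' - T) = 1 by rewrite /T' addrAC subrr add0r divff// gt_eqF.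
  have : B `^ p * T' <= B `^ p * (T + 1) by apply: ler_wpM2l => //; rewrite /T'; lra.
  by rewrite /C; lra.
clearbody C T'.
pose v := picard_limit p T T' phi u.
have vB y s : 0 <= v y s <= C.
  exact: (picard_limit_bounds p1 bphi phi0 u0B sF mu_ (ltW TT') B0 BC C0 y s).
have vu y s : 0 < s < T -> v y s = u y s.
  exact: (picard_limit_before p1 bphi phi0 u0B sF mu_ (ltW TT') B0 BC C0).
have sv := source_picard_limit p1 bphi phi0 u0B sF mu_ (ltW TT') B0 BC C0.
have mv := mild_picard_limit p1 bphi phi0 u0B sF mu_ (ltW TT') B0 BC C0.
rewrite -/v in sv mv; clearbody v.
(* At positive times this is v; but v vanishes for t <= 0, so that the initial values have to come
   from u. *)
pose w x t := if t < T then u x t else v x t.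
have wv x t : 0 < t -> w x t = v x t.
  by move=> t0; rewrite /w; case: ifP => // tT; rewrite vu// t0.
have wB y s : 0 < s < T' -> 0 <= w y s <= C by move=> /andP[s0 _]; rewrite wv.
have E : on_time T' (fun y s => reaction p (w y s)) = on_time T' (fun y s => reaction p (v y s)).
  by apply/funext => y; apply/funext => s; rewrite /on_time; case: ifP => // /andP[s0 _]; rewrite wv.
have sw : source 0 (C `^ p) (on_time T' (fun y s => reaction p (w y s))) by rewrite E.
have mw : mild T' phi (fun y s => reaction p (w y s)) w.
  by move=> x t tT; rewrite E wv ?mv//; case/andP: tT.
clear E sv mv.
have cl := mild_classical p1 bphi phi0 wB sw mw.
exists T', w; split=> //; last by move=> x t tT; rewrite /w tT.
split.
- apply/subspace_continuousP => -[x t]/= [t0 tT'].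
  (* Before T, and in particular at time 0, continuity is inherited from u; from T on it follows
     from the mild formula. *)
  have [tT|Tt] := ltP t T.
    have /subspace_continuousP/(_ (x, t)) := solution_continuous su.
    have tT0 : 0 <= (x, t).2 /\ ((x, t).2%:E < T%:E)%E by rewrite lte_fin.
    move=> /(_ tT0) /cvgrPdist_lt cu; apply/cvgrPdist_lt => e /cu.
    rewrite !near_withinE => {}cu.
    have nT : \forall z \near (x, t), z.2 < T by exact: near_time_lt.
    apply: filterS2 cu nT => z uz zT [z0 _].
    suff : `|w x t - w z.1 z.2| < e by [].
    by rewrite /w tT zT; apply: uz; split=> //; rewrite lte_fin.
  apply: cvg_within_filter.
  have tt : 0 < t < T' by rewrite (lt_le_trans T0 Tt) -lte_fin.
  exact: (continuous_mild bphi sw mw tt).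
- by move=> x; rewrite /w T0 (solution_initial su).
- move=> x t t0; rewrite lte_fin => tT'; have tt : 0 < t < T' by rewrite t0.
  have [[dt _] dx dxx] := cl x t tt.
  by split; [exact: dt|move=> i; split; [exact: dx|exact: dxx]].
- move=> x t t0; rewrite lte_fin => tT'; have tt : 0 < t < T' by rewrite t0.
  by have [[_ ->] _ _] := cl x t tt.
- move=> x t t0; rewrite lte_fin => tT'; rewrite /w; case: ifP => // tT.
    by apply: (solution_ge0 su) => //; rewrite lte_fin.
  by have /andP[] := vB x t.
- move=> S; rewrite lte_fin => ST'; exists C => x t /andP[t0 tS].
  rewrite /w; case: ifP => tT; last by have /andP[? ?] := vB x t; rewrite ger0_norm.
  have [t00|t00] := ltP 0 t.
    have tt : 0 < t < T by rewrite t00.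
    by have /andP[? uB'] := u0B x t tt; rewrite ger0_norm// (le_trans uB').
  have -> : t = 0 by lra.
  by rewrite (solution_initial su) (le_trans (bphi.2 x)).
- move=> x t t0; rewrite lte_fin => tT'; have tt : 0 < t <= T' by rewrite t0 ltW.
  rewrite (integral_duhamel x sw) => [|y s|//]; last first.
    by apply: on_time_ge0 => {}y {}s /(wB y)/andP[w0 _]; exact: reaction_ge0.
  by rewrite (heat_integral _ bphi t0) -EFinD mw// t0.
Qed.

End extension.

(** * Blow-up of maximal solutions *)

Section blow_up.
Context (R : realType) (n : nat).
Implicit Types (x y : 'rV[R]_n) (t s : R) (u w : 'rV[R]_n -> R -> R).
Local Notation mu := (lebesgue_rV R n).

Lemma solution_bound p phi (T : \bar R) u (S : R) : is_solution p phi T u -> (S%:E < T)%E ->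
  exists2 B : R, 0 <= B & forall x t, 0 <= t <= S -> 0 <= u x t <= B.
Proof.
move=> su ST; have [B uB] := solution_bounded su ST.
exists `|B| => // x t tS; have /andP[t0 tS'] := tS; apply/andP; split.
  by apply: (solution_ge0 su) => //; apply: le_lt_trans ST; rewrite lee_fin.
exact: le_trans (ler_norm _) (le_trans (uB x t tS) (ler_norm _)).
Qed.

Lemma solution_bounded_section p phi (T : \bar R) u t : is_solution p phi T u ->
  0 < t -> (t%:E < T)%E -> continuous (u ^~ t) /\ exists B, bounded_by B (u ^~ t).
Proof.
move=> su t0 tT.
have [S tS ST] : exists2 S : R, t < S & (S%:E <= T)%E.
  case: T tT {su} => [T| |//]; first by exists T.
  by exists (t + 1); [rewrite ltrDl|rewrite leey].
have cu : continuous (u ^~ t).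
  move=> x; apply: (continuous_section (f := u)).
  by apply: (solution_continuous_slab su ST); rewrite inE/= t0.
split=> //; have [B _ uB] := solution_bound su tT.
exists B; split=> [|y]; first by apply: (open_continuous_measurable_rV openT) => x _; exact: cu.
have tt : 0 <= t <= t by rewrite lexx ltW.
by have /andP[? ?] := uB y t tt; rewrite ger0_norm.
Qed.

Lemma solution_le_Lnorm p phi (T : \bar R) u t (a : R) x : is_solution p phi T u ->
  0 < t -> (t%:E < T)%E -> 0 <= a ->
  (Lnorm mu +oo%E (fun x => (u x t)%:E) <= a%:E)%E -> u x t <= a.
Proof.
move=> su t0 tT a0; have [cu [B bu]] := solution_bounded_section su t0 tT.
rewrite unlock /Lnorm; case: ifPn => [_|].
  move=> /ess_supP ua; apply: (continuous_ae_le bu) => //; last 2 first.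
  - exact: cu.
  - by apply: filterS ua => y /=; rewrite !lee_fin; exact/le_trans/ler_norm.
  - by move=> y; apply: (solution_ge0 su) => //; exact: ltW.
(* On a null space the norm would be 0 by convention; a ball of positive measure excludes this. *)
rewrite -leNgt => m0; exfalso.
suff : (0 < (0 : \bar R))%E by rewrite ltxx.
apply: lt_le_trans (lebesgue_eball_gt0 n (ltr01 : 0 < 1 :> R)) (le_trans _ m0).
by apply: le_measure; rewrite ?inE//; exact: measurable_eball.
Qed.

Lemma maximal_solution_blows_up p M phi (T : R) u : 1 < p -> bounded_by M phi ->
  (forall y, 0 <= phi y) -> is_maximal_solution p phi T%:E u -> blows_up T%:E u.
Proof.
move=> p1 bphi phi0 [T0' su maxT]; rewrite lte_fin in T0'.
split; first exact: ltry.
apply/cvgeyPge => A0; apply: contrapT => H.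
pose A := Num.max A0 1.
have A1 : 0 < A by rewrite lt_max ltr01 orbT.
have A0A : A0 <= A by rewrite le_max lexx.
clearbody A.
have A2 : 0 < (2 * A) `^ p by rewrite powR_gt0// mulr_gt0.
(* The time during which a solution starting below A stays below 2 A: its source is then at most (2
   A)^p, and tau (2 A)^p = A / 2. If the norm did not tend to +oo, some t1 within tau of T would
   have u(t1) <= A. *)
pose tau := A / 2 / (2 * A) `^ p.
have tau0 : 0 < tau by rewrite !divr_gt0.
have [t1 [t10 t1T tauT uA]] : exists t1, [/\ 0 < t1, t1 < T, T - tau <= t1 & forall y, u y t1 <= A].
  apply: contrapT => H'; apply: H.
  near=> t; apply: contrapT => Nt; apply: H'; exists t.
  have t0 : 0 < t by near: t; exact: nbhs_left_gt.
  have tT : t < T by near: t; exact: nbhs_left_lt.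
  split=> //.
    near: t; apply: nbhs_left_ge; first by rewrite ltrBlDr ltrDl.
  move=> y; apply: (solution_le_Lnorm y su t0); rewrite ?lte_fin//; first exact: ltW.
  move/negP: Nt; rewrite -ltNge => /ltW/le_trans; apply; rewrite lee_fin//.
have uA2 x t : t1 <= t < T -> u x t <= 2 * A.
  move=> /andP[t1t tT].
  (* The solution is bounded on [0, S] by some B depending on S; the bound 2 A obtained at t does
     not depend on S, which can be as close to T as needed. *)
  pose S := (t + T) / 2.
  have tS : t < S by rewrite /S; lra.
  have ST : S < T by rewrite /S; lra.
  clearbody S.
  have ST' : (S%:E < T%:E)%E by rewrite lte_fin.
  have [B B0 uB] := solution_bound su ST'.
  have uB' y s : 0 < s < S -> 0 <= u y s <= B.
    by move=> /andP[s0 sS]; apply: uB; rewrite !ltW.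
  have [sF mv] := solution_mild p1 B0 bphi su (ltW ST') (fun y s ss => (andP (uB' y s ss)).2).
  apply: (mild_bootstrap p1 bphi phi0 uB' sF mv x t10 t1t tS A1 _ uA).
  have E : tau * (2 * A) `^ p = A / 2 by rewrite /tau divfK// gt_eqF.
  by rewrite -E; apply: ler_wpM2r; [exact: ltW|lra].
have t1T' : (t1%:E < T%:E)%E by rewrite lte_fin.
have [B B0 uB] := solution_bound su t1T'.
have B1 : 0 <= Num.max B (2 * A) by rewrite le_max B0.
have uB' x t : 0 < t < T -> u x t <= Num.max B (2 * A).
  move=> /andP[t0 tT]; rewrite le_max; have [tt1|t1t] := leP t t1.
    have tt : 0 <= t <= t1 by rewrite (ltW t0).
    by have /andP[_ ->] := uB x t tt.
  by rewrite uA2 ?orbT// tT ltW.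
have [T' [w [TT' sw wu]]] := bounded_solution_extends p1 T0' B1 bphi phi0 su uB'.
have TT'E : (T%:E <= T'%:E)%E by rewrite lee_fin ltW.
have [E] := maxT T'%:E w TT'E sw (fun x t _ tT => wu x t tT).
by rewrite E ltxx in TT'.
Unshelve. all: by end_near. Qed.

End blow_up.

(** * The life span *)

Section life_span.
Context (R : realType) (n : nat).
Implicit Types (x y : 'rV[R]_n) (t s a : R) (u w : 'rV[R]_n -> R -> R) (phi : 'rV[R]_n -> R).
Local Notation mu := (lebesgue_rV R n).

Lemma density_ge0 (E : set 'rV[R]_n) (r : R) : (0 <= density E r)%E.
Proof. by rewrite /density mule_ge0// inve_ge0. Qed.

Lemma upper_density_ge0 phi a : (0 <= upper_density phi a)%E.
Proof.
by apply: limf_esup_ge0 => [|r]; [exact: filter_not_empty|exact: density_ge0].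
Qed.

Lemma upper_density0_rarefaction phi a :
  (upper_density phi a <= 0)%E -> rarefaction_set [set x | a <= phi x].
Proof.
move=> D0.
have H (e : R) : 0 < e -> \forall r \near +oo, (density [set x | (a <= phi x)%R] r < e%:E)%E.
  move=> e0; have : (upper_density phi a < e%:E)%E by rewrite (le_lt_trans D0)// lte_fin.
  rewrite /upper_density /limf_esup => /ereal_inf_lt[_ [B FB <-] Be].
  apply: filterS FB => r Br; apply: le_lt_trans Be.
  by apply: ereal_sup_ubound; exists r.
apply/fine_cvgP; split.
  by apply: filterS (H 1 ltr01) => r r1; rewrite ge0_fin_numE ?density_ge0// (lt_trans r1)// ltry.
apply/cvgrPdist_lt => e e0; apply: filterS (H e e0) => r re /=.
rewrite sub0r normrN ger0_norm ?fine_ge0 ?density_ge0//.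
by rewrite -lte_fin fineK// ge0_fin_numE ?density_ge0// (lt_trans re)// ltry.
Qed.

Lemma upper_density_lty M phi a : bounded_by M phi -> (forall y, 0 <= phi y) -> 0 < a ->
  (upper_density phi a < +oo)%E.
Proof.
move=> bphi phi0 a0; have M0 := bounded_by_ge0 bphi.
apply: le_lt_trans (ltry (M / a)).
apply: (upper_density_le_heat ltr01 a0 bphi phi0); first by rewrite divr_ge0// ltW.
move=> x; rewrite mulrC divfK ?gt_eqF//.
exact: le_trans (ler_norm _) (heat_norm_le _ _ bphi).
Qed.

Lemma solution_time_bound p M phi (T : \bar R) u (S a L : R) : 1 < p -> bounded_by M phi ->
  (forall y, 0 <= phi y) -> is_solution p phi T u -> 0 < S -> (S%:E < T)%E ->
  0 < a -> 0 < L -> (L%:E < upper_density phi a)%E -> (p - 1) * S <= (a * L) `^ (1 - p).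
Proof.
move=> p1 bphi phi0 su S0 ST a0 L0 LD.
have [x xL] : exists x, a * L < heat phi x S.
  apply: contrapT => H; move: LD; apply/negP; rewrite -leNgt.
  apply: (upper_density_le_heat S0 a0 bphi phi0 (ltW L0)) => x.
  by rewrite leNgt; apply/negP => xL; apply: H; exists x.
have [B B0 uB] := solution_bound su ST.
have uB' y s : 0 < s < S -> 0 <= u y s <= B.
  by move=> /andP[s0 sS]; apply: uB; rewrite !ltW.
have uB2 y s : 0 < s < S -> u y s <= B by move=> /(uB' y)/andP[].
have [sF mv] := solution_mild p1 B0 bphi su (ltW ST) uB2.
have aL0 : 0 < a * L by rewrite mulr_gt0.
apply: le_trans (mild_time_bound p1 S0 bphi phi0 sF _ mv (lt_trans aL0 xL)) _.
  by move=> y s /(uB' y)/andP[].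
by rewrite -(opprB p 1); apply: powRN_anti => //; [lra|exact: ltW].
Qed.

Lemma powR_inv_bound (q X z : R) : 0 < q -> 0 < X -> 0 <= z ->
  (z <= X^-1 `^ q^-1) <-> (z `^ q <= X^-1).
Proof.
move=> q0 X0 z0; have iX : 0 <= X^-1 by rewrite invr_ge0 ltW.
have mono (r b c : R) : 0 < r -> 0 <= b -> b <= c -> b `^ r <= c `^ r.
  by move=> r0 b0 bc; apply: ge0_ler_powR => //; [exact: ltW|exact: le_trans bc].
split=> H.
  have := mono q _ _ q0 z0 H; by rewrite -powRrM mulVf ?gt_eqF// powRr1.
have := mono q^-1 (z `^ q) X^-1; rewrite invr_gt0 powR_ge0 => /(_ q0 isT H).
by rewrite -powRrM mulfV ?gt_eqF// powRr1.
Qed.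

Lemma life_span_le p M phi (T : \bar R) u a (d : R) : 1 < p -> bounded_by M phi ->
  (forall y, 0 <= phi y) -> is_solution p phi T u -> 0 < a -> 0 < d ->
  upper_density phi a = d%:E -> (T <= ((p - 1)^-1 * (a * d) `^ (1 - p))%:E)%E.
Proof.
move=> p1 bphi phi0 su a0 d0 Dd.
have q0 : 0 < p - 1 by lra.
have ad0 : 0 < a * d by rewrite mulr_gt0.
have main (S : R) : 0 < S -> (S%:E < T)%E -> S <= (p - 1)^-1 * (a * d) `^ (1 - p).
  move=> S0 ST; rewrite ler_pdivlMl//.
  have X0 : 0 < (p - 1) * S by rewrite mulr_gt0.
  have E (z : R) : 0 < z -> ((p - 1) * S <= z `^ (1 - p)) <-> z <= ((p - 1) * S)^-1 `^ (p - 1)^-1.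
    move=> z0; have zq : 0 < z `^ (p - 1) by rewrite powR_gt0.
    rewrite (powR_inv_bound q0 X0 (ltW z0)) -(opprB p 1) powRN.
    by split; rewrite -?[X in _ -> X]lef_pV2 ?posrE ?invrK ?invr_gt0// => H;
      rewrite -lef_pV2 ?posrE ?invrK ?invr_gt0.
  apply/(E _ ad0); rewrite leNgt; apply/negP => zad.
  set z := powR _ _ in zad.
  have z0 : 0 <= z by exact: powR_ge0.
  pose L := (z / a + d) / 2.
  have zd : z / a < d by rewrite ltr_pdivrMr// mulrC.
  have za : 0 <= z / a by rewrite divr_ge0// ltW.
  have L0 : 0 < L by rewrite /L; lra.
  have Ld : L < d by rewrite /L; lra.
  have zL : z / a < L by rewrite /L; lra.
  have aL : 0 < a * L by rewrite mulr_gt0.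
  have : (L%:E < upper_density phi a)%E by rewrite Dd lte_fin.
  move=> /(solution_time_bound p1 bphi phi0 su S0 ST a0 L0)/(E _ aL).
  by apply/negP; rewrite -ltNge -/z mulrC -ltr_pdivrMr.
set b := (p - 1)^-1 * _ in main *.
have b0 : 0 <= b by rewrite mulr_ge0 ?powR_ge0// invr_ge0 ltW.
rewrite leNgt; apply/negP => bT.
have [S [bS ST]] : exists S : R, b < S /\ (S%:E < T)%E.
  case: T bT {su main} => [r| |//]; last by exists (b + 1); rewrite ltry ltrDl.
  by rewrite lte_fin => br; exists ((b + r) / 2); rewrite lte_fin; split; lra.
by have := main S (le_lt_trans b0 bS) ST; rewrite leNgt bS.
Qed.

End life_span.

Theorem theorem1p1 (R : realType) (n : nat) (p : R) (phi : 'rV[R]_n -> R)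
    (T : \bar R) (u : 'rV[R]_n -> R -> R)
    (n1 : (1 <= n)%N) (p1 : 1 < p)
    (phi_ge0 : forall x, 0 <= phi x)
    (phi_bounded : exists M : R, forall x, phi x <= M)
    (phi_continuous : continuous phi)
    (phi_neq0 : exists x, phi x <> 0)
    (uT : is_maximal_solution p phi T u)
    (phi_rare : ~ rarefaction_fun phi) :
  blows_up T u /\
  (T <= ((p - 1)^-1)%:E *
    ereal_inf [set npoweR (a%:E * upper_density phi a) (1 - p) |
                a in [set a : R | (0 < a)%R]])%E.
Proof.
have [M phiM] := phi_bounded.
have bphi : bounded_by M phi.
  split=> [|y]; last by rewrite ger0_norm.
  by apply: (open_continuous_measurable_rV openT) => x _; exact: phi_continuous.
have [T0 su maxT] := uT.
have Tle a : 0 < a -> upper_density phi a != 0%E ->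
    exists d : R, [/\ 0 < d, upper_density phi a = d%:E & (T <= ((p - 1)^-1 * (a * d) `^ (1 - p))%:E)%E].
  move=> a0 D0.
  have := upper_density_ge0 phi a; have := upper_density_lty bphi phi_ge0 a0.
  case Dd : (upper_density phi a) => [d| |] //.
  rewrite lee_fin => _ d0.
  exists d; have {}d0 : 0 < d by rewrite lt_neqAle d0 andbT eq_sym -eqe -Dd.
  by split=> //; exact: life_span_le bphi phi_ge0 su a0 d0 Dd.
split.
  have [a [a0 ra]] : exists a, 0 < a /\ ~ rarefaction_set [set x | a <= phi x].
    apply: contrapT => H; apply: phi_rare => a a0; apply: contrapT => ra.
    by apply: H; exists a.
  have [|d [_ _ Td]] := Tle a a0.
    by apply: contra_notN ra => /eqP D0; apply: upper_density0_rarefaction; rewrite D0.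
  case: T T0 Td uT {su maxT Tle} => [r _ _ uT| _ |]; last by [].
    exact: maximal_solution_blows_up p1 bphi phi_ge0 uT.
  by rewrite leye_eq.
rewrite lee_pdivlMl ?subr_gt0//; apply: le_ereal_inf_tmp => _ [a a0 <-].
rewrite /npoweR; have [->|D0] := eqVneq (upper_density phi a) 0%E.
  by rewrite mule0 eqxx leey.
have [d [d0 -> Td]] := Tle a a0 D0.
rewrite -EFinM eqe mulf_eq0 !gt_eqF//= -lee_pdivlMl ?subr_gt0//.
Qed.
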